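(* Let $\Theta=(\theta_m)_{m\ge1}$ be a sequence of non-negative real numbers, and let $K_{0n}$ be the total number of cycles of a random permutation in $S_n$ distributed according to $\mathbb{P}_\Theta$. Let $P_{K+\theta\log n}$ be a Poisson distributed random variable with parameter $K+\theta\log n$, where $K$ is the constant attached to the class of $g_\Theta$ below. (i) If $g_\Theta$ is of class $\mathcal{F}(r,\theta)$, then $$d_{loc}(K_{0n},P_{K+\theta\log n})\le\frac{c_1}{\log n},\qquad d_K(K_{0n},P_{K+\theta\log n})\le\frac{c_2}{\sqrt{\log n}}$$ with $c_1>0$, $c_2>0$ independent of $n$. (ii) If $g_\Theta$ is of class $e\mathcal{F}(r,\theta,\gamma)$, then $$d_{loc}(K_{0n},P_{K+\theta\log n})\le\frac{c_3}{\log n}$$ with $c_3>0$ independent of $n$.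
   Context: The bounds are understood for those $n\ge2$ for which the objects are defined (i.e. $h_n>0$ and the Poisson parameter is positive). For integer-valued random variables $X,Y$ with laws $\mu,\nu$: the point metric is $d_{loc}(X,Y)=\sup_{j\in\mathbb{Z}}|\mu\{j\}-\nu\{j\}|$ and the Kolmogorov distance is $d_K(X,Y)=\sup_{j\in\mathbb{Z}}|\mu((-\infty,j])-\nu((-\infty,j])|$. For $\sigma$ in the symmetric group $S_n$, $C_m^{(n)}(\sigma)$ is the number of cycles of length $m$ in the disjoint cycle decomposition of $\sigma$, and $K_{0n}=\sum_{m=1}^nC_m^{(n)}$. The weighted measure on $S_n$ is $\mathbb{P}_\Theta[\sigma]=\frac{1}{h_n n!}\prod_{m=1}^n\theta_m^{C_m^{(n)}(\sigma)}$, with normalization $h_n=\frac1{n!}\sum_{\sigma\in S_n}\prod_{m=1}^n\theta_m^{C_m^{(n)}(\sigma)}$. Put $g_\Theta(t)=\sum_{k\ge1}\frac{\theta_k}{k}t^k$. For $0<r<R$ and $0<\phi<\pi/2$ let $\Delta_0(r,R,\phi)=\{z\in\mathbb{C}: |z|<R,\ z\ne r,\ |\arg(z-r)|>\phi\}$. For $r>0$ and $\theta\ge0$, a function $g$ is of class $\mathcal{F}(r,\theta)$ if there are $R>r$ and $0<\phi<\pi/2$ such that $g$ is holomorphic in $\Delta_0(r,R,\phi)$, and there is a constant $K$ with $g(t)=\theta\log\frac{1}{1-t/r}+K+O(t-r)$ as $t\to r$. For $r>0$, $\theta\ge0$ and $0<\gamma\le1$, a function $g$ is of class $e\mathcal{F}(r,\theta,\gamma)$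 if $g(t)=\theta\log\frac{1}{1-t/r}+g_0(t)$ with $g_0$ analytic in $\{|t|<r\}$ and $[t^n]g_0=O(r^{-n}n^{-1-\gamma})$, where $[t^n]g_0$ is the coefficient of $t^n$; in this case one puts $K=g_0(r)=\sum_n([t^n]g_0)\,r^n$. For the formal power series $g_\Theta$, being of such a class means that it converges near $0$ and its sum (analytically continued if necessary) has the stated properties.
   Formalization: The formal statement assumes θ > 0 in both parts; for θ = 0 the claim fails, e.g. Θ = (1,0,0,…), g_Θ(t) = t, K = r, where K_{0n} = n but the Poisson law of parameter r gives 0 the fixed mass e^{-r}. *)

(* Defs.v *)
From HB Require Import structures.
From mathcomp Require Import all_boot all_order all_algebra all_fingroup.
From mathcomp Require Import all_classical all_reals all_analysis.
From mathcomp Require Import complex.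

Set Implicit Arguments.
Unset Strict Implicit.
Unset Printing Implicit Defensive.

Import Order.TTheory GRing.Theory Num.Theory numFieldNormedType.Exports.
Local Open Scope classical_set_scope.
Local Open Scope ring_scope.
Local Open Scope complex_scope.

(* The regular module R[i]^o carries the topology and the normed-module
   structure of the field R[i]; the norm `|z| is the modulus, as an element
   of R[i], and [Normc.normc z] is the modulus as an element of R. *)
Notation Cplx R := (complex R)^o.

Section ComplexLog.
Variable R : realType.
Implicit Type z : Cplx R.

(* Principal values, with argument in ]-pi, pi]. *)
Definition carg z : R :=
  let a := acos (complex.Re z / Normc.normc z) in
  if 0 <= complex.Im z then a else - a.

Definition clog z : Cplx R := ln (Normc.normc z) +i* carg z.

End ComplexLog.

Section Classes.
Variable R : realType.
Implicit Types (g : Cplx R -> Cplx R) (t z K : Cplx R).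
Implicit Types (r rho phi theta gamma : R).

Definition holomorphic_on (D : set (Cplx R)) g :=
  forall z, D z -> derivable g z 1.

Definition Delta0 r rho phi : set (Cplx R) :=
  [set z | [/\ `|z| < rho%:C, z != r%:C & phi < `|carg (z - r%:C)|]].

(* theta * log (1 / (1 - t / r)) *)
Definition log_sing r theta t : Cplx R :=
  theta%:C * clog (1 / (1 - t / r%:C)).

(* [theta = 0] belongs to both classes, but no bound in 1 / log n can hold then:
   a permutation of n >= 1 points has at least one cycle, while the Poisson law
   of fixed parameter K gives mass expR (- K) to 0, so d_loc >= expR (- K). *)
Definition class_F r theta K g :=
  [/\ 0 < r, 0 <= theta &
    exists rho phi,
    [/\ r < rho, 0 < phi < pi / 2, holomorphic_on (Delta0 r rho phi) g &
      exists M : R,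
        \forall t \near within (Delta0 r rho phi) (nbhs (r%:C : Cplx R)),
          `|g t - (log_sing r theta t + K)| <= M%:C * `|t - r%:C|]].

(* [a n] is the n-th Taylor coefficient at 0 of g0, and K = g0(r). *)
Definition class_eF r theta gamma K g :=
  [/\ 0 < r, 0 <= theta, 0 < gamma <= 1 &
    exists (g0 : Cplx R -> Cplx R) (a : nat -> Cplx R),
    [/\ forall t, `|t| < r%:C -> g t = log_sing r theta t + g0 t,
        forall t, `|t| < r%:C -> series (fun n => a n * t ^+ n) @ \oo --> g0 t,
        exists M : R, \forall n \near \oo,
          Normc.normc (a n) <= M * r ^- n * n%:R `^ (- 1 - gamma) &
        series (fun n => a n * r%:C ^+ n) @ \oo --> K]].

(* g is, near 0, the sum of the power series g_Theta; since the domains above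
   are connected and contain 0, a holomorphic g there is its continuation. *)
Definition sum_gTheta (Theta : nat -> R) g :=
  \forall t \near (0 : Cplx R),
    series (fun k => (Theta k.+1 / k.+1%:R)%:C * t ^+ k.+1) @ \oo --> g t.

Definition gTheta_class_F Theta r theta K :=
  exists g, sum_gTheta Theta g /\ class_F r theta K g.

Definition gTheta_class_eF Theta r theta gamma K :=
  exists g, sum_gTheta Theta g /\ class_eF r theta gamma K g.

End Classes.

Section WeightedPermutations.
Variables (R : realType) (Theta : nat -> R) (n : nat).

(* [porbits s] is the set of supports of all cycles, fixed points included. *)
Definition Ccycles (m : nat) (s : 'S_n) : nat :=
  #|[set c in porbits s | #|c| == m]|%SET.

Definition K0 (s : 'S_n) : nat := \sum_(1 <= m < n.+1) Ccycles m s.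

Definition weight (s : 'S_n) : R :=
  \prod_(1 <= m < n.+1) Theta m ^+ Ccycles m s.

Definition hTheta : R := (n`!)%:R^-1 * \sum_(s : 'S_n) weight s.

Definition PTheta (A : set 'S_n) : R :=
  \sum_(s : 'S_n | s \in A) weight s / (hTheta * (n`!)%:R).

End WeightedPermutations.

Section Distances.
Variable R : realType.

Definition law (T : Type) (P : set T -> R) (X : T -> int) : set int -> R :=
  fun A => P (X @^-1` A).

Definition d_loc (mu nu : set int -> R) : R :=
  sup (range (fun j : int => `|mu [set j] - nu [set j]|)).

Definition d_K (mu nu : set int -> R) : R :=
  sup (range (fun j : int => `|mu [set k | k <= j] - nu [set k | k <= j]|)).

Definition law_K0 (Theta : nat -> R) (n : nat) : set int -> R :=
  law (PTheta Theta (n := n)) (fun s => (K0 s)%:Z).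

(* The second argument of [poisson_prob] is a dummy. *)
Definition law_poisson (lambda : R) : set int -> R :=
  law (fun A => fine (poisson_prob lambda 0 A)) Posz.

End Distances.

(* Main.v *)
(* Put b_k = (theta_k r^k - theta) / k. In both classes b_k = O(k^(-1-g)) for some g > 0 and
   the b_k sum to K. For eF this is the definition. For F, the function
   f(t) = g_Theta(r t) - theta log (1 / (1 - t)) - K is O(|t - 1|), so Cauchy estimates on disks
   of radius c |t - 1| bound f(t e^(ih)) + f(t e^(-ih)) - 2 f(t) by O(h^2 / |t - 1|); with
   h = pi / n, averaging over the circle of radius 1 - 1 / (2 n) gives b_n = O(n^(-3/2)).

   Decomposing a permutation along the cycle of a point shows that r^n h_n E[x^K_0n] is the
   coefficient of t^n in (1 - t)^(- theta x) exp (x b(t)) with b(t) = sum_k b_k t^k. A power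
   series in x is read as a signed measure on the naturals, with its total variation norm. In
   that norm the coefficient is, up to a relative error O(n^(-g/2)), the coefficient of t^n in
   (1 - t)^(- theta x) times exp (x b(1)). The former is, up to a constant, a product of
   Bernoulli generating functions with parameters p_j = theta / (j + theta), each equal to the
   Poisson one times 1 + (x - 1) O(p_j^2). As sum_j p_j^2 is bounded, K_0n has the Poisson law
   of parameter K + theta log n times 1 + (x - 1) D with D bounded. Finally (x - 1) times the
   Poisson law of parameter L is O(1 / L) pointwise, and its partial sums are O(1 / sqrt L). *)
Require Import Defs.
From HB Require Import structures.
From mathcomp Require Import all_boot all_order all_algebra all_fingroup.
From mathcomp Require Import all_classical all_reals all_analysis.
From mathcomp Require Import complex.
From mathcomp Require Import ring lra zify.
Import Order.TTheory GRing.Theory Num.Theory numFieldNormedType.Exports.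
Local Open Scope classical_set_scope.
Local Open Scope ring_scope.
Local Open Scope complex_scope.
Set Implicit Arguments.
Unset Strict Implicit.
Unset Printing Implicit Defensive.

(** The bound f = O(|t - 1|) alone yields only b_n = O(1) when averaged over circles. That it holds
    in a domain reaching beyond the unit circle makes f smooth at the scale |t - 1|, and the second
    difference turns smoothness into decay. The mean of 1 / |t - 1| is bounded through the mean of
    its square, which Parseval's identity controls; the price is a factor sqrt n instead of log n,
    but any exponent below -1 is enough.

    Estimates in x need no inversion formula: the total variation norm is submultiplicative and
    dominates both distances. What matters is that the main error always appears as a factor 1 + (x
    - 1) D. This form is stable under products, and x - 1 is what gains 1 / L or 1 / sqrt L in the
    end.

    The normalization h_n is not estimated on its own: up to the factor r^n it is the total mass of
    the measure at hand, and is compared with the constant in front of the Poisson law. *)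

(** * Complex modulus, limits and differentiability with real epsilons *)

Section Modulus.
Variable R : realType.
Implicit Types (z w : R[i]) (x y : R).

Definition cm z : R := Normc.normc z.

Lemma cmE z : cm z = Num.sqrt (complex.Re z ^+ 2 + complex.Im z ^+ 2).
Proof. by case: z. Qed.

Lemma norm_cm z : `|z| = (cm z)%:C.
Proof. by rewrite normc_def cmE. Qed.

Lemma cm0 : cm 0 = 0. Proof. exact: Normc.normc0. Qed.
Lemma cm1 : cm 1 = 1. Proof. exact: Normc.normc1. Qed.
Lemma cmM z w : cm (z * w) = cm z * cm w. Proof. exact: Normc.normcM. Qed.
Lemma cmV z : cm z^-1 = (cm z)^-1. Proof. exact: Normc.normcV. Qed.
Lemma cmD z w : cm (z + w) <= cm z + cm w. Proof. exact: le_normcD. Qed.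
Lemma cmN z : cm (- z) = cm z. Proof. exact: normcN. Qed.
Lemma cmB z w : cm (z - w) <= cm z + cm w.
Proof. by rewrite -(cmN w) cmD. Qed.
Lemma cmC z w : cm (z - w) = cm (w - z).
Proof. by rewrite -cmN opprB. Qed.
Lemma cm_ge0 z : 0 <= cm z. Proof. by rewrite cmE sqrtr_ge0. Qed.
Lemma cm_eq0 z : (cm z == 0) = (z == 0).
Proof.
apply/eqP/eqP => [/Normc.eq0_normc //|->]; exact: cm0.
Qed.
Lemma cm_gt0 z : (0 < cm z) = (z != 0).
Proof. by rewrite lt_def cm_ge0 cm_eq0 andbT. Qed.
Lemma cm_real x : cm x%:C = `|x|.
Proof. by rewrite cmE /= expr0n addr0 sqrtr_sqr. Qed.
Lemma cmX z n : cm (z ^+ n) = cm z ^+ n.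
Proof. by elim: n => [|n IH]; rewrite ?expr0 ?cm1 // !exprS cmM IH. Qed.
Lemma cm_sum (I : Type) (r : seq I) (P : pred I) (F : I -> R[i]) :
  cm (\sum_(i <- r | P i) F i) <= \sum_(i <- r | P i) cm (F i).
Proof.
elim/big_rec2: _ => [|i x y _ le]; first by rewrite cm0.
by rewrite (le_trans (cmD _ _)) // lerD2l.
Qed.
Lemma cm_tri z w : cm z - cm w <= cm (z - w).
Proof. by rewrite lerBlDr (le_trans _ (cmD _ _)) // subrK. Qed.
Lemma Re_le_cm z : `|complex.Re z| <= cm z.
Proof.
rewrite cmE -sqrtr_sqr ler_sqrt; last by rewrite addr_ge0 ?sqr_ge0.
by rewrite lerDl sqr_ge0.
Qed.
Lemma Im_le_cm z : `|complex.Im z| <= cm z.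
Proof.
rewrite cmE -sqrtr_sqr ler_sqrt; last by rewrite addr_ge0 ?sqr_ge0.
by rewrite lerDr sqr_ge0.
Qed.
Lemma cm_i : cm 'i = 1.
Proof. by rewrite cmE /= expr0n expr1n add0r sqrtr1. Qed.
Lemma cm_le_ReIm z : cm z <= `|complex.Re z| + `|complex.Im z|.
Proof.
case: z => x y; rewrite {1}(_ : x +i* y = x%:C + 'i * y%:C); last first.
  by rewrite [LHS]complexE.
by rewrite (le_trans (cmD _ _)) // cmM !cm_real cm_i mul1r.
Qed.
(** A positive element of [R[i]] is real, so the radius of a neighbourhood may be taken in [R]. *)
Lemma cnearP z (P : Cplx R -> Prop) :
  (\forall t \near (z : Cplx R), P t) <->
  exists2 d : R, 0 < d & forall t, cm (t - z) < d -> P t.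
Proof.
split.
- move=> /nbhs_ballP[e /= e0 He].
  have eE : e = (complex.Re e)%:C.
    by rewrite RRe_real // gtr0_real.
  exists (complex.Re e); first by rewrite -ltcR -eE.
  by move=> t ht; apply: He; rewrite /ball /= norm_cm eE ltcR cmC.
- case=> d d0 Hd; apply/nbhs_ballP; exists d%:C; first by rewrite /= ltcR.
  by move=> t; rewrite /ball /= norm_cm ltcR cmC; apply: Hd.
Qed.

Definition ccvg (u : nat -> R[i]) (l : R[i]) :=
  forall e : R, 0 < e -> exists N : nat, forall n, (N <= n)%N -> cm (u n - l) < e.

Lemma ccvgP (u : nat -> Cplx R) (l : Cplx R) : (u @ \oo --> l) <-> ccvg u l.
Proof.
split.
- move=> /cvgrPdist_lt h e e0.
  have /h [N _ HN] : 0 < e%:C by rewrite ltcR.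
  by exists N => n Nn; have := HN n Nn; rewrite norm_cm ltcR cmC.
- move=> h; apply/cvgrPdist_lt => e e0.
  have eE : e = (complex.Re e)%:C by rewrite RRe_real // gtr0_real.
  have [|N HN] := h (complex.Re e); first by rewrite -ltcR -eE.
  exists N => // n /= Nn; rewrite norm_cm eE ltcR cmC; exact: HN.
Qed.

(** The difference quotient is cleared of its denominator: [w = z] is no exception, and the estimate
    has the form that Goursat's argument consumes. *)
Definition cdiff_at (g : R[i] -> R[i]) z d :=
  forall e : R, 0 < e -> exists2 h : R, 0 < h &
    forall w, cm (w - z) < h -> cm (g w - g z - d * (w - z)) <= e * cm (w - z).

Definition cdiff (g : R[i] -> R[i]) z := exists d, cdiff_at g z d.

Lemma derivable_cdiff (g : Cplx R -> Cplx R) (z : Cplx R) :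
  derivable g z 1 -> cdiff g z.
Proof.
move=> /cvg_ex[d] /cvgrPdist_lt h; exists d => e e0.
have /h : 0 < e%:C by rewrite ltcR.
move=> {}h.
have /cnearP[r r0 Hr] : \forall t \near (0 : Cplx R), t != 0 ->
    `|d - t^-1 *: ((g \o shift z) t%:A - g z)| < e%:C := h.
exists r => // w wr.
have [->|wz] := eqVneq w z; first by rewrite !subrr mulr0 subrr cm0 mulr0.
have := Hr (w - z); rewrite subr0 subr_eq0 => /(_ wr wz).
rewrite norm_cm ltcR /= => /ltW H.
have wz0 : w - z != 0 by rewrite subr_eq0.
have := ler_wpM2r (cm_ge0 (w - z)) H.
rewrite -cmM -cmN; congr (cm _ <= _).
have -> : (w - z) *: (1 : Cplx R) + z = w by rewrite /GRing.scale /= mulr1 subrK.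
by rewrite /GRing.scale /=; field.
Qed.

End Modulus.

(** * Cauchy's formula and Taylor expansion in the unit disk *)

Section SegmentIntegral.
Variable R : realType.
Implicit Types (a b m : R) (f g : R -> R[i]) (p q : R -> R).

Local Notation mu := (@lebesgue_measure R).
Definition rint p a b : R := Rintegral mu `[a, b] p.

Definition rcont a b p := forall x, a <= x <= b -> forall e, 0 < e ->
  exists2 d : R, 0 < d &
    forall y, a <= y <= b -> `|y - x| < d -> `|p y - p x| < e.

Lemma rcont_within a b p : rcont a b p -> {within `[a, b], continuous p}.
Proof.
move=> h; apply/subspace_continuousP => x /=; rewrite in_itv /= => xab.
apply/cvgrPdist_lt => e e0; have [d d0 Hd] := h x xab e e0.
rewrite near_withinE; apply/nbhs_ballP; exists d => //= y yd yab.
rewrite distrC; apply: Hd; first by move: yab; rewrite /= in_itv.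
by rewrite distrC.
Qed.

Lemma rcont_int a b p : rcont a b p -> mu.-integrable `[a, b] (EFin \o p).
Proof.
move=> h; apply: continuous_compact_integrable; first exact: segment_compact.
exact: rcont_within.
Qed.

Lemma rint_split a m b p : a <= m -> m <= b -> rcont a b p ->
  rint p a b = rint p a m + rint p m b.
Proof.
move=> am mb h; have hi := rcont_int h.
rewrite /rint -(@Rintegral_itv_obnd_cbnd _ m); last first.
  apply: (integrableS _ _ _ hi) => //.
  apply: subset_itv; rewrite ?bnd_simp //.
rewrite -(Rintegral_itvB hi) ?bnd_simp //; last by rewrite addrC subrK.
Qed.

Lemma rintD a b p q : rcont a b p -> rcont a b q ->
  rint (fun x => p x + q x) a b = rint p a b + rint q a b.
Proof. by move=> hp hq; rewrite /rint RintegralD //; apply: rcont_int. Qed.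

Lemma rintZ a b c p : rcont a b p -> rint (fun x => c * p x) a b = c * rint p a b.
Proof. by move=> hp; rewrite /rint RintegralZl //; apply: rcont_int. Qed.

Lemma rint_cst a b c : a <= b -> rint (fun=> c) a b = c * (b - a).
Proof.
move=> ab; rewrite /rint Rintegral_cst //= lebesgue_measure_itv /= lte_fin.
case: ltP => // ba.
by rewrite (_ : b - a = 0) //; apply/eqP; rewrite subr_eq0 eq_le ba ab.
Qed.

Lemma rcont_cst a b c : rcont a b (fun=> c).
Proof.
move=> x _ e e0; exists 1 => // y _ _; by rewrite subrr normr0.
Qed.

Lemma rcontZ a b c p : rcont a b p -> rcont a b (fun x => c * p x).
Proof.
move=> hp x xab e e0.
have e20 : 0 < e / (`|c| + 1) by rewrite divr_gt0 // ltr_wpDl.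
have [d d0 Hd] := hp x xab _ e20; exists d => // y yab yx.
rewrite -mulrBr normrM (le_lt_trans (ler_wpM2l (normr_ge0 c) (ltW (Hd y yab yx)))) //.
by rewrite mulrA ltr_pdivrMr ?ltr_wpDl // mulrC mulrDr mulr1 ltrDl.
Qed.

Lemma rint_le a b p M : a <= b -> rcont a b p ->
  (forall x, a <= x <= b -> `|p x| <= M) -> `|rint p a b| <= M * (b - a).
Proof.
move=> ab h hM.
have hc := @rcont_cst a b.
rewrite ler_norml; apply/andP; split.
  rewrite -mulNr -rint_cst //; apply: le_Rintegral; rewrite //.
  - exact/rcont_int.
  - exact/rcont_int.
  - move=> x; rewrite /= in_itv /= => /hM; rewrite ler_norml => /andP[]//.
rewrite -rint_cst //; apply: le_Rintegral; rewrite //.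
  - exact/rcont_int.
  - exact/rcont_int.
- move=> x; rewrite /= in_itv /= => /hM; rewrite ler_norml => /andP[]//.
Qed.

Lemma rint_FTC a b p F : a <= b -> rcont a b p ->
  (forall x : R, is_derive x 1 F (p x)) -> rint p a b = F b - F a.
Proof.
move=> ab h hF; have [abE|nab] := eqVneq a b.
  subst; rewrite subrr; apply/eqP; rewrite -normr_le0.
  rewrite (le_trans (@rint_le b b p (`|p b|) _ _ _)) // ?subrr ?mulr0 //.
  by move=> x /andP[xb bx]; rewrite (_ : x = b) //; apply/eqP; rewrite eq_le bx xb.
have ltab : a < b by rewrite lt_neqAle nab.
have dF x : derivable F x 1 by have [] := hF x.
have cF : continuous F.
  move=> x; apply: differentiable_continuous; apply/derivable1_diffP; exact: dF.
rewrite /rint /Rintegral (@continuous_FTC2 _ p F) //=.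
- exact: rcont_within.
- split.
  + by move=> x _.
  + apply: cvg_at_right_filter; exact: cF.
  + apply: cvg_at_left_filter; exact: cF.
- by move=> x _; rewrite derive1E; have [_ ->] := hF x.
Qed.

Definition ccont a b f := forall x, a <= x <= b -> forall e, 0 < e ->
  exists2 d : R, 0 < d &
    forall y, a <= y <= b -> `|y - x| < d -> cm (f y - f x) < e.

Definition cint f a b : R[i] :=
  rint (fun x => complex.Re (f x)) a b +i* rint (fun x => complex.Im (f x)) a b.

Lemma ReB (z w : R[i]) : complex.Re (z - w) = complex.Re z - complex.Re w.
Proof. by case: z; case: w. Qed.
Lemma ImB (z w : R[i]) : complex.Im (z - w) = complex.Im z - complex.Im w.
Proof. by case: z; case: w. Qed.

Lemma ccont_Re a b f : ccont a b f -> rcont a b (fun x => complex.Re (f x)).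
Proof.
move=> h x xab e e0; have [d d0 Hd] := h x xab e e0; exists d => // y yab yx.
by rewrite -ReB (le_lt_trans (Re_le_cm _)) // Hd.
Qed.
Lemma ccont_Im a b f : ccont a b f -> rcont a b (fun x => complex.Im (f x)).
Proof.
move=> h x xab e e0; have [d d0 Hd] := h x xab e e0; exists d => // y yab yx.
by rewrite -ImB (le_lt_trans (Im_le_cm _)) // Hd.
Qed.
Lemma ccont_sub a b c d f : a <= c -> d <= b -> ccont a b f -> ccont c d f.
Proof.
move=> ac db h x /andP[cx xd] e e0.
have [|k k0 Hk] := h x _ e e0.
  by rewrite (le_trans ac) //= (le_trans xd).
exists k => // y /andP[cy yd]; apply: Hk.
by rewrite (le_trans ac) //= (le_trans yd).
Qed.
Lemma ccont_cst a b c : ccont a b (fun=> c).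
Proof.
move=> x _ e e0; exists 1 => // y _ _; by rewrite subrr cm0.
Qed.
Lemma ccontD a b f g : ccont a b f -> ccont a b g -> ccont a b (fun x => f x + g x).
Proof.
move=> hf hg x xab e e0.
have e20 : 0 < e / 2 by rewrite divr_gt0.
have [d d0 Hd] := hf x xab _ e20; have [k k0 Hk] := hg x xab _ e20.
exists (Num.min d k); first by rewrite lt_min d0.
move=> y yab; rewrite lt_min => /andP[yd yk].
have -> : f y + g y - (f x + g x) = (f y - f x) + (g y - g x) by ring.
by rewrite (le_lt_trans (cmD _ _)) // (splitr e) ltrD // ?Hd ?Hk.
Qed.
Lemma ccontM a b f g : ccont a b f -> ccont a b g -> ccont a b (fun x => f x * g x).
Proof.
move=> hf hg x xab e e0.
pose M := cm (f x) + cm (g x) + 1.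
have M1 : 1 <= M by rewrite lerDr addr_ge0 // cm_ge0.
have M0 : 0 < M by rewrite (lt_le_trans _ M1).
have e20 : 0 < Num.min 1 (e / 2 / M) by rewrite lt_min ltr01 !divr_gt0.
have [d d0 Hd] := hf x xab _ e20; have [k k0 Hk] := hg x xab _ e20.
exists (Num.min d k); first by rewrite lt_min d0.
move=> y yab; rewrite lt_min => /andP[yd yk].
have -> : f y * g y - f x * g x = (f y - f x) * g x + (g y - g x) * f x
   + (f y - f x) * (g y - g x) by ring.
have := Hd y yab yd; have := Hk y yab yk; rewrite !lt_min => /andP[k1 ke] /andP[d1 de].
have H : cm (f y - f x) * cm (g x) + cm (g y - g x) * cm (f x)
   + cm (f y - f x) * cm (g y - g x) <= e / 2 / M * M.
  rewrite {2}/M 2!mulrDr mulr1 [X in _ <= X + _]addrC.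
  rewrite lerD // ?lerD //; do ?[by rewrite ler_wpM2r ?cm_ge0 // ltW].
  by rewrite -[leRHS]mulr1 ler_pM ?cm_ge0 // ltW.
rewrite (le_lt_trans (cmD _ _)) //.
rewrite (le_lt_trans (lerD (cmD _ _) (lexx _))) //.
rewrite !cmM (le_lt_trans H) // divfK ?lt0r_neq0 //; lra.
Qed.

Lemma cint_split a m b f : a <= m -> m <= b -> ccont a b f ->
  cint f a b = cint f a m + cint f m b.
Proof.
move=> am mb h; rewrite /cint (rint_split am mb (ccont_Re h)).
by rewrite (rint_split am mb (ccont_Im h)).
Qed.

Lemma eq_rint p q a b : (forall x, a <= x <= b -> p x = q x) ->
  rint p a b = rint q a b.
Proof.
by move=> h; apply: eq_Rintegral => x; rewrite inE /= in_itv /= => /h.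
Qed.

Lemma eq_cint f g a b : (forall x, a <= x <= b -> f x = g x) ->
  cint f a b = cint g a b.
Proof. by move=> h; congr (_ +i* _); apply: eq_rint => x /h ->. Qed.

Lemma cintD a b f g : ccont a b f -> ccont a b g ->
  cint (fun x => f x + g x) a b = cint f a b + cint g a b.
Proof.
move=> hf hg; rewrite /cint.
transitivity (rint (fun x => complex.Re (f x) + complex.Re (g x)) a b +i*
   rint (fun x => complex.Im (f x) + complex.Im (g x)) a b).
  by congr (_ +i* _); apply: eq_rint => x _; case: (f x); case: (g x).
by rewrite !rintD //; (exact/ccont_Re || exact/ccont_Im).
Qed.

Lemma cintZ a b c f : ccont a b f ->
  cint (fun x => c * f x) a b = c * cint f a b.
Proof.
move=> hf; rewrite /cint; case: c => u v.
transitivity (rint (fun x => u * complex.Re (f x) + (- v) * complex.Im (f x)) a b +i*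
   rint (fun x => u * complex.Im (f x) + v * complex.Re (f x)) a b).
  congr (_ +i* _); apply: eq_rint => x _; case: (f x) => /= ? ?; ring.
have hr := ccont_Re hf; have hi := ccont_Im hf.
rewrite !rintD ?rintZ //; try exact: rcontZ.
by rewrite mulNr.
Qed.

(** The factor 2 comes from integrating real and imaginary parts separately. It recurs in the Taylor
    bounds, where only the order of magnitude matters. *)
Lemma cint_le a b f M : a <= b -> ccont a b f ->
  (forall x, a <= x <= b -> cm (f x) <= M) -> cm (cint f a b) <= 2 * M * (b - a).
Proof.
move=> ab h hM; rewrite (le_trans (cm_le_ReIm _)) //= -mulrA mulr2n mulrDl mul1r.
rewrite lerD // rint_le //.
- exact: ccont_Re.
- by move=> x /hM; apply: le_trans; exact: Re_le_cm.
- exact: ccont_Im.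
- by move=> x /hM; apply: le_trans; exact: Im_le_cm.
Qed.

Lemma cint_cst a b c : a <= b -> cint (fun=> c) a b = (b - a)%:C * c.
Proof.
move=> ab; rewrite /cint !rint_cst //; case: c => u v; simpc.
by rewrite mulrC (mulrC v).
Qed.

Definition expi (x : R) : R[i] := cos x +i* sin x.

Lemma expi0 : expi 0 = 1. Proof. by rewrite /expi cos0 sin0. Qed.
Lemma expiD x y : expi (x + y) = expi x * expi y.
Proof. by rewrite /expi cosD sinD; simpc; congr (_ +i* _); rewrite addrC. Qed.
Lemma cm_expi x : cm (expi x) = 1.
Proof. by rewrite cmE /= cos2Dsin2 sqrtr1. Qed.
Lemma expi_neq0 x : expi x != 0.
Proof. by rewrite -cm_gt0 cm_expi. Qed.
Lemma expiN x : expi (- x) = (expi x)^-1.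
Proof.
apply: (mulIf (expi_neq0 x)); rewrite mulVf ?expi_neq0 // -expiD addNr; exact: expi0.
Qed.
Lemma expiMn x n : expi (n%:R * x) = expi x ^+ n.
Proof.
elim: n => [|n IH]; first by rewrite mul0r expi0.
by rewrite -natr1 mulrDl mul1r expiD IH exprSr.
Qed.
Lemma expi2pi : expi (2 * pi) = 1.
Proof. by rewrite /expi mulr_natl cos2pi sin2pi. Qed.
Lemma expi_pi : expi pi = -1.
Proof. by rewrite /expi cospi sinpi; apply/eqP; rewrite eq_complex /= oppr0 !eqxx. Qed.

Lemma expi_lip x y : cm (expi x - expi y) <= 2 * `|x - y|.
Proof.
have lip (F f : R -> R) : (forall z : R, is_derive z 1 F (f z)) ->
    (forall z, `|f z| <= 1) -> `|F x - F y| <= `|x - y|.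
  move=> dF f1.
  have cF : continuous F.
    move=> z; apply: differentiable_continuous; apply/derivable1_diffP.
    by have [] := dF z.
  wlog yx : x y / y <= x => [wl|].
    have [h|/ltW h] := leP y x; first exact: wl.
    by rewrite distrC (distrC x); exact: wl.
  have [z _ ->] := @MVT_segment R F f y x yx (fun z _ => dF z)
     (continuous_subspaceT cF).
  by rewrite normrM -[leRHS]mul1r ler_wpM2r.
rewrite (le_trans (cm_le_ReIm _)) //= mulr2n mulrDl mul1r lerD //.
  apply: (lip cos (fun z => - sin z)) => z.
  by rewrite normrN ler_norml sin_geN1 sin_le1.
apply: (lip sin cos) => z.
by rewrite ler_norml cos_geN1 cos_le1.
Qed.

Lemma ccont_lip a b f M : (forall x y, a <= x <= b -> a <= y <= b ->
   cm (f x - f y) <= M * `|x - y|) -> ccont a b f.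
Proof.
move=> h x xab e e0; exists (e / (`|M| + 1)); first by rewrite divr_gt0 // ltr_wpDl.
move=> y yab; rewrite ltr_pdivlMr ?ltr_wpDl // => yx.
apply: le_lt_trans (h _ _ yab xab) _; apply: le_lt_trans yx.
by rewrite mulrC ler_wpM2l // (le_trans (ler_norm _)) // lerDl.
Qed.

Lemma ccont_expi k a b : ccont a b (fun x => expi (k * x)).
Proof.
apply: (@ccont_lip _ _ _ (2 * `|k|)) => x y _ _.
by rewrite (le_trans (expi_lip _ _)) // -mulrBr normrM mulrA.
Qed.

(** Multiplied out by i k, so that [k = 0] is not a separate case. *)
Lemma cint_expi k a b : a <= b ->
  (k%:C * 'i) * cint (fun x => expi (k * x)) a b = expi (k * b) - expi (k * a).
Proof.
move=> ab; have hc := @ccont_expi k a b.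
have hcc := ccont_Re hc; have hs := ccont_Im hc.
have D0 (x : R) : is_derive x 1 (fun y : R => k * y) k.
  by apply: is_derive_eq; rewrite /GRing.scale /= mulr1.
have D1 (x : R) : is_derive x 1 (fun y : R => sin (k * y)) (k * cos (k * x)).
  by have := @is_derive1_comp _ sin _ _ _ _ (is_derive_sin _) (D0 x); rewrite mulrC.
have D2 (x : R) : is_derive x 1 (fun y : R => cos (k * y)) (- k * sin (k * x)).
  have := @is_derive1_comp _ cos _ _ _ _ (is_derive_cos _) (D0 x).
  by rewrite mulNr mulrC mulrN.
have H1 : k * rint (fun x => cos (k * x)) a b = sin (k * b) - sin (k * a).
  by rewrite -rintZ // (rint_FTC ab _ D1) //; exact: rcontZ.
have H2 : (- k) * rint (fun x => sin (k * x)) a b = cos (k * b) - cos (k * a).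
  by rewrite -rintZ // (rint_FTC ab _ D2) //; exact: rcontZ.
rewrite /cint /=; simpc.
by rewrite /expi; simpc; congr (_ +i* _); rewrite -?H1 -?H2 // mulNr.
Qed.

End SegmentIntegral.

(** * Repeated bisection of a square *)

Section SquareInduction.
Variable R : realType.
Implicit Types (x y l p q : R).

(** If [P] failed on the large square, it would fail on one of its quarters, then on a quarter of
    that one, and so on; the nested squares shrink to a point, where the local hypothesis is
    violated. It serves for Goursat's lemma and, in place of compactness, for boundedness. *)
Lemma square_ind (L : R) (P : R -> R -> R -> Prop) : 0 < L ->
  (forall x y l, 0 < l -> P x y l -> P (x + l) y l -> P x (y + l) l ->
     P (x + l) (y + l) l -> P x y (l + l)) ->
  (forall p q, 0 <= p <= L -> 0 <= q <= L -> exists2 d : R, 0 < d &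
     forall x y l, 0 < l < d -> x <= p <= x + l -> y <= q <= y + l -> P x y l) ->
  P 0 0 L.
Proof.
move=> L0 hstep hloc; apply: contrapT => nP.
pose good (s : R * R * R) := 0 < s.2 /\ ~ P s.1.1 s.1.2 s.2.
pose sub (s t : R * R * R) := [/\ t.2 = s.2 / 2, s.1.1 <= t.1.1,
  t.1.1 + t.2 <= s.1.1 + s.2, s.1.2 <= t.1.2 & t.1.2 + t.2 <= s.1.2 + s.2].
have step s : exists t, good s -> good t /\ sub s t.
  have [gs|] := pselect (good s); last by exists s.
  case: s gs => [[x y] l] [/= l0 nPl].
  pose h := l / 2; have h0 : 0 < h by rewrite divr_gt0.
  have lE : l = h + h by rewrite /h -splitr.
  have [[u v] [Hu Hv nQ]] : exists uv : R * R, [/\ (uv.1 == x) || (uv.1 == x + h),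
      (uv.2 == y) || (uv.2 == y + h) & ~ P uv.1 uv.2 h].
    apply: contrapT => H; apply: nPl; rewrite lE; apply: hstep => //.
    - by apply: contrapT => K; apply: H; exists (x, y); rewrite /= !eqxx.
    - by apply: contrapT => K; apply: H; exists (x + h, y); rewrite /= !eqxx orbT.
    - by apply: contrapT => K; apply: H; exists (x, y + h); rewrite /= !eqxx orbT.
    - by apply: contrapT => K; apply: H; exists (x + h, y + h); rewrite /= !eqxx !orbT.
  rewrite /= in Hu Hv nQ.
  exists (u, v, h) => _; split; first by split.
  rewrite /sub /= -/h; split => //; first by case/orP: Hu => /eqP -> //; lra.
  - by case/orP: Hu => /eqP -> //; lra.
  - by case/orP: Hv => /eqP -> //; lra.
  - by case/orP: Hv => /eqP -> //; lra.
have [f Hf] := choice step.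
pose s n := iter n f (0, 0, L).
have gs n : good (s n).
  by elim: n => [|n IH]; [split | have [] := Hf _ IH].
have ss n : sub (s n) (s n.+1) by have [] := Hf _ (gs n).
have sl n : (s n).2 = L / 2 ^+ n.
  elim: n => [|n IH]; first by rewrite expr0 divr1.
  by have [-> _ _ _ _] := ss n; rewrite IH exprS invfM mulrA (mulrAC L).
have mono (X : R * R * R -> R) : (forall n, X (s n) <= X (s n.+1)) ->
    (forall n, X (s n.+1) + (s n.+1).2 <= X (s n) + (s n).2) ->
    exists p, forall n, X (s n) <= p <= X (s n) + (s n).2.
  move=> h1 h2.
  have m1 n m : (n <= m)%N -> X (s n) <= X (s m).
    by elim: m => [|m IH]; rewrite leq_eqVlt => /orP[/eqP->//|//]; rewrite ltnS => /IH /le_trans; apply.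
  have m2 n m : (n <= m)%N -> X (s m) + (s m).2 <= X (s n) + (s n).2.
    elim: m => [|m IH]; rewrite leq_eqVlt => /orP[/eqP->//|//]; rewrite ltnS => /IH.
    by apply: le_trans.
  have ub n m : X (s n) <= X (s m) + (s m).2.
    have := m1 _ _ (leq_maxl n m); move/le_trans; apply.
    apply: le_trans (m2 _ _ (leq_maxr n m)).
    by rewrite lerDl; have [/ltW] := gs (maxn n m).
  exists (sup (range (fun n => X (s n)))) => n; apply/andP; split.
    apply: ub_le_sup; last by exists n.
    by exists (X (s 0%N) + (s 0%N).2) => _ [m _ <-].
  by apply: ge_sup; [exists (X (s 0%N)); exists 0%N | move=> _ [m _ <-]].
have [p Hp] : exists p, forall n, (s n).1.1 <= p <= (s n).1.1 + (s n).2.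
  by apply: (mono (fun s => s.1.1)) => n; have [] := ss n.
have [q Hq] : exists q, forall n, (s n).1.2 <= q <= (s n).1.2 + (s n).2.
  by apply: (mono (fun s => s.1.2)) => n; have [] := ss n.
have [||d d0 Hd] := hloc p q.
- by have := Hp 0%N; rewrite /= add0r.
- by have := Hq 0%N; rewrite /= add0r.
have [n Hn] : exists n, L / 2 ^+ n < d.
  pose n := Num.bound (L / d); exists n.
  rewrite ltr_pdivrMr ?exprn_gt0 // mulrC -ltr_pdivrMr //.
  apply: (lt_trans (archi_boundP _)); first by rewrite divr_ge0 // ltW.
  by rewrite -natrX ltr_nat ltn_expl.
have [/= l0 nPn] := gs n; apply: nPn; apply: Hd => //.
by rewrite l0 sl.
Qed.

End SquareInduction.

Section CauchyTaylor.
Variable R : realType.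
Implicit Types (g : R[i] -> R[i]) (w : R[i]).

Lemma cdiff_cont g w : cdiff g w -> forall e : R, 0 < e ->
  exists2 d : R, 0 < d & forall v, cm (v - w) < d -> cm (g v - g w) < e.
Proof.
move=> [D h] e e0; have [k k0 Hk] := h 1 ltr01.
have c0 : 0 < cm D + 1 + 1 by rewrite ltr_wpDl // addr_ge0 // cm_ge0.
exists (Num.min k (e / (cm D + 1 + 1))); first by rewrite lt_min k0 divr_gt0.
move=> v; rewrite lt_min ltr_pdivlMr // => /andP[vk ve].
apply: le_lt_trans ve; rewrite -(subrK (D * (v - w)) (g v - g w)).
rewrite (le_trans (cmD _ _)) // cmM.
have := Hk v vk; have := cm_ge0 (v - w); rewrite mul1r; nra.
Qed.

Variables (z : R[i]) (z1 : cm z < 1).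
Let B : R := 2 * pi.
Local Notation zeta := (@expi R).

(** For fixed [l], the image of the unit circle under the homothety of centre z and ratio [l]:
    letting [l] go from 1 to 0 contracts the circle to z inside the disk. *)
Definition Wpt (l s : R) : R[i] := z + l%:C * (zeta s - z).
Definition kern (s : R) : R[i] := 'i * (zeta s / (zeta s - z)).

Lemma zeta_z s : 1 - cm z <= cm (zeta s - z).
Proof. by have := cm_tri (zeta s) z; rewrite cm_expi. Qed.
Lemma zeta_z0 s : zeta s - z != 0.
Proof. by rewrite -cm_gt0 (lt_le_trans _ (zeta_z s)) // subr_gt0. Qed.
Lemma zeta_z2 s : cm (zeta s - z) <= 2.
Proof. by rewrite (le_trans (cmB _ _)) // cm_expi (_ : 2 = 1 + 1) // lerD2l ltW. Qed.

Lemma Wpt_disk l s : 0 <= l <= 1 -> cm (Wpt l s) <= 1.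
Proof.
move=> /andP[l0 l1].
have -> : Wpt l s = (1 - l)%:C * z + l%:C * zeta s.
  rewrite /Wpt rmorphB rmorph1 /=; ring.
rewrite (le_trans (cmD _ _)) // !cmM cm_expi !cm_real.
rewrite ger0_norm ?subr_ge0 // ger0_norm // mulr1.
have : (1 - l) * cm z <= (1 - l) * 1 by rewrite ler_wpM2l ?subr_ge0 // ltW.
lra.
Qed.

Lemma Wpt_lip l s l' s' : 0 <= l' <= 1 ->
  cm (Wpt l s - Wpt l' s') <= 2 * (`|l - l'| + `|s - s'|).
Proof.
move=> /andP[l0 l1].
have -> : Wpt l s - Wpt l' s' = (l - l')%:C * (zeta s - z) + l'%:C * (zeta s - zeta s').
  rewrite /Wpt rmorphB /=; ring.
rewrite (le_trans (cmD _ _)) // !cmM !cm_real mulrDr lerD //.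
  by rewrite mulrC ler_wpM2r // zeta_z2.
rewrite ger0_norm // -[leRHS]mul1r ler_pM ?cm_ge0 //; exact: expi_lip.
Qed.

Lemma cm_kern s : cm (kern s) <= (1 - cm z)^-1.
Proof.
rewrite /kern !cmM cm_i mul1r cm_expi mul1r cmV lef_pV2 ?posrE ?cm_gt0 ?zeta_z0 //.
  exact: zeta_z.
by rewrite subr_gt0.
Qed.

Lemma kern_cont a b : ccont a b kern.
Proof.
pose M : R := (1 - cm z)^-1.
apply: (@ccont_lip _ _ _ _ (M * M * 2)) => x y _ _.
have -> : kern x - kern y =
   'i * ((zeta x - z)^-1 * (zeta y - z)^-1 * z * (zeta y - zeta x)).
  rewrite /kern; field; by rewrite !zeta_z0.
have MM t : cm (zeta t - z)^-1 <= M.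
  rewrite cmV lef_pV2 ?posrE ?cm_gt0 ?zeta_z0 ?subr_gt0 //; exact: zeta_z.
rewrite cmM cm_i mul1r !cmM -(mulrA _ (cm z)) -(mulrA _ 2).
apply: ler_pM; rewrite ?mulr_ge0 ?cm_ge0 //.
  by apply: ler_pM; rewrite ?cm_ge0 // MM.
rewrite -[leRHS]mul1r; apply: ler_pM; rewrite ?cm_ge0 //; first exact: ltW.
by rewrite distrC expi_lip.
Qed.

Lemma invC_cont a b : 0 < a -> ccont a b (fun l : R => (l^-1)%:C).
Proof.
move=> a0; apply: (@ccont_lip _ _ _ _ (a^-1 * a^-1)) => x y /andP[ax _] /andP[ay _].
have x0 : 0 < x by apply: lt_le_trans ax. have y0 : 0 < y by apply: lt_le_trans ay.
rewrite -rmorphB cm_real.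
have -> : x^-1 - y^-1 = x^-1 * y^-1 * (y - x).
  field; by rewrite !lt0r_neq0.
have V (t : R) : a <= t -> `|t^-1| <= a^-1.
  move=> h; have t0 : 0 < t by apply: lt_le_trans h.
  by rewrite ger0_norm ?invr_ge0 ?(ltW t0) // lef_pV2.
by rewrite !normrM distrC ler_wpM2r // ler_pM // V.
Qed.

Variables (eps : R) (eps0 : 0 < eps) (eps1 : eps < 1).

(** Continuity in each variable suffices, as only integrals along the sides of rectangles occur;
    [eps <= l] keeps away from the pole at w = z. *)
Definition sepcont (G : R -> R -> R[i]) :=
  (forall s, ccont eps 1 (G^~ s)) /\ (forall l, eps <= l <= 1 -> ccont 0 B (G l)).

(* With w = Wpt l s one has dw / (w - z) = dl / l + kern s ds, so this is the integral of
   G dw / (w - z) around the image of the rectangle [a, b] x [c, d]. *)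
Definition bdint (G : R -> R -> R[i]) a b c d : R[i] :=
  cint (fun l => (l^-1)%:C * G l c) a b + cint (fun s => kern s * G b s) c d
  - cint (fun l => (l^-1)%:C * G l d) a b - cint (fun s => kern s * G a s) c d.

Section bdint.
Variables (a b c d : R) (ha : eps <= a) (hab : a <= b) (hb : b <= 1).
Variables (hc : 0 <= c) (hcd : c <= d) (hd : d <= B).

Lemma sep_l G s : sepcont G -> ccont a b (fun l => (l^-1)%:C * G l s).
Proof.
move=> [h _]; apply: ccontM; first by apply: invC_cont; exact: lt_le_trans ha.
by apply: ccont_sub (h s).
Qed.
Lemma sep_s G l : sepcont G -> eps <= l <= 1 -> ccont c d (fun s => kern s * G l s).
Proof.
move=> [_ h] hl; apply: ccontM; first exact: kern_cont.
by apply: ccont_sub (h l hl).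
Qed.
Let ea : eps <= a <= 1. Proof. by rewrite ha (le_trans hab). Qed.
Let eb : eps <= b <= 1. Proof. by rewrite hb (le_trans ha). Qed.

Lemma bdintD G H : sepcont G -> sepcont H ->
  bdint (fun l s => G l s + H l s) a b c d = bdint G a b c d + bdint H a b c d.
Proof.
move=> hG hH; rewrite /bdint.
have El s : cint (fun l => (l^-1)%:C * (G l s + H l s)) a b =
   cint (fun l => (l^-1)%:C * G l s) a b + cint (fun l => (l^-1)%:C * H l s) a b.
  rewrite -cintD; try exact: sep_l.
  by apply: eq_cint => l _; rewrite mulrDr.
have Es l : eps <= l <= 1 -> cint (fun s => kern s * (G l s + H l s)) c d =
   cint (fun s => kern s * G l s) c d + cint (fun s => kern s * H l s) c d.
  move=> hl; rewrite -cintD; try exact: sep_s.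
  by apply: eq_cint => s _; rewrite mulrDr.
rewrite !El !Es //; ring.
Qed.

Lemma bdintZ k G : sepcont G ->
  bdint (fun l s => k * G l s) a b c d = k * bdint G a b c d.
Proof.
move=> hG; rewrite /bdint.
have El s : cint (fun l => (l^-1)%:C * (k * G l s)) a b =
   k * cint (fun l => (l^-1)%:C * G l s) a b.
  rewrite -cintZ; last exact: sep_l.
  by apply: eq_cint => l _; ring.
have Es l : eps <= l <= 1 -> cint (fun s => kern s * (k * G l s)) c d =
   k * cint (fun s => kern s * G l s) c d.
  move=> hl; rewrite -cintZ; last exact: sep_s.
  by apply: eq_cint => s _; ring.
rewrite !El !Es //; ring.
Qed.

Lemma bdint1 : bdint (fun _ _ => 1) a b c d = 0.
Proof. rewrite /bdint; ring. Qed.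

(** Here G is w - z, so the integrand is the exact form dw. Together with [bdint1], this removes the
    affine part of g in [goursat]. *)
Lemma bdintlin : bdint (fun l s => l%:C * (zeta s - z)) a b c d = 0.
Proof.
rewrite /bdint.
have El s : cint (fun l : R => (l^-1)%:C * (l%:C * (zeta s - z))) a b =
    (b - a)%:C * (zeta s - z).
  rewrite -cint_cst //; apply: eq_cint => l /andP[al _].
  rewrite mulrA -rmorphM mulVf ?rmorph1 ?mul1r //.
  by rewrite lt0r_neq0 // (lt_le_trans eps0) // (le_trans ha).
have Es l : cint (fun s => kern s * (l%:C * (zeta s - z))) c d =
    l%:C * (zeta d - zeta c).
  have hi : cint zeta c d * 'i = zeta d - zeta c.
    have := @cint_expi _ 1 c d hcd; rewrite !mul1r mulrC => <-.
    by congr (_ * _); apply: eq_cint => x _; rewrite mul1r.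
  rewrite -hi (mulrC (cint _ _ _)) mulrA -cintZ; last first.
    apply: (@ccont_lip _ _ _ _ 2) => x y _ _; exact: expi_lip.
  by apply: eq_cint => s _; rewrite /kern; field; exact: zeta_z0.
rewrite !El !Es rmorphB /=; ring.
Qed.

(** Two sides in each direction and the factor 2 of [cint_le] make the 4; the two inverses bound the
    densities [l^-1] and [kern]. *)
Lemma bdint_le G M : 0 <= M -> sepcont G ->
  (forall l s, a <= l <= b -> c <= s <= d -> cm (G l s) <= M) ->
  cm (bdint G a b c d) <= 4 * (eps^-1 + (1 - cm z)^-1) * M * ((b - a) + (d - c)).
Proof.
move=> M0 hG hM.
pose C := eps^-1 + (1 - cm z)^-1.
have Vz0 : 0 <= (1 - cm z)^-1 by rewrite invr_ge0 subr_ge0 ltW.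
have Ve0 : 0 <= eps^-1 by rewrite invr_ge0 ltW.
have C0 : 0 <= C by rewrite addr_ge0.
have El s : c <= s <= d -> cm (cint (fun l => (l^-1)%:C * G l s) a b) <= 2 * (C * M) * (b - a).
  move=> hs; apply: cint_le => //; first exact: sep_l.
  move=> l hl; rewrite cmM ler_pM ?cm_ge0 ?hM // cm_real.
  have /andP[al _] := hl.
  have l0 : 0 < l by rewrite (lt_le_trans eps0) // (le_trans ha).
  rewrite ger0_norm ?invr_ge0 ?(ltW l0) // (@le_trans _ _ eps^-1) ?lerDl //.
  by rewrite lef_pV2 ?posrE // (le_trans ha).
have Es l : eps <= l <= 1 -> a <= l <= b ->
    cm (cint (fun s => kern s * G l s) c d) <= 2 * (C * M) * (d - c).
  move=> hl hl'; apply: cint_le => //; first exact: sep_s.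
  move=> s hs; rewrite cmM ler_pM ?cm_ge0 ?hM //.
  by rewrite (le_trans (cm_kern _)) // lerDr.
have := El c; have := El d; have := Es a ea; have := Es b eb.
rewrite !lexx hab hcd => /(_ isT) h1 /(_ isT) h2 /(_ isT) h3 /(_ isT) h4.
rewrite /bdint (le_trans (cmB _ _)) // (le_trans (lerD (cmB _ _) (lexx _))) //.
rewrite (le_trans (lerD (lerD (cmD _ _) (lexx _)) (lexx _))) //.
rewrite (le_trans (lerD (lerD (lerD h4 h1) h3) h2)) // -/C.
rewrite le_eqVlt; apply/orP; left; apply/eqP; ring.
Qed.
End bdint.

Variables (g : R[i] -> R[i]) (hg : forall w, cm w <= 1 -> cdiff g w).

Lemma sep_g : sepcont (fun l s => g (Wpt l s)).
Proof.
split=> [s l hl e e0|l hl s hs e e0].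
  have hl01 : 0 <= l <= 1 by case/andP: hl => h1 ->; rewrite (le_trans _ h1) ?ltW.
  have [d d0 Hd] := cdiff_cont (hg (Wpt_disk s hl01)) e0.
  exists (d / 2); first by rewrite divr_gt0.
  move=> y hy yl; apply: Hd; apply: (le_lt_trans (Wpt_lip _ _ _ hl01)).
  rewrite subrr normr0 addr0; lra.
have hl01 : 0 <= l <= 1 by case/andP: hl => h1 ->; rewrite (le_trans _ h1) ?ltW.
have [d d0 Hd] := cdiff_cont (hg (Wpt_disk s hl01)) e0.
exists (d / 2); first by rewrite divr_gt0.
move=> y hy yl; apply: Hd; apply: (le_lt_trans (Wpt_lip _ _ _ hl01)).
rewrite subrr normr0 add0r; lra.
Qed.

Lemma sep_cst k : sepcont (fun _ _ => k).
Proof. by split => *; exact: ccont_cst. Qed.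

Lemma sep_lin : sepcont (fun l s => l%:C * (zeta s - z)).
Proof.
split=> [s|l hl].
  apply: (@ccont_lip _ _ _ _ 2) => x y _ _; rewrite -mulrBl -rmorphB cmM cm_real.
  by rewrite mulrC ler_wpM2r // zeta_z2.
apply: (@ccont_lip _ _ _ _ 2) => x y _ _.
rewrite -mulrBr cmM cm_real.
have /andP[h1 h2] := hl.
rewrite -[leRHS]mul1r ler_pM ?cm_ge0 //.
  by rewrite ger0_norm // (le_trans _ h1) // ltW.
by rewrite opprB addrA subrK expi_lip.
Qed.

Lemma sepD G H : sepcont G -> sepcont H -> sepcont (fun l s => G l s + H l s).
Proof.
move=> [h1 h2] [h3 h4]; split => [s|l hl]; apply: ccontD => //; auto.
Qed.
Lemma sepZ k G : sepcont G -> sepcont (fun l s => k * G l s).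
Proof.
by move=> [h1 h2]; split => [s|l hl]; apply: ccontM; rewrite //; try exact: ccont_cst; auto.
Qed.

Lemma B_gt0 : 0 < B.
Proof. by rewrite mulr_gt0 // pi_gt0. Qed.

(** Goursat's argument on the parameter rectangle, rescaled to the unit square by [X] and [Y]. The
    bound [eta * l ^+ 2] is additive over the four quarters of a square. On a small square around w0
    the affine approximation of g contributes nothing, the remainder is at most a small multiple of
    the diameter, and the perimeter supplies the second factor [l]. *)
Lemma goursat : bdint (fun l s => g (Wpt l s)) eps 1 0 B = 0.
Proof.
pose A := 1 - eps; have A0 : 0 < A by rewrite subr_gt0.
have B0 := B_gt0.
pose G l s := g (Wpt l s).
pose X x := eps + A * x; pose Y y := B * y.
have X0 : X 0 = eps by rewrite /X mulr0 addr0.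
have X1 : X 1 = 1 by rewrite /X mulr1 /A addrC subrK.
have Xm u v : u <= v -> X u <= X v by move=> uv; rewrite lerD2l ler_pM2l.
have Ym u v : u <= v -> Y u <= Y v by move=> uv; rewrite ler_pM2l.
have Y0 : Y 0 = 0 by rewrite /Y mulr0.
have Y1 : Y 1 = B by rewrite /Y mulr1.
suff H eta : 0 < eta -> cm (bdint G (X 0) (X 1) (Y 0) (Y 1)) <= eta.
  apply/eqP; rewrite -cm_eq0 eq_le cm_ge0 andbT; apply/ler_addgt0Pr => e e0.
  by rewrite add0r; have := H e e0; rewrite X0 X1 Y0 Y1.
move=> eta0.
pose P x y l := 0 <= x -> x + l <= 1 -> 0 <= y -> y + l <= 1 -> 0 <= l ->
  cm (bdint G (X x) (X (x + l)) (Y y) (Y (y + l))) <= eta * l ^+ 2.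
suff : P 0 0 1 by rewrite /P !add0r expr1n mulr1; apply.
pose C := eps^-1 + (1 - cm z)^-1.
have C0 : 0 < C.
  by rewrite addr_gt0 ?invr_gt0 // subr_gt0.
apply: (@square_ind _ 1 P) => //.
- move=> x y l l0 P1 P2 P3 P4 x0 x1 y0 y1 _.
  have l0' := ltW l0.
  have -> : bdint G (X x) (X (x + (l + l))) (Y y) (Y (y + (l + l))) =
     bdint G (X x) (X (x + l)) (Y y) (Y (y + l)) +
     bdint G (X (x + l)) (X (x + l + l)) (Y y) (Y (y + l)) +
     bdint G (X x) (X (x + l)) (Y (y + l)) (Y (y + l + l)) +
     bdint G (X (x + l)) (X (x + l + l)) (Y (y + l)) (Y (y + l + l)).
    rewrite /bdint !(addrA x l l) !(addrA y l l).
    have hX1 : eps <= X x by rewrite -X0 Xm.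
    have hX2 : X (x + l + l) <= 1 by rewrite -X1 Xm // -addrA.
    have hX3 : X x <= X (x + l) by rewrite Xm // lerDl.
    have hX4 : X (x + l) <= X (x + l + l) by rewrite Xm // lerDl.
    have hY1 : 0 <= Y y by rewrite -Y0 Ym.
    have hY2 : Y (y + l + l) <= B by rewrite -Y1 Ym // -addrA.
    have hY3 : Y y <= Y (y + l) by rewrite Ym // lerDl.
    have hY4 : Y (y + l) <= Y (y + l + l) by rewrite Ym // lerDl.
    have El s : cint (fun l => (l^-1)%:C * G l s) (X x) (X (x + l + l)) =
       cint (fun l => (l^-1)%:C * G l s) (X x) (X (x + l)) +
       cint (fun l => (l^-1)%:C * G l s) (X (x + l)) (X (x + l + l)).
      by apply: cint_split => //; apply: sep_l sep_g.
    have Es k : eps <= k <= 1 -> cint (fun s => kern s * G k s) (Y y) (Y (y + l + l)) =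
       cint (fun s => kern s * G k s) (Y y) (Y (y + l)) +
       cint (fun s => kern s * G k s) (Y (y + l)) (Y (y + l + l)).
      by move=> hk; apply: cint_split => //; apply: sep_s sep_g hk.
    rewrite !El !Es; first by do !move: (cint _ _ _) => ?; ring.
    + by rewrite hX1 (le_trans hX3) // (le_trans hX4).
    + by rewrite hX2 (le_trans hX1) // (le_trans hX3).
  rewrite (le_trans (cmD _ _)) // (le_trans (lerD (cmD _ _) (lexx _))) //.
  rewrite (le_trans (lerD (lerD (cmD _ _) (lexx _)) (lexx _))) //.
  have -> : eta * (l + l) ^+ 2 = eta * l ^+ 2 + eta * l ^+ 2 + eta * l ^+ 2 + eta * l ^+ 2.
    ring.
  rewrite !lerD //; [apply: P1|apply: P2|apply: P3|apply: P4] => //; lra.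
move=> p q p01 q01.
pose w0 := Wpt (X p) (Y q).
have Xp01 : 0 <= X p <= 1.
  case/andP: p01 => p0 p1; apply/andP; split; last by rewrite -X1 Xm.
  by rewrite (le_trans (ltW eps0)) // -X0 Xm.
have [D hD] := hg (Wpt_disk (Y q) Xp01); rewrite -/w0 in hD.
(* The bound of [bdint_le], for a remainder of size e 2 (A + B) l and sides of total length (A + B)
   l, is then exactly eta l^2. *)
pose e := eta / (8 * C * (A + B) ^+ 2).
have AB0 : 0 < A + B by rewrite addr_gt0.
have e0 : 0 < e by rewrite divr_gt0 // mulr_gt0 ?exprn_gt0 // mulr_gt0.
have [h h0 Hh] := hD e e0.
exists (h / (2 * (A + B))); first by rewrite divr_gt0 // mulr_gt0.
move=> x y l /andP[l0 lh] /andP[xp px] /andP[yq qy] x0 x1 y0 y1 _.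
have hX1 : eps <= X x by rewrite -X0 Xm.
have hX2 : X (x + l) <= 1 by rewrite -X1 Xm.
have hX3 : X x <= X (x + l) by rewrite Xm // lerDl ltW.
have hY1 : 0 <= Y y by rewrite -Y0 Ym.
have hY2 : Y (y + l) <= B by rewrite -Y1 Ym.
have hY3 : Y y <= Y (y + l) by rewrite Ym // lerDl ltW.
(* The remainder g w - g w0 - D (w - w0), written as g plus multiples of the two functions with
   vanishing boundary integral. *)
pose rho l s := G l s + (- (g w0 + D * (z - w0)) * 1 + (- D) * (l%:C * (zeta s - z))).
have seprho : sepcont rho.
  apply: sepD; first exact: sep_g.
  apply: sepD; first exact: sep_cst.
  apply: sepZ; exact: sep_lin.
have JE : bdint G (X x) (X (x + l)) (Y y) (Y (y + l)) = bdint rho (X x) (X (x + l)) (Y y) (Y (y + l)).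
  rewrite /rho bdintD //; [|exact: sep_g|]; last first.
    apply: sepD; first exact: sep_cst.
    apply: sepZ; exact: sep_lin.
  rewrite bdintD //; [|exact: sep_cst|apply: sepZ; exact: sep_lin].
  rewrite !bdintZ //; [|exact: sep_lin|exact: sep_cst].
  by rewrite bdint1 bdintlin // !mulr0 !addr0.
have rhoE k s : rho k s = g (Wpt k s) - g w0 - D * (Wpt k s - w0).
  rewrite /rho /G /Wpt; ring.
rewrite JE; apply: (le_trans (@bdint_le _ _ _ _ _ _ _ _ _ _ _ (e * (2 * (A * l + B * l))) _ _ _)) => //.
- by apply: ltW; rewrite mulr_gt0 // mulr_gt0 // addr_gt0 // mulr_gt0.
- move=> k s /andP[k1 k2] /andP[s1 s2]; rewrite rhoE.
  have hk : `|k - X p| <= A * l.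
    have := Xm _ _ xp; have := Xm _ _ px.
    rewrite ler_norml; move: k1 k2; rewrite /X; lra.
  have hs : `|s - Y q| <= B * l.
    have := Ym _ _ yq; have := Ym _ _ qy.
    rewrite ler_norml; move: s1 s2; rewrite /Y; lra.
  have hW : cm (Wpt k s - w0) <= 2 * (A * l + B * l).
    by rewrite (le_trans (Wpt_lip _ _ _ Xp01)) // ler_pM2l // lerD.
  rewrite (le_trans (Hh _ _)) //; last by rewrite ler_pM2l.
  rewrite (le_lt_trans hW) //; move: lh; rewrite ltr_pdivlMr ?mulr_gt0 //; lra.
rewrite -/C /e.
have -> : X (x + l) - X x + (Y (y + l) - Y y) = (A + B) * l.
  by rewrite /X /Y; ring.
rewrite le_eqVlt; apply/orP; left; apply/eqP; field.
by rewrite !lt0r_neq0.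
Qed.

End CauchyTaylor.

Section Taylor.
Variable R : realType.
Implicit Types (g : R[i] -> R[i]) (w z : R[i]).
Local Notation zeta := (@expi R).
Local Notation B := (2 * pi : R).

Lemma circle_cont g : (forall w, cm w <= 1 -> cdiff g w) ->
  ccont 0 B (fun s => g (zeta s)).
Proof.
move=> hg s hs e e0.
have [|d d0 Hd] := cdiff_cont (hg (zeta s) _) e0; first by rewrite cm_expi.
exists (d / 2); first by rewrite divr_gt0.
move=> y _ yd; apply: Hd; rewrite (le_lt_trans (expi_lip _ _)) //; lra.
Qed.

(** In [goursat] the sides s = 0 and s = 2 pi are the same path and cancel, so the integrals over l
    = 1 and l = eps agree; as eps tends to 0, g tends to g z on the inner curve. The integral of
    [kern] is left as it is and evaluated in [cint_kern]. *)
Lemma cauchy_kern g z : (forall w, cm w <= 1 -> cdiff g w) -> cm z < 1 ->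
  cint (fun s => kern z s * g (zeta s)) 0 B = cint (kern z) 0 B * g z.
Proof.
move=> hg z1.
have B0 : 0 < B := B_gt0 R.
have hk := kern_cont z1 (a := 0) (b := B).
pose V := (1 - cm z)^-1; have V0 : 0 < V by rewrite invr_gt0 subr_gt0.
apply/eqP; rewrite -subr_eq0 -cm_eq0 eq_le cm_ge0 andbT; apply/ler_addgt0Pr => e e0.
rewrite add0r.
have e'0 : 0 < e / (2 * V * B) by rewrite divr_gt0 // mulr_gt0 // mulr_gt0.
have [d d0 Hd] := cdiff_cont (hg z (ltW z1)) e'0.
pose eps := Num.min (1 / 2) (d / 3).
have eps0 : 0 < eps by rewrite lt_min !divr_gt0.
have eps1 : eps < 1 by rewrite gt_min; apply/orP; left; lra.
have epsd : eps * 2 < d.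
  have : eps <= d / 3 by rewrite ge_min lexx orbT.
  by move=> h; lra.
have := goursat z1 eps0 eps1 hg; rewrite /bdint.
have Z0 : zeta B = zeta 0 by rewrite expi0 expi2pi.
have WB l : Wpt z l B = Wpt z l 0 by rewrite /Wpt Z0.
have -> : cint (fun l : R => (l^-1)%:C * g (Wpt z l B)) eps 1 =
    cint (fun l : R => (l^-1)%:C * g (Wpt z l 0)) eps 1.
  by apply: eq_cint => l _; rewrite WB.
rewrite (addrC (cint _ eps 1)) addrK => /subr0_eq.
have W1 s : Wpt z 1 s = zeta s by rewrite /Wpt rmorph1 mul1r addrC subrK.
have -> : cint (fun s => kern z s * g (Wpt z 1 s)) 0 B =
    cint (fun s => kern z s * g (zeta s)) 0 B.
  by apply: eq_cint => s _; rewrite W1.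
move=> ->.
have hsep := sep_g z1 eps0 hg.
have c1 : ccont 0 B (fun s => kern z s * g (Wpt z eps s)).
  by apply: ccontM => //; apply: (hsep.2); rewrite lexx ltW.
have -> : cint (kern z) 0 B * g z = cint (fun s => g z * kern z s) 0 B.
  by rewrite cintZ // mulrC.
have -> : cint (fun s => kern z s * g (Wpt z eps s)) 0 B =
  cint (fun s => g z * kern z s) 0 B + cint (fun s => kern z s * (g (Wpt z eps s) - g z)) 0 B.
  rewrite -cintD.
  - by apply: eq_cint => s _; ring.
  - by apply: ccontM => //; exact: ccont_cst.
  - apply: ccontM => //; apply: ccontD; last exact: ccont_cst.
    by apply: (hsep.2); rewrite lexx ltW.
rewrite addrAC subrr add0r.
rewrite (le_trans (@cint_le _ _ _ _ (V * (e / (2 * V * B))) _ _ _)) ?(ltW B0) //.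
- apply: ccontM => //; apply: ccontD; last exact: ccont_cst.
  by apply: (hsep.2); rewrite lexx ltW.
- move=> s _; rewrite cmM ler_pM ?cm_ge0 //; first exact: cm_kern.
  apply/ltW/Hd; rewrite /Wpt addrAC subrr add0r cmM cm_real gtr0_norm //.
  apply: le_lt_trans epsd; rewrite ler_wpM2l ?(ltW eps0) // zeta_z2 //.
- rewrite subr0; move: B0; set b := (2 * pi : R) => b0.
  rewrite le_eqVlt; apply/orP; left; apply/eqP; field.
  by rewrite !lt0r_neq0.
Qed.

(** A Fourier coefficient of g on the unit circle; [taylor_disk] shows that it is the Taylor
    coefficient at 0. *)
Definition tcoef g (j : nat) : R[i] :=
  (B^-1)%:C * cint (fun s => g (zeta s) * zeta (- j%:R * s)) 0 B.

Lemma zeta_inv j s : zeta (- j%:R * s) = (zeta s)^-1 ^+ j.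
Proof. by rewrite mulNr expiN expiMn exprVn. Qed.

(** Geometric expansion of [kern] in powers of z / zeta: what is left after N terms is [kern] times
    the N-th power of z / zeta. *)
Lemma kern_expand g z N M : (forall w, cm w <= 1 -> cdiff g w) -> cm z < 1 ->
  (forall s, cm (g (zeta s)) <= M) ->
  cm (cint (fun s => kern z s * g (zeta s)) 0 B -
      'i * B%:C * \sum_(j < N) tcoef g j * z ^+ j)
   <= 2 * M * B * (cm z ^+ N / (1 - cm z)).
Proof.
move=> hg z1 hM.
have B0 : 0 < B := B_gt0 R.
have M0 : 0 <= M by apply: le_trans (hM 0); exact: cm_ge0.
have hk := kern_cont z1 (a := 0) (b := B).
have hc := circle_cont hg.
have hz j : ccont 0 B (fun s => g (zeta s) * zeta (- j%:R * s)).
  by apply: ccontM => //; exact: ccont_expi.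
elim: N => [|N IH].
- rewrite big_ord0 mulr0 subr0 expr0 mul1r.
  rewrite (le_trans (@cint_le _ _ _ _ (M * (1 - cm z)^-1) _ _ _)) ?(ltW B0) //.
  + by apply: ccontM.
  + move=> s _; rewrite cmM mulrC ler_pM ?cm_ge0 //; exact: cm_kern.
  + rewrite subr0; lra.
- clear IH; set T := N.+1.
  (* The terms are split off one at a time; [F] is the integrand of the remainder. *)
  have H m : exists2 F, ccont 0 B F &
     (cint (fun s => kern z s * g (zeta s)) 0 B -
      'i * B%:C * \sum_(j < m) tcoef g j * z ^+ j = cint F 0 B) /\
     (forall s, F s = kern z s * g (zeta s) * (z * (zeta s)^-1) ^+ m).
    elim: m => [|m [F Fc [FE FF]]].
      exists (fun s => kern z s * g (zeta s)); first exact: ccontM.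
      by rewrite big_ord0 mulr0 subr0; split => // s; rewrite expr0 mulr1.
    pose G s := F s + (- ('i * z ^+ m)) * (g (zeta s) * zeta (- m%:R * s)).
    exists G.
      by apply: ccontD => //; apply: ccontM => //; exact: ccont_cst.
    split.
      rewrite /G cintD //; last by apply: ccontM => //; exact: ccont_cst.
      rewrite cintZ // -FE big_ord_recr /tcoef.
      have BB : B%:C * (B^-1)%:C = 1 by rewrite -rmorphM mulfV ?lt0r_neq0.
      move: BB; set b := B%:C; set b' := (B^-1)%:C => BB.
      set I := cint _ _ _; set S := \sum_(_ < m) _; set K0 := cint _ _ _; rewrite /=.
      have -> : 'i * b * (S + b' * K0 * z ^+ m) = 'i * b * S + 'i * (b * b') * K0 * z ^+ m.
        ring.
      rewrite BB; ring.
    move=> s; rewrite /G FF zeta_inv exprS exprMn /kern.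
    have h1 := zeta_z0 z1 s; have h2 := expi_neq0 s.
    set q := g _; set a := z ^+ m; set b := _ ^+ m.
    by field; rewrite ?h1 ?h2.
  have [F Fc [-> FF]] := H T.
  rewrite (le_trans (@cint_le _ _ _ _ (M * ((1 - cm z)^-1 * cm z ^+ T)) _ _ _)) ?(ltW B0) //.
  + move=> s _; rewrite FF; have := cm_kern z1 s; move: (kern z s) => k hk'.
    rewrite !cmM cmX cmM cmV cm_expi invr1 mulr1.
    rewrite (mulrC (cm k)) -mulrA ler_pM ?cm_ge0 //.
      by rewrite mulr_ge0 ?cm_ge0 // exprn_ge0 // cm_ge0.
    by rewrite ler_wpM2r ?exprn_ge0 ?cm_ge0.
  + rewrite subr0 le_eqVlt; apply/orP; left; apply/eqP; ring.
Qed.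

Lemma tcoef1 j : tcoef (fun=> 1) j = (j == 0%N)%:R.
Proof.
have B0 : 0 < B := B_gt0 R.
rewrite /tcoef; under eq_cint => s _ do rewrite mul1r.
have [->|j0] := eqVneq j 0%N.
  under eq_cint => s _ do rewrite mulNr mul0r oppr0 expi0.
  by rewrite cint_cst ?ltW // subr0 mulr1 -rmorphM mulVf ?lt0r_neq0.
have := @cint_expi _ (- j%:R) 0 B (ltW B0).
have -> : zeta (- j%:R * B) = 1 by rewrite mulNr expiN expiMn expi2pi expr1n invr1.
rewrite mulr0 expi0 subrr => /eqP; rewrite !mulf_eq0 => /orP[/orP[]|/eqP->].
- by rewrite -cm_eq0 cm_real normr_eq0 oppr_eq0 pnatr_eq0 (negPf j0).
- by rewrite -cm_eq0 cm_i oner_eq0.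
- by rewrite mulr0.
Qed.

Lemma cdiff_cst c z : cdiff (fun=> c) z.
Proof.
exists 0 => e e0; exists 1 => // w _; rewrite subrr mul0r subrr cm0.
by rewrite mulr_ge0 ?cm_ge0 // ltW.
Qed.

Lemma geo_small (q C : R) : 0 <= q < 1 -> forall e, 0 < e ->
  exists N : nat, forall n, (N <= n)%N -> C * q ^+ n <= e.
Proof.
move=> /andP[q0 q1] e e0.
have h : (fun n => q ^+ n) @ \oo --> 0 by apply: cvg_expr; rewrite ger0_norm.
have : 0 < e / (`|C| + 1) by rewrite divr_gt0 // ltr_wpDl.
move: h => /cvgrPdist_lt h /h [N _ HN]; exists N => n Nn.
have := HN n Nn; rewrite sub0r normrN ltr_pdivlMr ?ltr_wpDl // => /ltW H.
rewrite (le_trans (ler_norm _)) // normrM (le_trans _ H) // mulrC.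
by rewrite ler_wpM2l // lerDl.
Qed.

(** [kern_expand] for the constant function 1, whose only nonzero coefficient is the one of index 0,
    with N tending to infinity. *)
Lemma cint_kern z : cm z < 1 -> cint (kern z) 0 B = 'i * B%:C.
Proof.
move=> z1; have B0 : 0 < B := B_gt0 R.
apply/eqP; rewrite -subr_eq0 -cm_eq0 eq_le cm_ge0 andbT; apply/ler_addgt0Pr => e e0.
rewrite add0r.
have q : 0 <= cm z < 1 by rewrite cm_ge0.
have [N HN] := geo_small (2 * B / (1 - cm z)) q e0.
apply: le_trans (HN N.+1 (leqnSn _)).
have c1 (s : R) : cm ((fun=> 1 : R[i]) (zeta s)) <= 1 by rewrite cm1.
have := @kern_expand (fun=> 1) z N.+1 1 (fun w _ => @cdiff_cst 1 w) z1 c1.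
have -> : \sum_(j < N.+1) tcoef (fun=> 1) j * z ^+ j = 1.
  rewrite big_ord_recl big1 ?addr0 => [|j _]; rewrite tcoef1 ?mul1r ?expr0 //.
  by rewrite mul0r.
under eq_cint => s _ do rewrite mulr1.
rewrite !mulr1 => H; apply: (le_trans H).
rewrite le_eqVlt; apply/orP; left; apply/eqP; ring.
Qed.

(** Cauchy's formula divided by 2 pi i. Differentiability is assumed on the closed disk, so
    functions on an open disk are rescaled before use. *)
Lemma taylor_disk g M : (forall w, cm w <= 1 -> cdiff g w) ->
  (forall w, cm w <= 1 -> cm (g w) <= M) ->
  exists a : nat -> R[i], (forall j, cm (a j) <= 2 * M) /\
   forall z N, cm z < 1 ->
    cm (g z - \sum_(j < N) a j * z ^+ j) <= 2 * M * (cm z ^+ N / (1 - cm z)).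
Proof.
move=> hg hM; have B0 : 0 < B := B_gt0 R.
have hM' s : cm (g (zeta s)) <= M by apply: hM; rewrite cm_expi.
exists (tcoef g); split => [j|z N z1].
  rewrite /tcoef cmM cm_real ger0_norm ?invr_ge0 ?(ltW B0) //.
  rewrite mulrC ler_pdivrMr //.
  rewrite (le_trans (@cint_le _ _ _ _ M _ _ _)) ?(ltW B0) ?subr0 //.
    by apply: ccontM; [exact: circle_cont | exact: ccont_expi].
  by move=> s _; rewrite cmM cm_expi mulr1.
have := kern_expand N hg z1 hM'.
rewrite cauchy_kern // cint_kern // -mulrBr !cmM cm_i mul1r cm_real gtr0_norm //.
rewrite -(mulrA _ (B : R)) (mulrCA _ (B : R)) ler_pM2l //.
Qed.

End Taylor.

(** * The principal logarithm and power series *)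

Section ComplexLogarithm.
Variable R : realType.
Implicit Types (z w h : R[i]) (x y : R).

(** The exponential enters as the inverse of [clog], whose functional equations and derivative are
    obtained through it. *)
Definition cexp w : R[i] := (expR (complex.Re w))%:C * expi (complex.Im w).

Lemma cexpD w z : cexp (w + z) = cexp w * cexp z.
Proof.
case: w => a b; case: z => c d; rewrite /cexp /= expRD expiD rmorphM; ring.
Qed.
Lemma cexp0 : cexp 0 = 1. Proof. by rewrite /cexp /= expR0 expi0 mulr1. Qed.
Lemma cm_cexp w : cm (cexp w) = expR (complex.Re w).
Proof. by rewrite /cexp cmM cm_expi mulr1 cm_real ger0_norm ?expR_ge0. Qed.
Lemma cexp_neq0 w : cexp w != 0.
Proof. by rewrite -cm_gt0 cm_cexp expR_gt0. Qed.
Lemma cexpN w : cexp (- w) = (cexp w)^-1.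
Proof.
by apply: (mulIf (cexp_neq0 w)); rewrite -cexpD addNr cexp0 mulVf // cexp_neq0.
Qed.

Lemma ReM_real x z : complex.Re (x%:C * z) = x * complex.Re z.
Proof. by case: z => a b; simpc. Qed.
Lemma ImM_real x z : complex.Im (x%:C * z) = x * complex.Im z.
Proof. by case: z => a b; simpc. Qed.

Lemma Re_div_cm z : -1 <= complex.Re z / cm z <= 1.
Proof.
have [->|z0] := eqVneq z 0; first by rewrite mul0r lerN10 ler01.
have cz : 0 < cm z by rewrite cm_gt0.
rewrite -ler_norml normrM normfV (gtr0_norm cz) ler_pdivrMr // mul1r.
exact: Re_le_cm.
Qed.

Lemma carg_norm z : `|carg z| = acos (complex.Re z / cm z).
Proof.
rewrite /carg -/(cm z); case: ifP => _; rewrite ?normrN ger0_norm // acos_ge0 //;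
exact: Re_div_cm.
Qed.

Lemma carg_pi z : `|carg z| <= pi.
Proof. by rewrite carg_norm acos_lepi // Re_div_cm. Qed.

Lemma cos_carg z : cos (carg z) = complex.Re z / cm z.
Proof. by rewrite -cos_norm carg_norm acosK // in_itv /= Re_div_cm. Qed.

Lemma sin_carg z : z != 0 -> sin (carg z) = complex.Im z / cm z.
Proof.
move=> z0; have cz : 0 < cm z by rewrite cm_gt0.
have E : Num.sqrt (1 - (complex.Re z / cm z) ^+ 2) = `|complex.Im z| / cm z.
  have -> : 1 - (complex.Re z / cm z) ^+ 2 = (complex.Im z / cm z) ^+ 2.
    have : cm z ^+ 2 = complex.Re z ^+ 2 + complex.Im z ^+ 2.
      by rewrite cmE sqr_sqrtr // addr_ge0 ?sqr_ge0.
    move=> E; rewrite !expr_div_n E; field.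
    by rewrite -E sqrf_eq0 lt0r_neq0.
  by rewrite sqrtr_sqr normrM normfV (gtr0_norm cz).
rewrite /carg -/(cm z); case: leP => [i0|/ltW i0].
  by rewrite sin_acos ?Re_div_cm // E ger0_norm.
by rewrite sinN sin_acos ?Re_div_cm // E ler0_norm // mulNr opprK.
Qed.

Lemma cexp_clog z : z != 0 -> cexp (clog z) = z.
Proof.
move=> z0; have cz : 0 < cm z by rewrite cm_gt0.
rewrite /cexp /clog /= -/(cm z) lnK ?posrE // /expi cos_carg sin_carg //.
case: z z0 cz => a b z0 cz /=; simpc; rewrite !mulrA.
by congr (_ +i* _); rewrite mulrC mulKf // lt0r_neq0.
Qed.

Lemma clog_cexp w : `|complex.Im w| < pi -> clog (cexp w) = w.
Proof.
case: w => x y /= ypi; rewrite /clog -/(cm (cexp _)) cm_cexp /= expRK; congr (_ +i* _).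
have ReE : complex.Re (cexp (x +i* y)) = expR x * cos y by rewrite /cexp ReM_real.
have ImE : complex.Im (cexp (x +i* y)) = expR x * sin y by rewrite /cexp ImM_real.
rewrite /carg -/(cm (cexp _)) cm_cexp ReE ImE /=.
rewrite (mulrAC (expR x)) mulfV ?gt_eqF ?expR_gt0 // mul1r.
move: ypi; rewrite ltr_norml => /andP[y1 y2].
have [y0|y0] := leP 0 y.
  rewrite ifT ?cosK // ?in_itv /= ?y0 ?(ltW y2) //.
  by rewrite mulr_ge0 ?expR_ge0 // sin_ge0_pi // y0 ltW.
rewrite ifF.
  by rewrite cosKN ?opprK // (ltW y1) ltW.
apply/negbTE; rewrite -ltNge pmulr_rlt0 ?expR_gt0 //.
by rewrite -oppr_gt0 -sinN sin_gt0_pi // oppr_gt0 y0 ltrNl.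
Qed.

Definition slit z := ~ (complex.Im z = 0 /\ complex.Re z <= 0).

Lemma slit_neq0 z : slit z -> z != 0.
Proof. by move=> h; apply/eqP => z0; apply: h; rewrite z0. Qed.

Lemma slit_carg z : slit z -> `|carg z| < pi.
Proof.
move=> hz; have z0 := slit_neq0 hz.
have cz : 0 < cm z by rewrite cm_gt0.
rewrite carg_norm; have /andP[h1 h2] := Re_div_cm z.
apply: acos_ltpi; rewrite h2 andbT lt_neqAle h1 andbT; apply/eqP => E.
apply: hz.
have Ez : complex.Re z = - cm z.
  apply: (mulIf (x := (cm z)^-1)); first by rewrite invr_eq0 lt0r_neq0.
  by rewrite -E mulNr mulfV // lt0r_neq0.
split; last by rewrite Ez oppr_le0 ltW.
have : cm z ^+ 2 = complex.Re z ^+ 2 + complex.Im z ^+ 2.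
  by rewrite cmE sqr_sqrtr // addr_ge0 ?sqr_ge0.
rewrite Ez sqrrN => /eqP; rewrite -subr_eq0 opprD addNKr oppr_eq0 sqrf_eq0.
by move/eqP.
Qed.

Lemma clogV z : slit z -> clog z^-1 = - clog z.
Proof.
move=> hz; have z0 := slit_neq0 hz.
by rewrite -(@clog_cexp (- clog z)) ?cexpN ?cexp_clog //= normrN slit_carg.
Qed.

Lemma is_derive_small (f : R -> R) d : is_derive (0 : R) 1 f d ->
  forall e, 0 < e -> exists2 r : R, 0 < r &
    forall x, `|x| < r -> `|f x - f 0 - d * x| <= e * `|x|.
Proof.
move=> [/cvg_ex[l Hl] Ed] e e0.
have El : l = d by rewrite -Ed; apply/esym/cvg_lim.
move: Hl; rewrite El => /cvgrPdist_lt /(_ e e0) H.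
have /nbhs_ballP[r /= r0 Hr] : \forall t \near (0 : R), t != 0 ->
    `|d - t^-1 *: ((f \o shift 0) t%:A - f 0)| < e := H.
exists r => // x xr.
have [->|x0] := eqVneq x 0; first by rewrite mulr0 subr0 subrr normr0 mulr0.
have := Hr x; rewrite /ball /= sub0r normrN => /(_ xr x0) /ltW.
rewrite addr0 => /(ler_wpM2r (normr_ge0 x)); rewrite -normrM.
congr (_ <= _); rewrite -normrN; congr `|_|.
rewrite /GRing.scale /= mulr1; field; exact: x0.
Qed.

Lemma complex_decomp w : w = (complex.Re w)%:C + 'i * (complex.Im w)%:C.
Proof. exact: complexE. Qed.

Lemma cexp_small e : 0 < e -> exists2 r : R, 0 < r &
  forall w, cm w < r -> cm (cexp w - 1 - w) <= e * cm w.
Proof.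
(* The three terms into which the error is split below take the shares 1, 6 and 7 of 14. *)
move=> e0; pose e' := e / 14; have e'0 : 0 < e' by rewrite divr_gt0.
have [r1 r10 H1] := is_derive_small (is_derive_expR (0 : R)) e'0.
have [r2 r20 H2] := is_derive_small (is_derive_cos (0 : R)) e'0.
have [r3 r30 H3] := is_derive_small (is_derive_sin (0 : R)) e'0.
have [r4 r40 H4] := is_derive_small (is_derive_expR (0 : R)) (ltr01 : 0 < 1).
pose r := Num.min (Num.min (Num.min r1 r2) (Num.min r3 r4)) (Num.min 1 (e / 4)).
exists r; first by rewrite !lt_min r10 r20 r30 r40 ltr01 divr_gt0.
move=> w; rewrite !lt_min => /andP[/andP[/andP[w1 w2] /andP[w3 w4]] /andP[w5 w6]].
have hx := Re_le_cm w; have hy := Im_le_cm w.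
have := H1 (complex.Re w) (le_lt_trans hx w1); rewrite expR0 mul1r => E1.
have := H2 (complex.Im w) (le_lt_trans hy w2); rewrite cos0 sin0 oppr0 mul0r subr0 => E2.
have := H3 (complex.Im w) (le_lt_trans hy w3); rewrite sin0 cos0 mul1r subr0 => E3.
have := H4 (complex.Re w) (le_lt_trans hx w4); rewrite expR0 !mul1r => E4.
move: w5 w6 hx hy E1 E2 E3 E4; have := cm_ge0 w.
rewrite (_ : cexp w - 1 - w = (expR (complex.Re w) - 1 - complex.Re w)%:C
  + (expR (complex.Re w))%:C * (expi (complex.Im w) - 1 - 'i * (complex.Im w)%:C)
  + ((expR (complex.Re w)) - 1)%:C * ('i * (complex.Im w)%:C)); last first.
  rewrite /cexp [X in _ - 1 - X = _](complex_decomp w) !rmorphB rmorph1; ring.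
move: (complex.Re w) (complex.Im w) => x y; move: (cm w) => c.
move=> c0 c1 ce hx hy E1 E2 E3 E4.
rewrite (le_trans (cmD _ _)) // (le_trans (lerD (cmD _ _) (lexx _))) //.
rewrite !cmM !cm_real cm_i mul1r.
have Z : cm (expi y - 1 - 'i * y%:C) <= 2 * e' * `|y|.
  rewrite (le_trans (cm_le_ReIm _)) //.
  have -> : expi y - 1 - 'i * y%:C = (cos y - 1) +i* (sin y - y).
    by rewrite /expi; simpc.
  rewrite /=; lra.
have ex : `|expR x - 1| <= 2 * c.
  have -> : expR x - 1 = (expR x - 1 - x) + x by rewrite subrK.
  by rewrite (le_trans (ler_normD _ _)) // mulr2n mulrDl mul1r lerD // (le_trans E4).
have ex3 : `|expR x| <= 3.
  have -> : expR x = (expR x - 1) + 1 by rewrite subrK.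
  rewrite (le_trans (ler_normD _ _)) // normr1; lra.
have h1 : `|expR x| * cm (expi y - 1 - 'i * y%:C) <= 3 * (2 * e' * c).
  apply: ler_pM; rewrite ?cm_ge0 // (le_trans Z) // ler_wpM2l //.
  by rewrite mulr_ge0 // ltW.
have h2 : `|expR x - 1| * `|y| <= (2 * c) * c by apply: ler_pM.
have h3 : (2 * c) * c <= (2 * (e / 4)) * c.
  by rewrite ler_wpM2r // ler_pM2l // ltW.
have h4 : e' * `|x| <= e' * c by rewrite ler_wpM2l // ltW.
have Ee : e = 14 * e' by rewrite /e'; field.
rewrite Ee in h3 *; lra.
Qed.

(** The logarithm of the modulus accounts for 2, by ln (1 + x) <= x applied to the modulus and its
    inverse, and the argument for 8: cosine is at least 1 / 4 between 0 and the argument, so by the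
    mean value theorem the argument is at most 4 times its sine. *)
Lemma clog1_lip h : cm h < 1 / 2 -> cm (clog (1 + h)) <= 10 * cm h.
Proof.
move=> hh; have h0 := cm_ge0 h.
have c1 : 1 - cm h <= cm (1 + h).
  by have := cm_tri 1 (- h); rewrite cm1 cmN opprK.
have c2 : cm (1 + h) <= 1 + cm h by rewrite (le_trans (cmD _ _)) ?cm1.
have c0 : 0 < cm (1 + h) by apply: lt_le_trans c1; lra.
have n0 : 1 + h != 0 by rewrite -cm_gt0.
have := Re_le_cm h; have := Im_le_cm h.
rewrite !ler_norml => /andP[i1 i2] /andP[r1 r2].
have E1 := cos_carg (1 + h); have E2 := sin_carg n0; have E3 := carg_pi (1 + h).
have RE : complex.Re (1 + h) = 1 + complex.Re h by case: (h).
have IE : complex.Im (1 + h) = complex.Im h by case: (h) => a b; simpc.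
have s1 (u : R) : 1 + (u - 1) = u by rewrite addrC subrK.
have L1 : `|ln (cm (1 + h))| <= 2 * cm h.
  rewrite ler_norml; apply/andP; split; last first.
    have := @le_ln1Dx R (cm (1 + h) - 1); rewrite s1 => H; apply: le_trans (H _) _; lra.
  have := @le_ln1Dx R ((cm (1 + h))^-1 - 1); rewrite s1.
  have V0 : 0 < (cm (1 + h))^-1 by rewrite invr_gt0.
  move=> /(_ _)/le_trans H; rewrite lerNl -lnV ?posrE //; apply: H; first lra.
  rewrite lerBlDr -div1r ler_pdivrMr //.
  have : 0 <= cm h * (1 - 2 * cm h) by rewrite mulr_ge0 //; lra.
  nra.
have A : `|carg (1 + h)| <= 8 * cm h.
  move: E1 E2 E3; move: (carg (1 + h)) => y E1 E2 E3.
  set t := `|y|.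
  have ct : 1 / 4 <= cos t.
    rewrite /t cos_norm E1 RE ler_pdivlMr //; lra.
  have st : `|sin t| <= 2 * cm h.
    have -> : `|sin t| = `|sin y|.
      by rewrite /t; case: (ger0P y) => _ //; rewrite sinN normrN.
    rewrite E2 IE normrM normfV (gtr0_norm c0) ler_pdivrMr //.
    apply: (le_trans (Im_le_cm h)).
    have : 0 <= cm h * (1 - 2 * cm h) by rewrite mulr_ge0 //; lra.
    nra.
  have t0 : 0 <= t by exact: normr_ge0.
  have [u u1 Hu] := @MVT_segment R sin cos 0 t t0 (fun (v : R) _ => is_derive_sin v)
     (continuous_subspaceT (@continuous_sin R)).
  move: Hu; rewrite sin0 !subr0 => Hu.
  have cu : 1 / 4 <= cos u.
    apply: le_trans ct _; move: u1; rewrite in_itv /= => /andP[u0].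
    rewrite le_eqVlt => /orP[/eqP->//|ut]; apply: ltW.
    by rewrite ltr_cos // in_itv /= ?u0 ?t0 //= (le_trans (ltW ut)).
  have : t / 4 <= `|sin t|.
    rewrite Hu normrM (ger0_norm t0) mulrC ler_wpM2r //.
    by rewrite (le_trans _ (ler_norm _)) //; lra.
  lra.
rewrite (le_trans (cm_le_ReIm _)) // /clog /= -/(cm (1 + h)); lra.
Qed.

(** Differentiation of an inverse function: with w = z (1 + h) one has clog w - clog z = clog (1 +
    h), and [cexp_small] at clog (1 + h) compares this number with h. *)
Lemma cdiff_clog z : slit z -> cdiff_at (@clog R) z z^-1.
Proof.
move=> hz e e0; have z0 := slit_neq0 hz.
have cz : 0 < cm z by rewrite cm_gt0.
have zpi := slit_carg hz.
have e10 : 0 < e * cm z / 10 by rewrite divr_gt0 // mulr_gt0.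
have [r r0 Hr] := cexp_small e10.
(* The first bound is for [clog1_lip], the second for [cexp_small]; the third keeps the sum of the
   two arguments inside ]-pi, pi[, so that the branch does not jump. *)
pose k := Num.min (Num.min (1 / 2) (r / 10)) ((pi - `|carg z|) / 10).
have k0 : 0 < k by rewrite !lt_min !divr_gt0 // subr_gt0.
exists (k * cm z); first by rewrite mulr_gt0.
move=> w hw; pose h := (w - z) / z.
have hk : cm h < k by rewrite cmM cmV ltr_pdivrMr.
move: hk; rewrite !lt_min => /andP[/andP[h1 h2] h3].
have wE : w = z * (1 + h) by rewrite /h; field.
have L := clog1_lip h1.
have n0 : 1 + h != 0.
  rewrite -cm_gt0; have := cm_tri 1 (- h); rewrite cm1 cmN opprK; lra.
have wzE : w - z = h * z by rewrite /h; field.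
have E : clog w = clog z + clog (1 + h).
  rewrite wE -(@clog_cexp (clog z + clog (1 + h))) ?cexpD ?cexp_clog //.
  have -> : complex.Im (clog z + clog (1 + h)) = carg z + complex.Im (clog (1 + h)).
    by rewrite /clog /=.
  rewrite (le_lt_trans (ler_normD _ _)) //.
  have := Im_le_cm (clog (1 + h)); lra.
have -> : clog w - clog z = clog (1 + h) by rewrite E addrAC subrr add0r.
rewrite wzE cmM.
have -> : z^-1 * (h * z) = h by field.
have lr : cm (clog (1 + h)) < r by lra.
have := Hr _ lr; rewrite cexp_clog // (_ : 1 + h - 1 = h) 1?cmC => [H|]; last by ring.
rewrite (le_trans H) // (le_trans (ler_wpM2l (ltW e10) L)) //.
rewrite le_eqVlt; apply/orP; left; by apply/eqP; field.
Qed.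

End ComplexLogarithm.

Section PowerSeries.
Variable R : realType.
Implicit Types (a b c : nat -> R[i]) (g : R[i] -> R[i]) (z t w l : R[i]).

Definition psum a z l := ccvg (fun N => \sum_(k < N) a k * z ^+ k) l.

Lemma ccvg_eq (u v : nat -> R[i]) l : u =1 v -> ccvg u l -> ccvg v l.
Proof. by move=> uv h e e0; have [N HN] := h e e0; exists N => n /HN; rewrite uv. Qed.

Lemma ccvgB (u v : nat -> R[i]) l m : ccvg u l -> ccvg v m ->
  ccvg (fun n => u n - v n) (l - m).
Proof.
move=> hu hv e e0; have e20 : 0 < e / 2 by rewrite divr_gt0.
have [N HN] := hu _ e20; have [M HM] := hv _ e20.
exists (maxn N M) => n; rewrite geq_max => /andP[/HN h1 /HM h2].
have -> : u n - v n - (l - m) = (u n - l) - (v n - m) by ring.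
by rewrite (le_lt_trans (cmB _ _)) // (splitr e) ltrD.
Qed.

Lemma ccvgZ (u : nat -> R[i]) l k : ccvg u l -> ccvg (fun n => k * u n) (k * l).
Proof.
move=> hu e e0; have k0 : 0 < cm k + 1 by rewrite ltr_wpDl // cm_ge0.
have [N HN] := hu _ (divr_gt0 e0 k0); exists N => n /HN.
rewrite ltr_pdivlMr // => H; rewrite -mulrBr cmM; apply: le_lt_trans H.
by rewrite mulrC ler_wpM2l ?cm_ge0 // lerDl.
Qed.

Lemma psumB a b z l m : psum a z l -> psum b z m ->
  psum (fun k => a k - b k) z (l - m).
Proof.
move=> ha hb; apply: ccvg_eq (ccvgB ha hb) => n.
by rewrite -sumrB; apply: eq_bigr => k _; rewrite mulrBl.
Qed.

Lemma psumZ a z l k : psum a z l -> psum (fun j => k * a j) z (k * l).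
Proof.
move=> ha; apply: ccvg_eq (ccvgZ k ha) => n.
by rewrite mulr_sumr; apply: eq_bigr => j _; rewrite mulrA.
Qed.

Lemma psum_geo_bound a z l : psum a z l ->
  exists2 M : R, 0 < M & forall k, cm (a k) * cm z ^+ k <= M.
Proof.
move=> h; have [N HN] := h 1 ltr01.
pose M := 2 + \sum_(k < N) cm (a k * z ^+ k).
exists M => [|k]; first by rewrite ltr_pwDl // sumr_ge0 // => i _; rewrite cm_ge0.
rewrite -cmX -cmM; have [kN|Nk] := ltnP k N.
  rewrite /M (bigD1 (Ordinal kN)) //= addrCA lerDl addr_ge0 // sumr_ge0 // => i _.
  by rewrite cm_ge0.
have := HN k Nk; have := HN k.+1 (leqW Nk); rewrite big_ord_recr /=.
set s := \sum_(_ < _) _ => h1 h2.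
have -> : a k * z ^+ k = (s + a k * z ^+ k - l) - (s - l) by ring.
have S0 : 0 <= \sum_(k0 < N) cm (a k0 * z ^+ k0) by rewrite sumr_ge0 // => i _; rewrite cm_ge0.
rewrite (le_trans (cmB _ _)) // /M; lra.
Qed.

Lemma geo_tail_le (q : R) n m : 0 <= q -> q <= 1 / 2 ->
  \sum_(n <= k < m) q ^+ k <= 2 * q ^+ n.
Proof.
move=> q0 q1; have [mn|nm] := leqP m n.
  by rewrite big_geq // mulr_ge0 // exprn_ge0.
have H j : \sum_(n <= k < n + j) q ^+ k + 2 * q ^+ (n + j) <= 2 * q ^+ n.
  elim: j => [|j IH].
    by rewrite addn0 big_geq // add0r.
  rewrite addnS big_nat_recr ?leq_addr //=; apply: le_trans IH.
  rewrite -addrA lerD2l exprS.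
  have : 0 <= q ^+ (n + j) by rewrite exprn_ge0.
  nra.
rewrite -(subnKC (ltnW nm)); apply: le_trans (H (m - n)%N).
by rewrite lerDl mulr_ge0 // exprn_ge0.
Qed.

(** The first nonzero coefficient would dominate the rest near 0. Values on a real segment suffice,
    which is where all series are compared. *)
Lemma ps_unique c (d : R) : 0 < d ->
  (forall x : R, 0 < x < d -> psum c x%:C 0) -> forall k, c k = 0.
Proof.
move=> d0 h; pose x0 := d / 2; have x00 : 0 < x0 by rewrite divr_gt0.
have x0d : x0 < d by rewrite /x0; lra.
have [|M M0 HM] := @psum_geo_bound c x0%:C 0; first by apply: h; rewrite x00.
rewrite cm_real (gtr0_norm x00) in HM.
elim/ltn_ind => n IH; apply/eqP; rewrite -cm_eq0; apply/negPn/negP => cn.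
have cn0 : 0 < cm (c n) by rewrite lt_def cn cm_ge0.
pose A := cm (c n) * x0 ^+ n; have A0 : 0 < A by rewrite mulr_gt0 // exprn_gt0.
(* At x = x0 q the leading term has modulus A q^n and the later ones at most 2 M q^(n+1) <= A q^n /
   2, which leaves more than the A q^n / 4 allowed by convergence to 0. *)
pose q := Num.min (1 / 2) (A / (4 * M)).
have q0 : 0 < q by rewrite lt_min !divr_gt0 // mulr_gt0.
have q1 : q <= 1 / 2 by rewrite ge_min lexx.
have qA : q * (4 * M) <= A by rewrite -ler_pdivlMr ?mulr_gt0 // ge_min lexx orbT.
pose x := x0 * q.
have x_0 : 0 < x by rewrite mulr_gt0.
have xd : x < d.
  by rewrite (lt_trans _ x0d) // /x -[ltRHS]mulr1 ltr_pM2l // (le_lt_trans q1) //; lra.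
have e0 : 0 < A * q ^+ n / 4 by rewrite divr_gt0 // mulr_gt0 // exprn_gt0.
have [|N HN] := h x _ _ e0; first by rewrite x_0.
have := HN (maxn N n.+1) (leq_maxl _ _); rewrite subr0.
set m := maxn _ _; have nm : (n < m)%N by rewrite leq_maxr.
rewrite -(big_mkord xpredT (fun k => c k * x%:C ^+ k)) (big_cat_nat (n := n)) //=; last exact: ltnW.
rewrite big_nat big1 ?add0r; last by move=> i /andP[_ /IH ->]; rewrite mul0r.
rewrite big_ltn // => H.
have T : cm (\sum_(n.+1 <= i < m) c i * x%:C ^+ i) <= M * (2 * q ^+ n.+1).
  rewrite (le_trans (cm_sum _ _ _)) //.
  apply: le_trans (ler_wpM2l (ltW M0) (@geo_tail_le q n.+1 m (ltW q0) q1)).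
  rewrite mulr_sumr; apply: ler_sum => i _.
  rewrite cmM cmX cm_real gtr0_norm // /x exprMn mulrA ler_wpM2r // exprn_ge0 //.
  exact: ltW.
have E : cm (c n * x%:C ^+ n) = A * q ^+ n.
  by rewrite cmM cmX cm_real gtr0_norm // /x exprMn mulrA.
have Q : M * (2 * q ^+ n.+1) <= A * q ^+ n / 2.
  rewrite exprS; have -> : M * (2 * (q * q ^+ n)) = (q * (4 * M)) * q ^+ n / 2 by field.
  by rewrite ler_pM2r // ler_pM2r // exprn_gt0.
have := cm_tri (c n * x%:C ^+ n) (- (\sum_(n.+1 <= i < m) c i * x%:C ^+ i)).
rewrite cmN opprK E; lra.
Qed.

(** Compactness by [square_ind] on the square of side 2 A. The local bound is required at every
    point of the plane, so closedness of [S] is not mentioned. *)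
Lemma locally_bounded_box (S : R[i] -> Prop) g (A : R) : 0 < A ->
  (forall w, S w -> cm w <= A) ->
  (forall p, exists2 d : R, 0 < d & exists M, forall w, cm (w - p) < d -> S w -> cm (g w) <= M) ->
  exists M : R, forall w, S w -> cm (g w) <= M.
Proof.
move=> A0 hS hloc.
pose P (x y l : R) := exists M : R, forall u v : R, x <= u <= x + l -> y <= v <= y + l ->
  S ((u - A) +i* (v - A)) -> cm (g ((u - A) +i* (v - A))) <= M.
have AA : 0 < A + A by rewrite addr_gt0.
have : P 0 0 (A + A).
  apply: (@square_ind _ _ P) => //.
    move=> x y l l0 [M1 H1] [M2 H2] [M3 H3] [M4 H4].
    exists (Num.max (Num.max M1 M2) (Num.max M3 M4)) => u v /andP[u1 u2] /andP[v1 v2] hs.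
    rewrite !le_max.
    have [ux|ux] := leP u (x + l); have [vy|vy] := leP v (y + l).
    - by rewrite H1 ?u1 ?v1.
    - by rewrite H3 ?u1 ?(ltW vy) ?orbT //= -addrA.
    - by rewrite H2 ?v1 ?(ltW ux) ?orbT //= -addrA.
    - by rewrite H4 ?(ltW vy) ?(ltW ux) ?orbT //= -addrA.
  move=> p q _ _; have [d d0 [M HM]] := hloc ((p - A) +i* (q - A)).
  exists (d / 2) => [|x y l /andP[l0 ld] /andP[p1 p2] /andP[q1 q2]].
    by rewrite divr_gt0.
  exists M => u v /andP[u1 u2] /andP[v1 v2]; apply: HM.
  apply: (le_lt_trans (cm_le_ReIm _)); rewrite ReB ImB /=.
  have h1 : `|u - A - (p - A)| <= l by rewrite ler_norml; lra.
  have h2 : `|v - A - (q - A)| <= l by rewrite ler_norml; lra.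
  lra.
case=> M HM; exists M => w Sw.
have := HM (complex.Re w + A) (complex.Im w + A).
rewrite !addrK !add0r; have -> : complex.Re w +i* complex.Im w = w by case: (w).
apply => //; have := hS w Sw; have := Re_le_cm w; have := Im_le_cm w;
 rewrite !ler_norml; lra.
Qed.

Lemma bounded_disk g : (forall w, cm w <= 1 -> cdiff g w) ->
  exists M : R, forall w, cm w <= 1 -> cm (g w) <= M.
Proof.
move=> hg; apply: (@locally_bounded_box (fun w => cm w <= 1) g 1) => // p.
have [p1|p1] := leP (cm p) 1.
  have [d d0 Hd] := cdiff_cont (hg p p1) ltr01; exists d => //.
  exists (cm (g p) + 1) => w /Hd h _.
  rewrite -(subrK (g p) (g w)) (le_trans (cmD _ _)) // addrC lerD2l ltW //.
exists (cm p - 1); first by rewrite subr_gt0.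
exists 0 => w h hw; exfalso; have := cm_tri p w; rewrite cmC; lra.
Qed.

(** Analytic continuation: on a disk of radius rho between |t| and 1, g has a Taylor series, whose
    coefficients agree with those of [b] by comparison on a short real segment. *)
Lemma analytic_unit g b : (forall w, cm w < 1 -> cdiff g w) ->
  (exists2 d : R, 0 < d & forall x : R, 0 < x < d -> psum b x%:C (g x%:C)) ->
  forall t, cm t < 1 -> psum b t (g t).
Proof.
move=> hg [d d0 hd] t t1.
pose rho := (1 + cm t) / 2; have t0 := cm_ge0 t.
have rho0 : 0 < rho by rewrite /rho; lra.
have rho1 : rho < 1 by rewrite /rho; lra.
have trho : cm t < rho by rewrite /rho; lra.
pose G z := g (rho%:C * z).
have rhoC : rho%:C != 0 by rewrite -cm_gt0 cm_real gtr0_norm.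
have dG w : cm w <= 1 -> cdiff G w.
  move=> w1; have [|D HD] := hg (rho%:C * w).
    rewrite cmM cm_real gtr0_norm // (le_lt_trans _ rho1) // -[leRHS]mulr1.
    by rewrite ler_pM2l.
  exists (D * rho%:C) => e e0; have [h h0 Hh] := HD (e / rho) (divr_gt0 e0 rho0).
  exists h => // v vw.
  have E : cm (rho%:C * v - rho%:C * w) = rho * cm (v - w).
    by rewrite -mulrBr cmM cm_real gtr0_norm.
  have := Hh (rho%:C * v); rewrite E mulrA divfK ?lt0r_neq0 // -mulrBr mulrA; apply.
  rewrite (le_lt_trans _ vw) // -[leRHS]mul1r ler_wpM2r ?cm_ge0 // ltW //.
have [M HM] := bounded_disk dG.
have [a [Ha Ta]] := taylor_disk dG HM.
have M0 : 0 <= 2 * M by apply: le_trans (Ha 0%N); exact: cm_ge0.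
have psG z : cm z < 1 -> psum a z (G z).
  move=> z1 e e0.
  have e20 : 0 < e / 2 by rewrite divr_gt0.
  have [|N HN] := @geo_small _ (cm z) (2 * M / (1 - cm z)) _ (e / 2) e20.
    by rewrite cm_ge0.
  exists N => n /HN h; rewrite cmC (le_lt_trans (Ta z n z1)) //.
  have -> : 2 * M * (cm z ^+ n / (1 - cm z)) = 2 * M / (1 - cm z) * cm z ^+ n by ring.
  lra.
have ab : forall k, a k - b k * rho%:C ^+ k = 0.
  apply: (@ps_unique _ (Num.min 1 d)) => [|x]; first by rewrite lt_min ltr01.
  rewrite lt_min => /andP[x0 /andP[x1 xd]].
  have h1 : psum a x%:C (G x%:C) by apply: psG; rewrite cm_real gtr0_norm.
  have h2 : psum (fun k => b k * rho%:C ^+ k) x%:C (G x%:C).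
    rewrite /G -rmorphM; have := hd (rho * x).
    rewrite mulr_gt0 //= => /(_ _) H; apply: ccvg_eq (H _) => [n|].
      by apply: eq_bigr => k _; rewrite rmorphM exprMn mulrA.
    by rewrite (lt_trans _ xd) // -[ltRHS]mul1r ltr_pM2r.
  by have := psumB h1 h2; rewrite subrr.
have h := psG (t / rho%:C).
have E : rho%:C * (t / rho%:C) = t by rewrite mulrC divfK.
rewrite /G E in h; apply: ccvg_eq (h _) => [n|].
  apply: eq_bigr => k _; have /eqP := ab k; rewrite subr_eq0 => /eqP ->.
  by rewrite expr_div_n mulrA mulrAC mulfK // expf_neq0.
by rewrite cmM cmV cm_real gtr0_norm // ltr_pdivrMr // mul1r.
Qed.

(* [k = 0] gives the coefficient [0] since [0^-1 = 0]. *)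
Definition logcoef (k : nat) : R[i] := (k%:R^-1 : R)%:C.

(** The remainder [phi N] vanishes at 0 and has derivative u^N / (1 - u), so the mean value theorem
    makes it O(x^(N+1)). The whole disk then follows by [analytic_unit]. *)
Lemma real_log_series (x : R) : 0 < x < 1 / 2 ->
  psum logcoef x%:C (- clog (1 - x%:C)).
Proof.
move=> /andP[x0 x1].
pose phi N (y : R) := - ln (1 - y) - \sum_(k < N) y ^+ k.+1 / k.+1%:R.
have dphi N (y : R) : y < 1 -> is_derive y 1 (phi N) ((1 - y)^-1 - \sum_(k < N) y ^+ k).
  move=> y1; have y1' : 0 < 1 - y by rewrite subr_gt0.
  rewrite /phi.
  have dl : is_derive y 1 (fun y => - ln (1 - y)) (1 - y)^-1.
    have d1 : is_derive y 1 (fun y : R => 1 - y) (-1).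
      by apply: is_derive_eq; rewrite add0r mul1r.
    have := @is_derive1_comp _ (@ln R) (fun y => 1 - y) _ _ _ (is_derive1_ln y1') d1.
    rewrite mulrN1 => d2; have := is_deriveN d2; rewrite opprK //.
  have ds : is_derive y 1 (fun y => \sum_(k < N) y ^+ k.+1 / k.+1%:R) (\sum_(k < N) y ^+ k).
    elim: N => [|N IH].
      have := is_derive_cst (0 : R) y 1; congr is_derive; last by rewrite big_ord0.
      by apply/funext => v; rewrite big_ord0.
    have dN : is_derive y 1 (fun y => y ^+ N.+1 / N.+1%:R) (y ^+ N).
      have := is_deriveZ (N.+1%:R^-1) (is_deriveX N.+1 (is_derive_id y (1 : R))).
      rewrite /GRing.scale /= mulr1 mulKf ?pnatr_eq0 //; congr is_derive.
      by apply/funext => v; rewrite /GRing.scale /= exprfctE mulrC.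
    have := is_deriveD IH dN; congr is_derive; last by rewrite big_ord_recr.
    by apply/funext => v; rewrite big_ord_recr.
  exact: is_deriveB.
have B N : `|phi N x| <= 2 * x ^+ N.+1.
  have cphi : {within `[0, x], continuous (phi N)}.
    apply: derivable_within_continuous => y; rewrite in_itv /= => /andP[_ yx].
    by have [|] := dphi N y; first lra.
  have [|u] := @MVT_segment R (phi N) (fun y => (1 - y)^-1 - \sum_(k < N) y ^+ k) 0 x (ltW x0) _ cphi.
    by move=> y; rewrite in_itv /= => /andP[_ yx]; apply: dphi; lra.
  rewrite in_itv /= => /andP[u0 ux].
  have -> : phi N 0 = 0.
    rewrite /phi subr0 ln1 oppr0 big1 ?subr0 // => k _.
    by rewrite expr0n /= mul0r.
  have u1 : 0 < 1 - u by lra.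
  have -> : (1 - u)^-1 - \sum_(k < N) u ^+ k = u ^+ N / (1 - u).
    have := subrXX 1 u N; rewrite expr1n => E.
    have {}E : 1 - u ^+ N = (1 - u) * \sum_(k < N) u ^+ k.
      by rewrite E; congr (_ * _); apply: eq_bigr => k _; rewrite expr1n mul1r.
    apply: (mulfI (lt0r_neq0 u1)); rewrite mulrBr -E mulfV ?lt0r_neq0 //.
    by rewrite mulrCA mulfV ?lt0r_neq0 //; ring.
  rewrite !subr0 => ->; rewrite exprSr mulrA.
  rewrite normrM (gtr0_norm x0) ler_pM2r // normrM ger0_norm ?exprn_ge0 //.
  rewrite mulrC ler_pM ?exprn_ge0 //; last by rewrite lerXn2r // nnegrE // ltW.
  rewrite ger0_norm ?invr_ge0 ?(ltW u1) // -div1r ler_pdivrMr //; lra.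
move=> e e0.
have e20 : 0 < e / 2 by rewrite divr_gt0.
have [|N HN] := @geo_small _ x (2 * x) _ (e / 2) e20.
  by rewrite (ltW x0) /=; lra.
have x1' : 0 < 1 - x by lra.
have L : clog (1 - x%:C) = (ln (1 - x))%:C.
  have -> : 1 - x%:C = cexp (ln (1 - x))%:C.
    rewrite /cexp /= lnK ?posrE // expi0 mulr1 rmorphB rmorph1 //.
  by rewrite clog_cexp //= normr0 pi_gt0.
exists N.+1 => -[//|n]; rewrite ltnS => /HN h.
rewrite big_ord_recl /= /logcoef invr0 mul0r add0r L.
have -> : \sum_(i < n) (((bump 0 i)%:R^-1 : R)%:C) * x%:C ^+ bump 0 i - - (ln (1 - x))%:C
   = (- phi n x)%:C.
  rewrite /phi opprB rmorphB rmorphN rmorph_sum opprK; congr (_ + _).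
  by apply: eq_bigr => i _; rewrite rmorphM rmorphXn mulrC.
rewrite cm_real normrN (le_lt_trans (B n)) // exprS mulrA; lra.
Qed.

Lemma cdiff_log1m w : slit (1 - w) -> cdiff (fun t => - clog (1 - t)) w.
Proof.
move=> hs; exists ((1 - w)^-1) => e e0.
have [h h0 Hh] := cdiff_clog hs e0.
exists h => // v vw; have := Hh (1 - v).
have -> : 1 - v - (1 - w) = - (v - w) by ring.
rewrite cmN => /(_ vw); rewrite -cmN; congr (cm _ <= _); ring.
Qed.

Lemma slit_disk w : cm w < 1 -> slit (1 - w).
Proof.
move=> w1 [_]; rewrite ReB /= => h; have := Re_le_cm w; rewrite ler_norml; lra.
Qed.

Lemma log_series t : cm t < 1 -> psum logcoef t (- clog (1 - t)).
Proof.
apply: (@analytic_unit (fun t => - clog (1 - t))).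
  by move=> w w1; apply: cdiff_log1m; exact: slit_disk.
by exists (1 / 2) => // x hx; exact: real_log_series.
Qed.

Lemma log_singE (r theta : R) t : slit (1 - t / r%:C) ->
  log_sing r theta t = theta%:C * (- clog (1 - t / r%:C)).
Proof. by move=> h; rewrite /log_sing div1r clogV. Qed.

End PowerSeries.

(** * Singularity analysis *)

Section Delta.
Variable R : realType.
Implicit Types (g f : R[i] -> R[i]) (z t w : R[i]).

Lemma acos_gt_cos (x phi : R) : -1 <= x <= 1 -> 0 <= phi <= pi -> x < cos phi ->
  phi < acos x.
Proof.
move=> x1 phi01 xc; rewrite ltNge; apply/negP => h.
have a0 := acos_ge0 x1; have a1 := acos_lepi x1.
have : cos phi <= cos (acos x).
  move: h; rewrite le_eqVlt => /orP[/eqP -> //|h]; apply: ltW.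
  by rewrite ltr_cos // in_itv /= ?a0 ?a1.
by rewrite acosK ?in_itv //= leNgt xc.
Qed.

Lemma cdiff_lin g (k : R[i]) w : cdiff g (k * w) -> cdiff (fun z => g (k * z)) w.
Proof.
move=> [D HD]; exists (D * k) => e e0.
have c0 : 0 < cm k + 1 by rewrite ltr_wpDl // cm_ge0.
have [h h0 Hh] := HD (e / (cm k + 1)) (divr_gt0 e0 c0).
exists (h / (cm k + 1)); first by rewrite divr_gt0.
move=> v; rewrite ltr_pdivlMr // => vw.
have E : cm (k * v - k * w) = cm k * cm (v - w) by rewrite -mulrBr cmM.
have le1 : cm k * cm (v - w) <= cm (v - w) * (cm k + 1).
  by rewrite mulrC ler_wpM2l ?cm_ge0 // lerDl.
have := Hh (k * v); rewrite E => /(_ (le_lt_trans le1 vw)).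
have -> : D * (k * v - k * w) = D * k * (v - w) by ring.
move=> /le_trans; apply.
by rewrite mulrAC ler_pdivrMr // -mulrA ler_pM2l.
Qed.

Lemma cdiffB f g w : cdiff f w -> cdiff g w -> cdiff (fun z => f z - g z) w.
Proof.
move=> [D HD] [E HE]; exists (D - E) => e e0.
have e20 : 0 < e / 2 by rewrite divr_gt0.
have [h h0 Hh] := HD _ e20; have [k k0 Hk] := HE _ e20.
exists (Num.min h k); first by rewrite lt_min h0.
move=> v; rewrite lt_min => /andP[/Hh vh /Hk vk].
have -> : f v - g v - (f w - g w) - (D - E) * (v - w) =
  (f v - f w - D * (v - w)) - (g v - g w - E * (v - w)) by ring.
rewrite (le_trans (cmB _ _)) //; lra.
Qed.

Lemma cdiffZ f k w : cdiff f w -> cdiff (fun z => k * f z) w.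
Proof.
move=> [D HD]; exists (k * D) => e e0.
have c0 : 0 < cm k + 1 by rewrite ltr_wpDl // cm_ge0.
have [h h0 Hh] := HD (e / (cm k + 1)) (divr_gt0 e0 c0).
exists h => // v /Hh H.
have -> : k * f v - k * f w - k * D * (v - w) = k * (f v - f w - D * (v - w)) by ring.
rewrite cmM (le_trans (ler_wpM2l (cm_ge0 k) H)) //.
rewrite mulrA ler_wpM2r ?cm_ge0 // mulrCA ger_pMr //.
by rewrite ler_pdivrMr // mul1r lerDl.
Qed.

Definition sing_diff (r theta : R) (K : R[i]) g t : R[i] :=
  g (r%:C * t) - (theta%:C * (- clog (1 - t)) + K).

(** The domain is rescaled to r = 1 and its angle condition read as Re (w - 1) < cos phi |w - 1|. A
    point t of the unit disk satisfies Re (t - 1) <= 0, which leaves room for a disk of radius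
    proportional to |t - 1|. Near 1 the bound on f is the hypothesis; away from 1 boundedness is
    enough. *)
Lemma class_F_local (r theta : R) (K : Cplx R) (g : Cplx R -> Cplx R) :
  class_F r theta K g ->
  exists2 c : R, 0 < c <= 1 / 4 & exists2 M : R, 0 < M &
    forall t w, cm t < 1 -> cm (w - t) <= c * cm (t - 1) ->
      cdiff (sing_diff r theta K g) w /\ cm (sing_diff r theta K g w) <= M * cm (t - 1).
Proof.
move=> [r0 th0 [rho [phi [rrho /andP[phi0 phi1] hol [M /cnearP[del del0 Hdel]]]]]].
have pi0 := pi_gt0 R.
have rC : r%:C != 0 by rewrite -cm_gt0 cm_real gtr0_norm.
pose rho1 := rho / r; have rho11 : 1 < rho1 by rewrite ltr_pdivlMr // mul1r.
pose kap := cos phi.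
have kap0 : 0 < kap by apply: cos_gt0_pihalf; apply/andP; split; lra.
have kap1 : kap < 1.
  by rewrite -(@cos0 R) /kap ltr_cos ?in_itv //=; apply/andP; split; lra.
pose f := sing_diff r theta K g; rewrite -/f.
have inD w : cm w < rho1 -> w != 1 -> complex.Re (w - 1) < kap * cm (w - 1) ->
    Delta0 r rho phi (r%:C * w : Cplx R).
  move=> w1 w2 w3.
  have w10 : w - 1 != 0 by rewrite subr_eq0.
  have c10 : 0 < cm (w - 1) by rewrite cm_gt0.
  have E : r%:C * w - r%:C = r%:C * (w - 1) by rewrite mulrBr mulr1.
  split.
  - rewrite norm_cm ltcR cmM cm_real gtr0_norm // mulrC -ltr_pdivlMr //.
  - by rewrite -subr_eq0 E mulf_neq0.
  - rewrite E carg_norm; apply: acos_gt_cos; first exact: Re_div_cm.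
      by apply/andP; split; lra.
    rewrite ReM_real cmM cm_real gtr0_norm // -mulf_div divff ?lt0r_neq0 // mul1r.
    by rewrite ltr_pdivrMr.
have slitD w : w != 1 -> complex.Re (w - 1) < kap * cm (w - 1) -> slit (1 - w).
  move=> w2 w3 [i0 re0].
  have E : complex.Re (w - 1) = cm (w - 1).
    have -> : w - 1 = (complex.Re (w - 1))%:C.
      rewrite {1}[w - 1]complex_decomp -[w - 1]opprB.
      have -> : complex.Im (- (1 - w)) = - complex.Im (1 - w) by case: (1 - w).
      by rewrite i0 oppr0 mulr0 addr0.
    rewrite cm_real ger0_norm //=.
    have -> : complex.Re (w - 1) = - complex.Re (1 - w).
      by rewrite -[w - 1]opprB; case: (1 - w).
    by rewrite oppr_ge0.
  move: w3; rewrite E -[ltLHS]mul1r ltr_pM2r ?cm_gt0 ?subr_eq0 //; lra.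
have fdiff w : cm w < rho1 -> w != 1 -> complex.Re (w - 1) < kap * cm (w - 1) ->
    cdiff f w.
  move=> w1 w2 w3; rewrite /f /sing_diff.
  apply: cdiffB; first by apply: cdiff_lin; apply: derivable_cdiff; apply: hol; exact: inD.
  have h1 : cdiff (fun t => - clog (1 - t)) w by apply: cdiff_log1m; exact: slitD.
  have := cdiffB (cdiffZ theta%:C h1) (@cdiff_cst _ (- K) w).
  congr cdiff; by apply/funext => v; rewrite opprK.
have fnear w : cm w < rho1 -> w != 1 -> complex.Re (w - 1) < kap * cm (w - 1) ->
    cm (w - 1) < del / r -> cm (f w) <= `|M| * r * cm (w - 1).
  move=> w1 w2 w3 w4.
  have E : r%:C * w - r%:C = r%:C * (w - 1) by rewrite mulrBr mulr1.
  have := Hdel (r%:C * w); rewrite /= E cmM cm_real gtr0_norm //.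
  rewrite mulrC -ltr_pdivlMr // => /(_ w4 (inD w w1 w2 w3)).
  have E1 : r%:C * w / r%:C = w by rewrite mulrC mulKf.
  rewrite norm_cm (@log_singE R r theta (r%:C * w)); last by rewrite E1; exact: slitD.
  rewrite E1 norm_cm -rmorphM lecR => /le_trans; apply.
  rewrite cmM cm_real gtr0_norm // mulrA ler_wpM2r ?cm_ge0 //.
  by rewrite ler_pM2r // ler_norm.
pose rho2 := (1 + rho1) / 2.
pose d' := del / r; have d'0 : 0 < d' by rewrite divr_gt0.
rewrite -/d' in fnear.
move: kap rho1 d' f kap0 kap1 rho11 d'0 fdiff fnear {inD slitD Hdel hol phi0 phi1 pi0 rrho th0 rC del0} @rho2.
move=> kap rho1 d' f kap0 kap1 rho11 d'0 fdiff fnear rho2.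
(* A compact part of the domain away from 1, with margins [rho2 < rho1] and [kap / 2 < kap]; there a
   constant bound is also a multiple of |w - 1|. *)
pose S w := [/\ cm w <= rho2, complex.Re (w - 1) <= kap / 2 * cm (w - 1) & d' <= cm (w - 1)].
have rho20 : 0 < rho2 by rewrite /rho2; lra.
have [|p|M1 HM1] := @locally_bounded_box _ S f rho2 rho20.
- by move=> w [].
- have [[p1 p2 p3]|nS] := pselect (S p).
    have cp0 : 0 < cm (p - 1) by apply: lt_le_trans p3.
    have fp : cdiff f p.
      apply: fdiff; first by rewrite (le_lt_trans p1) // /rho2; lra.
        by rewrite -subr_eq0 -cm_gt0.
      rewrite (le_lt_trans p2) // ltr_pM2r //; lra.
    have [d d0 Hd] := cdiff_cont fp ltr01.
    exists d => //; exists (cm (f p) + 1) => w /Hd h _.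
    by rewrite -(subrK (f p) (f w)) (le_trans (cmD _ _)) // addrC lerD2l ltW.
  have [p1|p1] := leP (cm p) rho2; last first.
    exists (cm p - rho2); first by rewrite subr_gt0.
    exists 0 => w h [hw _ _]; exfalso; have := cm_tri p w; rewrite cmC; lra.
  have [p2|p2] := leP (complex.Re (p - 1)) (kap / 2 * cm (p - 1)); last first.
    pose eta := complex.Re (p - 1) - kap / 2 * cm (p - 1).
    have eta0 : 0 < eta by rewrite subr_gt0.
    exists (eta / 2); first by rewrite divr_gt0.
    exists 0 => w h [_ hw _]; exfalso.
    have h1 := Re_le_cm (w - p); move: h1; rewrite ler_norml => /andP[h1 _].
    have E : w - 1 = (w - p) + (p - 1) by ring.
    have h2 : complex.Re (w - 1) = complex.Re (w - p) + complex.Re (p - 1).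
      by rewrite !ReB; ring.
    have h3 : cm (w - 1) <= cm (w - p) + cm (p - 1) by rewrite {1}E cmD.
    have h4 : kap / 2 * cm (w - 1) <= kap / 2 * (cm (w - p) + cm (p - 1)).
      by rewrite ler_wpM2l //; lra.
    have h5 : kap / 2 * cm (w - p) <= 1 * cm (w - p).
      by rewrite ler_wpM2r ?cm_ge0 //; lra.
    move: h h1 hw; rewrite h2 /eta; lra.
  have [p3|p3] := leP d' (cm (p - 1)); first by exfalso; apply: nS.
  exists (d' - cm (p - 1)); first by rewrite subr_gt0.
  exists 0 => w h [_ _ hw]; exfalso.
  have E : w - 1 = (w - p) + (p - 1) by ring.
  have : cm (w - 1) <= cm (w - p) + cm (p - 1) by rewrite {1}E cmD.
  lra.
(* The three bounds preserve, in turn, the angle condition with [kap / 2], the radius [rho2], and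
   the comparability of |w - 1| with |t - 1|. *)
pose c := Num.min (kap / 4) (Num.min ((rho1 - 1) / 4) (1 / 4)).
have c0 : 0 < c by rewrite !lt_min !divr_gt0 // subr_gt0.
have c1 : c <= kap / 4 by rewrite ge_min lexx.
have c2 : c <= (rho1 - 1) / 4 by rewrite !ge_min lexx orbT.
have c3 : c <= 1 / 4 by rewrite !ge_min lexx !orbT.
have M10 : 0 <= `|M1| / d' by rewrite divr_ge0 // ltW.
have M20 : 0 <= `|M| * r by rewrite mulr_ge0 // ltW.
exists c; first by rewrite c0.
exists (2 * (`|M| * r + `|M1| / d' + 1)).
  by rewrite mulr_gt0 // ltr_wpDl // addr_ge0.
move=> t w t1 wt.
have ct2 : cm (t - 1) <= 2 by rewrite (le_trans (cmB _ _)) // cm1; lra.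
have ct0 : 0 < cm (t - 1).
  rewrite cm_gt0 subr_eq0; apply/eqP => E; move: t1; rewrite E cm1 ltxx //.
have Et : w - 1 = (w - t) + (t - 1) by ring.
have cct : c * cm (t - 1) <= 1 / 4 * cm (t - 1) by rewrite ler_pM2r.
have W1 : 3 / 4 * cm (t - 1) <= cm (w - 1).
  have := cm_tri (t - 1) (t - w).
  have -> : t - 1 - (t - w) = w - 1 by ring.
  rewrite (cmC t w); lra.
have W2 : cm (w - 1) <= 2 * cm (t - 1).
  rewrite Et (le_trans (cmD _ _)) //; lra.
have W0 : 0 < cm (w - 1) by apply: lt_le_trans W1; lra.
have Wr : complex.Re (w - 1) <= kap / 2 * cm (w - 1).
  have h1 := Re_le_cm (w - t); move: h1; rewrite ler_norml => /andP[_ h1].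
  have h2 : complex.Re (w - 1) = complex.Re (w - t) + complex.Re (t - 1).
    by rewrite !ReB; ring.
  have h3 : complex.Re (t - 1) <= 0.
    rewrite ReB /= subr_le0; have := Re_le_cm t; rewrite ler_norml; lra.
  have h4 : c * cm (t - 1) <= kap / 4 * cm (t - 1) by rewrite ler_pM2r.
  have h5 : kap / 2 * (3 / 4 * cm (t - 1)) <= kap / 2 * cm (w - 1).
    rewrite ler_wpM2l //; lra.
  have h6 : 0 <= kap * cm (t - 1) by rewrite mulr_ge0 // ltW.
  lra.
have Ww : cm w <= rho2.
  have E : w = (w - t) + t by ring.
  rewrite E (le_trans (cmD _ _)) //.
  have : c * cm (t - 1) <= (rho1 - 1) / 4 * 2.
    by apply: ler_pM => //; exact: ltW.
  rewrite /rho2; lra.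
have wn1 : w != 1 by rewrite -subr_eq0 -cm_gt0.
have Wr' : complex.Re (w - 1) < kap * cm (w - 1).
  rewrite (le_lt_trans Wr) // ltr_pM2r //; lra.
have Ww' : cm w < rho1 by rewrite (le_lt_trans Ww) // /rho2; lra.
split; first exact: fdiff.
have B : cm (f w) <= (`|M| * r + `|M1| / d' + 1) * cm (w - 1).
  have [h|h] := ltP (cm (w - 1)) d'.
    rewrite (le_trans (fnear _ Ww' wn1 Wr' h)) // ler_pM2r //; lra.
  have := HM1 w; rewrite /S => /(_ _)/le_trans -> //.
  rewrite (le_trans (ler_norm _)) //.
  apply: (@le_trans _ _ (`|M1| / d' * cm (w - 1))); last by rewrite ler_pM2r //; lra.
  by rewrite mulrAC ler_pdivlMr // ler_wpM2l.
rewrite (le_trans B) // (mulrC 2) -mulrA ler_wpM2l //; lra.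
Qed.

End Delta.

Section PowerTails.
Variable R : realType.

(** Convexity of the power: with x = 1 / k it amounts to 1 + d x <= (1 - x)^(-d). The right-hand
    side telescopes in [powRN_tail]. *)
Lemma powRN_step (d : R) (k : nat) : 0 < d -> (1 < k)%N ->
  d * k%:R `^ (- 1 - d) <= k.-1%:R `^ (- d) - k%:R `^ (- d).
Proof.
move=> d0 k1; case: k k1 => // k k1.
have k0 : 0 < k.+1%:R :> R by rewrite ltr0n.
have k'0 : 0 < k%:R :> R by rewrite ltr0n.
pose x : R := k.+1%:R^-1.
have x0 : 0 < x by rewrite invr_gt0.
have x1 : x < 1 by rewrite invf_lt1 // ltr1n.
have kE : k%:R = k.+1%:R * (1 - x) :> R.
  by rewrite mulrBr mulr1 mulfV ?lt0r_neq0 // -natr1 addrK.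
have x1' : 0 < 1 - x by rewrite subr_gt0.
rewrite /= kE powRM ?(ltW k0) ?(ltW x1') // addrC powRD; last by rewrite lt0r_neq0 ?implybT.
rewrite powR_inv1 ?(ltW k0) // -/x.
have P0 : 0 <= k.+1%:R `^ (- d) by exact: powR_ge0.
have H : 1 + d * x <= (1 - x) `^ (- d).
  rewrite /powR gt_eqF // (le_trans _ (expR_ge1Dx _)) // lerD2l mulNr -mulrN.
  rewrite ler_pM2l // lerNr.
  by have := @le_ln1Dx R (- x); rewrite ltrNl opprK => /(_ x1).
have := ler_wpM2l P0 H. lra.
Qed.

Lemma powRN_tail (d : R) (n m : nat) : 0 < d -> (0 < n)%N ->
  \sum_(n.+1 <= k < m) k%:R `^ (- 1 - d) <= n%:R `^ (- d) / d.
Proof.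
move=> d0 n0; rewrite ler_pdivlMr // mulr_suml.
have [mn|nm] := leqP m n.+1; first by rewrite big_geq // powR_ge0.
have H j : \sum_(n.+1 <= k < n.+1 + j) k%:R `^ (- 1 - d) * d
    <= n%:R `^ (- d) - (n + j)%:R `^ (- d).
  elim: j => [|j IH]; first by rewrite addn0 big_geq // addn0 subrr.
  rewrite addnS big_nat_recr ?leq_addr //=.
  apply: le_trans (lerD IH _) _; first by rewrite mulrC; apply: powRN_step => //; rewrite addSn ltnS (leq_trans n0) // leq_addr.
  by rewrite addSn /= addrA subrK addnS.
rewrite -(subnKC (ltnW nm)) (le_trans (H _)) //.
by rewrite gerBl powR_ge0.
Qed.

Lemma powRN_small (d e : R) : 0 < d -> 0 < e ->
  exists N : nat, forall n, (N <= n)%N -> n%:R `^ (- d) <= e.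
Proof.
move=> d0 e0.
pose A := expR (- (ln e) / d); have A0 : 0 < A by exact: expR_gt0.
exists (Num.bound A) => n Nn.
have An : A < n%:R.
  by rewrite (lt_le_trans (archi_boundP (ltW A0))) // ler_nat.
have n0 : 0 < n%:R :> R by apply: lt_trans An.
rewrite /powR gt_eqF // -[leRHS](lnK (x := e)) ?posrE // ler_expR.
rewrite mulNr lerNl mulrC -ler_pdivrMr // -[leLHS]expRK ler_ln ?posrE //.
exact: ltW.
Qed.

Lemma bernoulli_ge (x : R) n : 0 <= x <= 1 -> 1 - n%:R * x <= (1 - x) ^+ n.
Proof.
move=> /andP[x0 x1]; elim: n => [|n IH]; first by rewrite mul0r subr0 expr0.
rewrite exprS -natr1 mulrDl mul1r.
have h : 0 <= 1 - x by rewrite subr_ge0.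
apply: le_trans (ler_wpM2l h IH).
have : 0 <= n%:R * x * x by rewrite !mulr_ge0.
nra.
Qed.

End PowerTails.

(** * Second differences and averages over roots of unity *)

Section Transfer.
Variable R : realType.
Implicit Types (f : R[i] -> R[i]) (b : nat -> R[i]) (z t w : R[i]).

Lemma cdiff_affine f t (k : R[i]) w : cdiff f (t + k * w) ->
  cdiff (fun z => f (t + k * z)) w.
Proof.
move=> h; apply: (@cdiff_lin _ (fun z => f (t + z))).
case: h => D HD; exists D => e e0; have [r r0 Hr] := HD e e0; exists r => // v vr.
have E : t + v - (t + k * w) = v - k * w by ring.
by have := Hr (t + v); rewrite E; apply.
Qed.

Section SecondDifference.
Variables (f : R[i] -> R[i]) (c M : R) (c01 : 0 < c <= 1 / 4) (M0 : 0 < M).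
Hypothesis hf : forall t w, cm t < 1 -> cm (w - t) <= c * cm (t - 1) ->
  cdiff f w /\ cm (f w) <= M * cm (t - 1).

(* If [h] is small against [cm (t - 1)], the Taylor expansion of f on the disk of radius
   c |t - 1| about t is used; otherwise the three terms are bounded separately. *)
Lemma second_difference (h : R) t : 0 < h -> cm t < 1 ->
  cm (f (t * expi h) + f (t * (expi h)^-1) - 2 * f t) <=
    80 * M / c ^+ 2 * (h ^+ 2 / cm (t - 1)).
Proof.
move=> h0 t1; set tau := expi h; set d := cm (t - 1).
have /andP[c0 c1] := c01.
have tau0 : tau != 0 := expi_neq0 h.
have cmtau : cm tau = 1 := cm_expi h.
have d0 : 0 < d.
  by rewrite cm_gt0 subr_eq0; apply/eqP => E; move: t1; rewrite E cm1 ltxx.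
have d2 : d <= 2 by rewrite (le_trans (cmB _ _)) // cm1; have := ltW t1; lra.
have tauh : cm (tau - 1) <= 2 * h.
  by have := expi_lip h 0; rewrite expi0 subr0 gtr0_norm.
have tauVh : cm (tau^-1 - 1) <= 2 * h.
  have -> : tau^-1 - 1 = - (tau^-1 * (tau - 1)) by field.
  by rewrite cmN cmM cmV cmtau invr1 mul1r.
have cc : c ^+ 2 <= c by rewrite expr2 ger_pMl //; lra.
have c20 : 0 < c ^+ 2 by rewrite exprn_gt0.
have [hs|hl] := leP (4 * h) (c * d).
- pose k := (c * d)%:C.
  have cd0 : 0 < c * d by rewrite mulr_gt0.
  have k0 : k != 0 by rewrite -cm_gt0 cm_real gtr0_norm.
  have cmk : cm k = c * d by rewrite cm_real gtr0_norm.
  pose G z := f (t + k * z).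
  have inn z : cm z <= 1 -> cm (t + k * z - t) <= c * d.
    by move=> z1; rewrite addrAC subrr add0r cmM cmk ger_pMr.
  have dG z : cm z <= 1 -> cdiff G z.
    by move=> z1; apply: cdiff_affine; case: (hf t1 (inn z z1)).
  have bG z : cm z <= 1 -> cm (G z) <= M * d.
    by move=> z1; case: (hf t1 (inn z z1)).
  have [a [Ha Ta]] := taylor_disk dG bG.
  have Md0 : 0 < M * d by rewrite mulr_gt0.
  have T z : cm z <= 1 / 2 -> cm (G z - (a 0%N + a 1%N * z)) <= 4 * (M * d) * cm z ^+ 2.
    move=> z2; have z1 : cm z < 1 by lra.
    have := Ta z 2 z1; rewrite big_ord_recl big_ord1 expr0 mulr1 expr1 => /le_trans; apply.
    rewrite [leLHS]mulrA ler_pdivrMr; last by lra.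
    have : 0 <= (M * d) * cm z ^+ 2 by rewrite mulr_ge0 ?(ltW Md0) // exprn_ge0 // cm_ge0.
    have -> : 4 * (M * d) * cm z ^+ 2 * (1 - cm z) = (M * d) * cm z ^+ 2 * (4 * (1 - cm z)) by ring.
    have -> : 2 * (M * d) * cm z ^+ 2 = (M * d) * cm z ^+ 2 * 2 by ring.
    move=> P; apply: ler_wpM2l => //; lra.
  pose z1 := t * (tau - 1) / k; pose z2 := t * (tau^-1 - 1) / k.
  pose u := 2 * h / (c * d).
  have u2 : u <= 1 / 2 by rewrite /u ler_pdivrMr //; lra.
  have B v : cm v <= 2 * h -> cm (t * v / k) <= u.
    move=> vh; rewrite !cmM cmV cmk /u ler_wpM2r ?invr_ge0 ?(ltW cd0) //.
    by rewrite -[leRHS]mul1r ler_pM ?cm_ge0 // ltW.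
  have Z1 : cm z1 <= u by exact: B.
  have Z2 : cm z2 <= u by exact: B.
  have ek v : k * (v / k) = v by rewrite mulrC divfK.
  have E1 : f (t * tau) = G z1 by rewrite /G /z1 ek; congr f; ring.
  have E2 : f (t * tau^-1) = G z2 by rewrite /G /z2 ek; congr f; ring.
  have E0 : f t = a 0%N.
    have := T 0; rewrite cm0 expr0n mulr0 mulr0 addr0 => /(_ _) H.
    have : cm (G 0 - a 0%N) <= 0 by apply: H; lra.
    by rewrite /G mulr0 addr0 => H'; apply/eqP; rewrite -subr_eq0 -cm_eq0 eq_le H' cm_ge0.
  (* The displacement is multiplicative, so the linear terms do not cancel; but tau + tau^-1 - 2 is
     of second order in h. *)
  have S : z1 + z2 = t * (tau^-1 * (tau - 1) * (tau - 1)) / k.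
    rewrite /z1 /z2 -mulrDl; congr (_ / _); field; exact: tau0.
  rewrite E1 E2 E0.
  have -> : G z1 + G z2 - 2 * a 0%N = (G z1 - (a 0%N + a 1%N * z1)) +
     (G z2 - (a 0%N + a 1%N * z2)) + a 1%N * (z1 + z2) by ring.
  rewrite (le_trans (cmD _ _)) // (le_trans (lerD (cmD _ _) (lexx _))) //.
  have TT v : cm v <= u -> cm (G v - (a 0%N + a 1%N * v)) <= 4 * (M * d) * u ^+ 2.
    move=> vu; rewrite (le_trans (T v (le_trans vu u2))) // ler_wpM2l //.
      by rewrite mulr_ge0 // ltW.
    by rewrite lerXn2r // nnegrE ?cm_ge0 // (le_trans (cm_ge0 v)).
  have T3 : cm (a 1%N * (z1 + z2)) <= 2 * (M * d) * (4 * h ^+ 2 / (c * d)).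
    rewrite cmM ler_pM ?cm_ge0 // S !cmM !cmV cmtau invr1 mul1r cmk.
    rewrite ler_wpM2r ?invr_ge0 ?(ltW cd0) //.
    have -> : 4 * h ^+ 2 = 1 * ((2 * h) * (2 * h)) by ring.
    by rewrite ler_pM ?mulr_ge0 ?cm_ge0 ?(ltW t1) // ler_pM ?cm_ge0.
  rewrite (le_trans (lerD (lerD (TT _ Z1) (TT _ Z2)) T3)) //.
  + have -> : 4 * (M * d) * u ^+ 2 + 4 * (M * d) * u ^+ 2 + 2 * (M * d) * (4 * h ^+ 2 / (c * d))
      = (32 * M + 8 * M * (c * d)) / c ^+ 2 * (h ^+ 2 / d).
      by rewrite /u; field; rewrite !lt0r_neq0.
    rewrite ler_wpM2r ?divr_ge0 ?exprn_ge0 ?(ltW h0) ?(ltW d0) //.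
    rewrite ler_pM2r ?invr_gt0 //.
    have : c * d <= 1 / 4 * 2 by apply: ler_pM => //; exact: ltW.
    nra.
- have F w : cm w < 1 -> cm (f w) <= M * cm (w - 1).
    move=> w1; have [] := hf (t := w) (w := w) w1 _; last by [].
    by rewrite subrr cm0 mulr_ge0 ?cm_ge0 // ltW.
  have D v : cm v = 1 -> cm (v - 1) <= 2 * h -> cm (f (t * v)) <= M * (d + 2 * h).
    move=> v1 vh; rewrite (le_trans (F _ _)) ?cmM ?v1 ?mulr1 // ler_pM2l //.
    have -> : t * v - 1 = (t - 1) + t * (v - 1) by ring.
    rewrite (le_trans (cmD _ _)) // lerD2l cmM -[leRHS]mul1r ler_pM ?cm_ge0 //.
    exact: ltW.
  have D1 := D tau cmtau tauh.
  have D2 := D tau^-1 _ tauVh; rewrite cmV cmtau invr1 in D2.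
  have D3 := F t t1.
  rewrite (le_trans (cmB _ _)) // (le_trans (lerD (cmD _ _) (lexx _))) //.
  rewrite (le_trans (lerD (lerD D1 (D2 erefl)) (_ : _ <= 2 * (M * d)))) //.
    rewrite cmM; have -> : cm (2 : R[i]) = 2.
      by rewrite (_ : (2 : R[i]) = (2 : R)%:C) ?cm_real ?gtr0_norm // rmorphMn rmorph1.
    by rewrite ler_pM2l.
  have h1 : d <= 4 * h / c by rewrite ler_pdivlMr // mulrC ltW.
  have h2 : h <= h / c by rewrite ler_pdivlMr // ger_pMr //; lra.
  have h3 : h / c <= 4 * (h ^+ 2 / d) / c ^+ 2.
    have -> : 4 * (h ^+ 2 / d) / c ^+ 2 = h / c * (4 * h / (c * d)).
      by field; rewrite !lt0r_neq0.
    rewrite ler_peMr ?divr_ge0 ?(ltW h0) ?(ltW c0) //.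
    by rewrite ler_pdivlMr ?mulr_gt0 // mul1r ltW.
  have h4 : M * (d + 2 * h) + M * (d + 2 * h) + 2 * (M * d) <= M * (20 * (h / c)).
    have -> : M * (d + 2 * h) + M * (d + 2 * h) + 2 * (M * d) = M * (4 * d + 4 * h) by ring.
    rewrite ler_pM2l //; move: h1; rewrite -mulrA; lra.
  rewrite (le_trans h4) //.
  have -> : 80 * M / c ^+ 2 * (h ^+ 2 / d) = M * (20 * (4 * (h ^+ 2 / d) / c ^+ 2)) by ring.
  by rewrite ler_pM2l // ler_pM2l.
Qed.

End SecondDifference.

Section RootsOfUnity.
Variables (N : nat) (N0 : (0 < N)%N).
Let om : R[i] := expi (2 * pi / N%:R).

Lemma om_neq0 : om != 0. Proof. exact: expi_neq0. Qed.
Lemma cm_om k : cm (om ^+ k) = 1. Proof. by rewrite cmX cm_expi expr1n. Qed.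
Lemma omN : om ^+ N = 1.
Proof. by rewrite -expiMn mulrC divfK ?expi2pi // pnatr_eq0 -lt0n. Qed.

Lemma om_neq1 m : (0 < m < N)%N -> om ^+ m != 1.
Proof.
move=> /andP[m0 mN]; rewrite -expiMn; apply/eqP => E.
set x := _ * _ in E; pose y := x / 2.
have Nr : 0 < N%:R :> R by rewrite ltr0n.
have y0 : 0 < y < pi.
  rewrite /y /x; have -> : m%:R * (2 * pi / N%:R) / 2 = pi * (m%:R / N%:R) :> R.
    move: (pi : R) => p; field; exact: lt0r_neq0.
  rewrite mulr_gt0 ?pi_gt0 ?divr_gt0 ?ltr0n //= -[ltRHS]mulr1.
  by rewrite ltr_pM2l ?pi_gt0 // ltr_pdivrMr // mul1r ltr_nat.
have s0 := sin_gt0_pi y0.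
have : cos x = 1 by move/(congr1 (@complex.Re R)): E.
have -> : x = y *+ 2 by rewrite /y -mulr_natr divfK.
rewrite cos_mulr2n cos2sin2 => E'.
have : sin y ^+ 2 = 0 by rewrite mulr2n in E'; lra.
by move/eqP; rewrite sqrf_eq0 gt_eqF.
Qed.

Lemma om_sum (k n : nat) : (k < N)%N -> (n < N)%N ->
  \sum_(j < N) (om ^+ j) ^+ k * (om ^+ j) ^- n = if k == n then N%:R else 0.
Proof.
move=> kN nN; pose x := om ^+ k / om ^+ n.
have on j : om ^+ j != 0 by rewrite expf_neq0 // om_neq0.
have -> : \sum_(j < N) (om ^+ j) ^+ k * (om ^+ j) ^- n = \sum_(j < N) x ^+ j.
  apply: eq_bigr => j _; rewrite /x expr_div_n -!exprM.
  by rewrite (mulnC k) (mulnC n).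
case: eqVneq => [E|kn].
  rewrite (eq_bigr (fun=> 1)) ?sumr_const ?card_ord // => j _.
  by rewrite /x E mulfV // expr1n.
have xN : x ^+ N = 1 by rewrite /x expr_div_n -!exprM !(mulnC _ N) !exprM omN !expr1n divr1.
have x1 : x != 1.
  rewrite /x; apply/eqP => E.
  have {}E : om ^+ k = om ^+ n by apply: (mulIf (invr_neq0 (on n))); rewrite mulfV.
  wlog lt : k n kN nN kn {x xN} E / (k < n)%N => [W|].
    by move: kn; rewrite neq_ltn => /orP[] h; [apply: (W k n)|apply: (W n k)] => //; rewrite ?lt_eqF ?gt_eqF // ?(ltn_eqF h) ?(gtn_eqF h).
  have : om ^+ (n - k) != 1 by apply: om_neq1; rewrite subn_gt0 lt (leq_ltn_trans (leq_subr _ _)).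
  by apply/negP/negPn/eqP/(mulIf (on k)); rewrite -exprD subnK ?mul1r // ltnW.
have := subrX1 x N; rewrite xN subrr => /esym/eqP; rewrite mulf_eq0 subr_eq0 (negPf x1).
by move/eqP.
Qed.

(** Discrete Fourier inversion in place of Cauchy's integral: it is exact on polynomials of degree
    below N, so series are truncated there. *)
Lemma coef_extract (a : nat -> R[i]) n : (n < N)%N ->
  \sum_(j < N) (\sum_(k < N) a k * (om ^+ j) ^+ k) * (om ^+ j) ^- n = N%:R * a n.
Proof.
move=> nN; under eq_bigr do rewrite mulr_suml.
rewrite exchange_big /= (eq_bigr (fun k : 'I_N => a k * if k == n :> nat then N%:R else 0)).
  rewrite (bigD1 (Ordinal nN)) //= eqxx big1 ?addr0 1?mulrC // => k kn.
  by rewrite ifF ?mulr0 //; apply/negbTE; rewrite -val_eqE /= in kn.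
by move=> k _; rewrite -om_sum // mulr_sumr; apply: eq_bigr => j _; rewrite mulrA.
Qed.

Lemma parseval_real (c : nat -> R) :
  \sum_(j < N) cm (\sum_(k < N) (c k)%:C * (om ^+ j) ^+ k) ^+ 2 =
  N%:R * \sum_(k < N) c k ^+ 2.
Proof.
apply: (@complexI R); rewrite rmorphM !rmorph_sum rmorph_nat.
have E j : (cm (\sum_(k < N) (c k)%:C * (om ^+ j) ^+ k) ^+ 2)%:C =
   (\sum_(k < N) (c k)%:C * (om ^+ j) ^+ k) * \sum_(n < N) (c n)%:C * (om ^+ j) ^- n.
  have sq (v : R[i]) : (cm v ^+ 2)%:C = `|v| ^+ 2 by rewrite norm_cm rmorphXn.
  rewrite sq sqr_normc; congr (_ * _).
  rewrite rmorph_sum; apply: eq_bigr => n _.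
  rewrite rmorphM rmorphXn; congr (_ * _); first exact: conjc_real.
  rewrite -exprVn; congr (_ ^+ _).
  have := cm_om j; set v := om ^+ j => v1.
  by rewrite invc_norm norm_cm v1 rmorph1 expr1n invr1 mul1r.
rewrite (eq_bigr _ (fun (j : 'I_N) _ => E j)).
rewrite (eq_bigr (fun j : 'I_N => \sum_(n < N) (c n)%:C *
   ((\sum_(k < N) (c k)%:C * (om ^+ j) ^+ k) * (om ^+ j) ^- n))); last first.
  by move=> j _; rewrite mulr_sumr; apply: eq_bigr => n _; ring.
rewrite exchange_big /= mulr_sumr; apply: eq_bigr => n _.
rewrite -mulr_sumr (coef_extract (fun k => (c k)%:C)) // rmorphXn expr2; ring.
Qed.

(** As om^N = 1, the inverse of 1 - rho om^j is a polynomial of degree below N in om^j, with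
    coefficients rho^k / (1 - rho^N), and Parseval gives the mean of its square. The 4 bounds (1 -
    rho^N)^(-2). *)
Lemma mean_inv_sq (rho : R) : 0 <= rho < 1 -> rho ^+ N <= 1 / 2 ->
  \sum_(j < N) cm (1 - rho%:C * om ^+ j) ^- 2 <= N%:R * (4 / (1 - rho)).
Proof.
move=> /andP[r0 r1] rN.
have rN0 : 0 <= rho ^+ N by rewrite exprn_ge0.
have rN1 : 1 - (rho ^+ N)%:C != 0 :> R[i].
  rewrite -(rmorph1 (real_complex R)) -rmorphB -cm_gt0 cm_real gtr0_norm; lra.
have E j : cm (1 - rho%:C * om ^+ j) ^- 2 =
   (1 - rho ^+ N) ^- 2 * cm (\sum_(k < N) (rho ^+ k)%:C * (om ^+ j) ^+ k) ^+ 2.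
  have G : 1 - (rho ^+ N)%:C = (1 - rho%:C * om ^+ j) *
      \sum_(k < N) (rho ^+ k)%:C * (om ^+ j) ^+ k.
    have := subrXX 1 (rho%:C * om ^+ j) N; rewrite expr1n exprMn -exprM mulnC exprM omN expr1n mulr1.
    rewrite rmorphXn => ->; congr (_ * _); apply: eq_bigr => k _.
    by rewrite expr1n mul1r exprMn rmorphXn.
  have := congr1 (@cm R) G.
  rewrite -(rmorph1 (real_complex R)) -rmorphB cm_real gtr0_norm; last by lra.
  rewrite rmorph1 cmM => ->.
  have : 1 - rho%:C * om ^+ j != 0.
    by apply/eqP => Z; move: rN1; rewrite G Z mul0r eqxx.
  have : \sum_(k < N) (rho ^+ k)%:C * (om ^+ j) ^+ k != 0.
    by apply/eqP => Z; move: rN1; rewrite G Z mulr0 eqxx.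
  rewrite -!cm_eq0; move: (cm _) (cm _) => x y x0 y0; field; by rewrite x0 y0.
under eq_bigr do rewrite E.
rewrite -mulr_sumr parseval_real mulrCA ler_wpM2l //.
apply: ler_pM; rewrite ?invr_ge0 ?exprn_ge0 ?sumr_ge0 //; first by lra.
- by move=> k _; rewrite !exprn_ge0.
- have -> : 4 = (1 / 2 : R) ^- 2 by field.
  rewrite lef_pV2 ?posrE ?exprn_gt0 //; last by lra.
  by rewrite lerXn2r ?nnegrE //; lra.
- have := subrXX 1 (rho ^+ 2) N; rewrite expr1n.
  have -> : \sum_(i < N) 1 ^+ (N.-1 - i) * (rho ^+ 2) ^+ i = \sum_(k < N) (rho ^+ k) ^+ 2.
    by apply: eq_bigr => k _; rewrite expr1n mul1r -!exprM mulnC.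
  set S := \sum_(k < N) _ => ES.
  have S0 : 0 <= S by apply: sumr_ge0 => k _; rewrite !exprn_ge0.
  rewrite -div1r ler_pdivlMr; last by lra.
  have : 0 <= (rho ^+ 2) ^+ N by rewrite !exprn_ge0.
  have : 0 <= S * (rho * (1 - rho)) by rewrite !mulr_ge0 //; lra.
  move: ES; rewrite expr2; nra.
Qed.

End RootsOfUnity.

End Transfer.

Section TransferBound.
Variable R : realType.
Implicit Types (a b : nat -> R[i]) (z t w : R[i]).

Lemma ccvg_le (u : nat -> R[i]) l v (T : R) N : ccvg u l ->
  (forall n, (N <= n)%N -> cm (u n - v) <= T) -> cm (l - v) <= T.
Proof.
move=> hu hT; apply/ler_addgt0Pr => e e0; have [N' HN] := hu e e0.
have h1 := HN (maxn N N') (leq_maxr _ _); have h2 := hT (maxn N N') (leq_maxl _ _).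
have -> : l - v = (u (maxn N N') - v) - (u (maxn N N') - l) by ring.
by rewrite (le_trans (cmB _ _)) // lerD // ltW.
Qed.

Lemma psum_tail a t l (T : R) N : psum a t l ->
  (forall m, (N <= m)%N -> \sum_(N <= k < m) cm (a k) * cm t ^+ k <= T) ->
  cm (l - \sum_(k < N) a k * t ^+ k) <= T.
Proof.
move=> hl hT; apply: (ccvg_le (N := N) hl) => m Nm.
rewrite -!(big_mkord xpredT (fun k => a k * t ^+ k)) (big_cat_nat (n := N)) //=.
rewrite addrAC subrr add0r (le_trans (cm_sum _ _ _)) // (le_trans _ (hT m Nm)) //.
by apply: ler_sum => k _; rewrite cmM cmX.
Qed.

Lemma geo_sum_le (q : R) n m : 0 <= q < 1 ->
  \sum_(n <= k < m) q ^+ k <= q ^+ n / (1 - q).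
Proof.
move=> /andP[q0 q1]; have q1' : 0 < 1 - q by rewrite subr_gt0.
rewrite ler_pdivlMr //; have [mn|nm] := leqP m n.
  by rewrite big_geq // mul0r exprn_ge0.
have H j : (\sum_(n <= k < n + j) q ^+ k) * (1 - q) = q ^+ n - q ^+ (n + j).
  elim: j => [|j IH]; first by rewrite addn0 big_geq // mul0r subrr.
  rewrite addnS big_nat_recr ?leq_addr //= mulrDl IH exprS; ring.
by rewrite -(subnKC (ltnW nm)) H gerBl exprn_ge0.
Qed.

Lemma two_real : (2 : R[i]) = (2 : R)%:C.
Proof. by rewrite rmorphMn rmorph1. Qed.

Variables (f : R[i] -> R[i]) (c M : R) (c01 : 0 < c <= 1 / 4) (M0 : 0 < M).
Hypothesis hf : forall t w, cm t < 1 -> cm (w - t) <= c * cm (t - 1) ->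
  cdiff f w /\ cm (f w) <= M * cm (t - 1).
Variable b : nat -> R[i].
Hypothesis hb : forall t, cm t < 1 -> psum b t (f t).

(* With tau = exp (i pi / n), the series of the second difference has n-th coefficient
   - 4 b_n; it is extracted by averaging over the N-th roots of unity, N large. *)
Lemma coef_bound : exists2 C : R, 0 < C &
  forall n, (0 < n)%N -> cm (b n) <= C * n%:R `^ (- 1 - 1 / 2).
Proof.
have /andP[c0 c1] := c01.
pose C3 := 80 * M / c ^+ 2.
have C30 : 0 < C3 by rewrite divr_gt0 ?mulr_gt0 ?exprn_gt0.
exists (C3 * pi ^+ 2 * (9 / 4)).
  by rewrite mulr_gt0 // mulr_gt0 // exprn_gt0 // pi_gt0.
move=> n n0; have nr : 0 < n%:R :> R by rewrite ltr0n.
pose s := Num.sqrt (n%:R : R); have s0 : 0 < s by rewrite sqrtr_gt0.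
have sn : s ^+ 2 = n%:R by rewrite sqr_sqrtr // ltW.
have -> : n%:R `^ (- 1 - 1 / 2) = s / n%:R ^+ 2 :> R.
  have -> : (- 1 - 1 / 2 : R) = 2^-1 - 2%:R by field.
  rewrite powRB; last by rewrite lt0r_neq0 ?implybT.
  by rewrite powR12_sqrt ?(ltW nr) // powR_mulrn ?(ltW nr).
pose h : R := pi / n%:R; have h0 : 0 < h by rewrite divr_gt0 // pi_gt0.
pose tau := expi h; have tau0 : tau != 0 := expi_neq0 h.
(* Bernoulli's inequality gives rho^n >= 1 / 2, so removing the factor rho^n from the extracted
   coefficient at most doubles the bound. *)
pose rho : R := 1 - (2 * n%:R)^-1.
have i0 : 0 < (2 * n%:R : R)^-1 by rewrite invr_gt0 mulr_gt0.
have i1 : (2 * n%:R : R)^-1 <= 1 / 2.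
  rewrite invfM mul1r ger_pMr ?invr_gt0 // invf_le1 // ler1n //.
have rho0 : 0 < rho by rewrite /rho; lra.
have rho1 : rho < 1 by rewrite /rho; lra.
pose F t := f (t * tau) + f (t * tau^-1) - 2 * f t.
pose b' k := b k * (tau ^+ k + tau ^- k - 2).
have cmtau : cm tau = 1 := cm_expi h.
have psF t : cm t < 1 -> psum b' t (F t).
  move=> t1.
  have h1 : psum b (t * tau) (f (t * tau)) by apply: hb; rewrite cmM cmtau mulr1.
  have h2 : psum b (t * tau^-1) (f (t * tau^-1)).
    by apply: hb; rewrite cmM cmV cmtau invr1 mulr1.
  have h3 := hb t1.
  have : psum (fun k => b k * tau ^+ k - (- (b k * tau ^- k))) t (f (t * tau) - (- f (t * tau^-1))).
    apply: psumB; first by apply: ccvg_eq h1 => m; apply: eq_bigr => k _; rewrite exprMn; ring.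
    have := psumZ (-1) h2; rewrite mulN1r; apply: ccvg_eq => m.
    by apply: eq_bigr => k _; rewrite exprMn exprVn; ring.
  move/psumB => /(_ _ _ (psumZ 2 h3)); rewrite /F opprK; apply: ccvg_eq => m.
  by apply: eq_bigr => k _; rewrite /b'; ring.
have bF t : cm t < 1 -> cm (F t) <= C3 * (h ^+ 2 / cm (t - 1)).
  by move=> t1; exact: second_difference.
have b'n : cm (b' n) = 4 * cm (b n).
  have tn : tau ^+ n = -1.
    by rewrite -expiMn /h mulrC divfK ?expi_pi // lt0r_neq0.
  rewrite /b' tn invrN1 cmM mulrC; congr (_ * _).
  have -> : -1 - 1 - 2 = - ((4 : R)%:C) :> R[i].
    by rewrite rmorphMn rmorph1 two_real; ring.
  by rewrite cmN cm_real gtr0_norm.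
have rn : 1 / 2 <= rho ^+ n.
  apply: le_trans (bernoulli_ge n _); last by rewrite (ltW i0) (le_trans i1) //; lra.
  rewrite le_eqVlt; apply/orP; left; apply/eqP; field; exact: lt0r_neq0.
suff : cm (b' n) * rho ^+ n <= C3 * h ^+ 2 * (9 / 2 * s).
  rewrite b'n => H.
  have : 4 * cm (b n) * (1 / 2) <= 4 * cm (b n) * rho ^+ n.
    by rewrite ler_wpM2l // mulr_ge0 // cm_ge0.
  move/le_trans/(_ H).
  have -> : C3 * h ^+ 2 * (9 / 2 * s) = 2 * (C3 * pi ^+ 2 * (9 / 4) * (s / n%:R ^+ 2)).
    rewrite /h; move: (pi : R) => p; field; exact: lt0r_neq0.
  lra.
apply/ler_addgt0Pr => e e0.
(* Convergence at the larger radius [rho'] bounds the coefficients, and makes the truncation error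
   at radius [rho] geometrically small in N. *)
pose rho' := (1 + rho) / 2.
have r'0 : 0 < rho' by rewrite /rho'; lra.
have r'1 : rho' < 1 by rewrite /rho'; lra.
have rr' : rho < rho' by rewrite /rho'; lra.
have [|M' M'0 HM'] := @psum_geo_bound R b' rho'%:C (F rho'%:C).
  by apply: psF; rewrite cm_real gtr0_norm.
rewrite cm_real (gtr0_norm r'0) in HM'.
pose q := rho / rho'.
have q01 : 0 <= q < 1.
  by rewrite divr_ge0 ?(ltW rho0) ?(ltW r'0) //= ltr_pdivrMr // mul1r.
have tail t N : cm t = rho -> cm (F t - \sum_(k < N) b' k * t ^+ k) <= M' / (1 - q) * q ^+ N.
  move=> tr; apply: psum_tail; first by apply: psF; rewrite tr.
  move=> m Nm; rewrite mulrAC -mulrA.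
  apply: le_trans (ler_wpM2l (ltW M'0) (@geo_sum_le q N m q01)).
  rewrite mulr_sumr; apply: ler_sum => k _; rewrite tr /q expr_div_n.
  by rewrite mulrA ler_pdivlMr ?exprn_gt0 // mulrAC ler_pM2r ?exprn_gt0.
have [N1 HN1] := geo_small (M' / (1 - q)) q01 e0.
have half0 : 0 < 1 / 2 :> R by lra.
have rho01 : 0 <= rho < 1 by rewrite (ltW rho0).
have [N2 HN2] := geo_small 1 rho01 half0.
(* Large enough to extract the coefficient n, to make the truncation error at most e, and to apply
   [mean_inv_sq]. *)
pose N := maxn n.+1 (maxn N1 N2).
have nN : (n < N)%N by rewrite leq_maxl.
have N10 : (N1 <= N)%N by rewrite /N (leq_trans _ (leq_maxr _ _)) // leq_maxl.
have N20 : (N2 <= N)%N by rewrite /N (leq_trans _ (leq_maxr _ _)) // leq_maxr.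
have N00 : (0 < N)%N by exact: leq_ltn_trans nN.
have Nr : 0 < N%:R :> R by rewrite ltr0n.
have rN : rho ^+ N <= 1 / 2 by have := HN2 N N20; rewrite mul1r.
pose om : R[i] := expi (2 * pi / N%:R).
pose t j := rho%:C * om ^+ j.
have tr j : cm (t j) = rho by rewrite cmM cm_real gtr0_norm // cm_om // mulr1.
pose X j := cm (1 - t j).
have X0 j : 0 < X j.
  have := cm_tri 1 (t j); rewrite cm1 tr /X; lra.
(* AM-GM, weighted so that [mean_inv_sq] applies *)
have Fj j : cm (F (t j)) <= C3 * h ^+ 2 * ((s^-1 * X j ^- 2 + s) / 2).
  rewrite (le_trans (bF _ _)) ?tr // cmC -/(X j) mulrA ler_wpM2l //.
    by rewrite mulr_ge0 ?exprn_ge0 // ltW.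
  rewrite -div1r ler_pdivrMr //.
  have -> : (s^-1 * X j ^- 2 + s) / 2 * X j = 1 + s / 2 * X j * ((s * X j)^-1 - 1) ^+ 2.
    move: (X j) (X0 j) s0; clearbody s => x x0 s0; field; by rewrite !lt0r_neq0.
  by rewrite lerDl mulr_ge0 ?sqr_ge0 // mulr_ge0 // ?divr_ge0 // ltW.
have main : N%:R * (cm (b' n) * rho ^+ n) <=
   \sum_(j < N) (C3 * h ^+ 2 * ((s^-1 * X j ^- 2 + s) / 2) + e).
  have := congr1 (@cm R) (coef_extract N00 (fun k => b' k * rho%:C ^+ k) nN).
  rewrite -/om [RHS]cmM (_ : cm N%:R = N%:R); last first.
    by rewrite -(rmorph_nat (real_complex R)) cm_real ger0_norm.
  rewrite cmM cmX cm_real (gtr0_norm rho0) => <-.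
  rewrite (le_trans (cm_sum _ _ _)) //; apply: ler_sum => j _.
  rewrite cmM -exprVn cmX cmV cm_om // invr1 expr1n mulr1.
  have -> : \sum_(k < N) b' k * rho%:C ^+ k * (om ^+ j) ^+ k = \sum_(k < N) b' k * t j ^+ k.
    by apply: eq_bigr => k _; rewrite /t exprMn mulrA.
  have := tail (t j) N (tr j); set S := \sum_(k < N) _ => HS.
  have -> : S = F (t j) - (F (t j) - S) by ring.
  by rewrite (le_trans (cmB _ _)) // lerD // (le_trans HS) // HN1.
move: main; rewrite big_split /= sumr_const card_ord -mulr_sumr -mulr_suml big_split /=.
rewrite -mulr_sumr sumr_const card_ord.
have := mean_inv_sq N00 (rho := rho) _ rN; rewrite (ltW rho0) rho1 => /(_ isT).
have -> : \sum_(j < N) cm (1 - rho%:C * expi (2 * pi / N%:R) ^+ j) ^- 2 = \sum_(j < N) X j ^- 2.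
  by [].
set Q := \sum_(j < N) _ => HQ main.
rewrite -(ler_pM2l Nr) (le_trans main) // -(mulr_natr e) -(mulr_natr s) mulrDr lerD //; last by rewrite mulrC.
have -> : N%:R * (C3 * h ^+ 2 * (9 / 2 * s)) = C3 * h ^+ 2 * ((s^-1 * (N%:R * (8 * n%:R)) + s * N%:R) / 2).
  rewrite -sn; move: (C3 * _) (N%:R : R) => u v; clearbody s; field; exact: lt0r_neq0.
have P0 : 0 <= C3 * h ^+ 2 := mulr_ge0 (ltW C30) (exprn_ge0 2 (ltW h0)).
rewrite (ler_wpM2l P0) //.
rewrite ler_wpM2r ?invr_ge0 // lerD2r ler_wpM2l ?invr_ge0 ?(ltW s0) //.
rewrite (le_trans HQ) // ler_pM2l // /rho opprB addrC subrK invrK.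
by rewrite mulrA -natrM.
Qed.

(** Abel's theorem at 1, where f tends to 0. The partial sum is compared with f x at x = 1 - eta:
    the tail is bounded by [coef_bound], while eta, chosen after N, makes f x and the change of the
    first N + 1 terms negligible. *)
Lemma abel_zero : ccvg (fun N => \sum_(k < N) b k) 0.
Proof.
have [C C0 HC] := coef_bound.
pose T (N : nat) := C * (N%:R `^ (- (1 / 2)) / (1 / 2)).
have H N : (0 < N)%N -> cm (\sum_(k < N.+1) b k) <= T N.
  move=> N0; apply/ler_addgt0Pr => e e0.
  pose A := \sum_(k < N.+1) cm (b k) * k%:R.
  have A0 : 0 <= A by apply: sumr_ge0 => k _; rewrite mulr_ge0 // cm_ge0.
  pose eta := Num.min (1 / 2) (e / (A + M)).
  have eta0 : 0 < eta by rewrite lt_min !divr_gt0 // ltr_wpDl.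
  have eta1 : eta <= 1 / 2 by rewrite ge_min lexx.
  have etae : eta * (A + M) <= e by rewrite -ler_pdivlMr ?ltr_wpDl // ge_min lexx orbT.
  pose x := 1 - eta.
  have x0 : 0 < x by rewrite /x; lra.
  have x1 : x < 1 by rewrite /x; lra.
  have cx : cm x%:C = x by rewrite cm_real gtr0_norm.
  have x1' : cm (x%:C : R[i]) < 1 by rewrite cx.
  have h1 : cm (f x%:C - \sum_(k < N.+1) b k * x%:C ^+ k) <= T N.
    apply: psum_tail; first exact: hb.
    move=> m Nm; apply: le_trans (ler_wpM2l (ltW C0) (powRN_tail m _ N0)); last by [].
    rewrite mulr_sumr !big_nat; apply: ler_sum => k /andP[Nk _].
    rewrite (le_trans _ (HC k (leq_ltn_trans (leq0n N) Nk))) //.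
    by rewrite -[leRHS]mulr1 ler_wpM2l ?cm_ge0 // cx exprn_ile1 // ltW.
  have h2 : cm (f x%:C) <= M * eta.
    have c0 : 0 <= c by case/andP: c01 => /ltW.
    have xx : cm ((x%:C : R[i]) - x%:C) <= c * cm ((x%:C : R[i]) - 1).
      by rewrite subrr cm0 mulr_ge0 ?cm_ge0.
    have [_] := hf x1' xx.
    have -> : x%:C - 1 = (- eta)%:C :> R[i].
      by rewrite /x rmorphB rmorph1 rmorphN addrAC subrr add0r.
    by rewrite cm_real normrN gtr0_norm.
  have h3 : cm (\sum_(k < N.+1) b k - \sum_(k < N.+1) b k * x%:C ^+ k) <= eta * A.
    rewrite -sumrB (le_trans (cm_sum _ _ _)) // mulr_sumr; apply: ler_sum => k _.
    rewrite -[X in X - _]mulr1 -mulrBr cmM mulrCA ler_wpM2l ?cm_ge0 //.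
    rewrite -rmorphXn -(rmorph1 (real_complex R)) -rmorphB cm_real.
    have xk1 : x ^+ k <= 1 by rewrite exprn_ile1 // ltW.
    rewrite ger0_norm ?subr_ge0 // lerBlDr addrC -lerBlDr mulrC.
    apply: bernoulli_ge; rewrite (ltW eta0) /=; lra.
  set S := \sum_(k < N.+1) b k in h3 *; set P := \sum_(k < N.+1) _ in h1 h3.
  have -> : S = (S - P) - (f x%:C - P) + f x%:C by ring.
  rewrite (le_trans (cmD _ _)) // (le_trans (lerD (cmB _ _) (lexx _))) //.
  lra.
move=> e e0.
have half0 : 0 < 1 / 2 :> R by lra.
have e40 : 0 < e / (4 * C) by rewrite divr_gt0 // mulr_gt0.
have [N HN] := powRN_small half0 e40.
exists (maxn N 1).+1 => -[//|n]; rewrite ltnS geq_max => /andP[Nn n0].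
rewrite subr0 (le_lt_trans (H n n0)) // /T.
have := HN n Nn; rewrite ler_pdivlMr ?mulr_gt0 //.
lra.
Qed.

End TransferBound.

(** * Reduction of both classes to one condition on the coefficients *)

Section Reduction.
Variable R : realType.
Variables (Theta : nat -> R) (r theta K : R).

(** [beta 0] is 0 because division by 0 gives 0, in accordance with [gcoef] and [logcoef]. *)
Definition beta (k : nat) : R := (Theta k * r ^+ k - theta) / k%:R.

(** All that the probabilistic part uses. The partial sums only have to stay within distance 1 of K:
    a bounded change of the Poisson parameter costs a factor 1 + (x - 1) D by [pois_shift]. *)
Definition regular_beta := exists gamma M : R, [/\ 0 < gamma <= 1, 0 < M,
  forall k, (0 < k)%N -> `|beta k| <= M * k%:R `^ (- 1 - gamma) &
  exists N : nat, forall n, (N <= n)%N -> `|\sum_(1 <= k < n.+1) beta k - K| <= 1].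

Lemma ccvgS (u : nat -> R[i]) l : ccvg (fun n => u n.+1) l -> ccvg u l.
Proof.
move=> h e e0; have [N HN] := h e e0; exists N.+1 => -[//|n]; rewrite ltnS; exact: HN.
Qed.

(* [k%:R^-1 = 0] for [k = 0], as the constant coefficient of g_Theta. *)
Definition gcoef (k : nat) : R[i] := (Theta k * r ^+ k / k%:R)%:C.

Lemma gTheta_psum (g : Cplx R -> Cplx R) : 0 < r -> sum_gTheta Theta g ->
  exists2 d : R, 0 < d & forall t : R[i], cm t < d -> psum gcoef t (g (r%:C * t)).
Proof.
move=> r0 /cnearP[d d0 Hd]; exists (d / r); first by rewrite divr_gt0.
move=> t; rewrite ltr_pdivlMr // => td.
have := Hd (r%:C * t); rewrite subr0 cmM cm_real gtr0_norm // mulrC => /(_ td) /ccvgP h.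
apply: ccvgS; apply: ccvg_eq h => n.
rewrite big_ord_recl /= {1}/gcoef invr0 mulr0 mul0r add0r /series /= big_mkord.
apply: eq_bigr => k _; rewrite /bump /= add1n /gcoef exprMn.
by rewrite mulrAC [in RHS]rmorphM rmorphXn mulrA.
Qed.

Lemma psum_const (v t : R[i]) : psum (fun k => if k == 0%N then v else 0) t v.
Proof.
apply: ccvgS => e e0; exists 0%N => n _.
by rewrite big_ord_recl /= big1 => [|i _]; rewrite ?expr0 ?mulr1 ?addr0 ?subrr ?cm0 // mul0r.
Qed.

Lemma gcoef_log k : gcoef k - theta%:C * logcoef R k = (beta k)%:C.
Proof. by rewrite /gcoef /logcoef /beta -rmorphM -rmorphB mulrBl. Qed.

(** The coefficients of f are the [beta k], except for - K at index 0; so the vanishing of their sum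
    in [abel_zero] says that the [beta k] sum to K. *)
Lemma class_F_regular : gTheta_class_F Theta r theta K%:C -> regular_beta.
Proof.
move=> [g [sg cF]]; have r0 : 0 < r by case: cF.
have [c c01 [M M0 hf]] := class_F_local cF.
pose f := sing_diff r theta K%:C g.
pose b k := (beta k)%:C - (if k == 0%N then K%:C else 0).
have c0 : 0 < c by case/andP: c01.
have hf0 w : cm w < 1 -> cdiff f w.
  move=> w1; have [] // := hf w w w1 _.
  by rewrite subrr cm0 mulr_ge0 ?cm_ge0 ?(ltW c0).
have hb : forall t, cm t < 1 -> psum b t (f t).
  apply: analytic_unit hf0 _; have [d d0 Hd] := gTheta_psum r0 sg.
  exists (Num.min d 1); first by rewrite lt_min d0 ltr01.
  move=> x /andP[x0]; rewrite lt_min => /andP[xd x1].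
  have cx : cm x%:C = x by rewrite cm_real gtr0_norm.
  have h1 : psum gcoef x%:C (g (r%:C * x%:C)) by apply: Hd; rewrite cx.
  have h2 : psum (logcoef R) x%:C (- clog (1 - x%:C)) by apply: log_series; rewrite cx.
  have := psumB (psumB h1 (psumZ theta%:C h2)) (psum_const K%:C x%:C).
  have -> : g (r%:C * x%:C) - theta%:C * - clog (1 - x%:C) - K%:C = f x%:C.
    by rewrite /f /sing_diff opprD addrA.
  by apply: ccvg_eq => n; apply: eq_bigr => k _; rewrite gcoef_log.
have [C C0 HC] := coef_bound c01 M0 hf hb.
have hz := abel_zero c01 M0 hf hb.
have bE k : (0 < k)%N -> b k = (beta k)%:C by case: k => // k _; rewrite /b subr0.
exists (1 / 2), C; split => //; first lra.
  by move=> k k0; have := HC k k0; rewrite bE // cm_real.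
have [N HN] := hz 1 ltr01; exists N => n Nn.
have := HN n.+1 (leqW Nn); rewrite subr0 -(big_mkord xpredT b) big_ltn //.
rewrite (eq_big_nat _ _ (F2 := fun k => (beta k)%:C)); last first.
  by move=> k /andP[k0 _]; exact: bE.
rewrite {1}/b /beta /= invr0 mulr0 sub0r -rmorph_sum -rmorphN -rmorphD cm_real.
by rewrite addrC => /ltW.
Qed.

(** Uniqueness of coefficients on a real segment gives beta_k = a_k r^k. The bound, which holds for
    large k, is extended to the finitely many others by the constant [S]. *)
Lemma class_eF_regular gamma : gTheta_class_eF Theta r theta gamma K%:C -> regular_beta.
Proof.
move=> [g [sg [r0 _ g01 [g0 [a [Hg Hs [M [N0 _ HM]] /ccvgP HK]]]]]].
have rC : r%:C != 0 by rewrite -cm_gt0 cm_real gtr0_norm.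
have aE k : (beta k)%:C = a k * r%:C ^+ k.
  apply/eqP; rewrite -subr_eq0; apply/eqP; move: k.
  have [d d0 Hd] := gTheta_psum r0 sg.
  apply: (@ps_unique _ _ (Num.min d 1)); first by rewrite lt_min d0 ltr01.
  move=> x /andP[x0]; rewrite lt_min => /andP[xd x1].
  have cx : cm x%:C = x by rewrite cm_real gtr0_norm.
  have h1 : psum gcoef x%:C (g (r%:C * x%:C)) by apply: Hd; rewrite cx.
  have h2 : psum (logcoef R) x%:C (- clog (1 - x%:C)) by apply: log_series; rewrite cx.
  have rx : `|(r%:C * x%:C : Cplx R)| < r%:C.
    by rewrite norm_cm ltcR cmM !cm_real !gtr0_norm // -[ltRHS]mulr1 ltr_pM2l.
  have h3 : psum (fun k => a k * r%:C ^+ k) x%:C (g0 (r%:C * x%:C)).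
    have /ccvgP := Hs _ rx; apply: ccvg_eq => n.
    by rewrite /series /= big_mkord; apply: eq_bigr => k _; rewrite exprMn mulrA.
  have := psumB (psumB h1 (psumZ theta%:C h2)) h3.
  have E : r%:C * x%:C / r%:C = x%:C by rewrite mulrC mulKf.
  rewrite (Hg _ rx) log_singE E; last by apply: slit_disk; rewrite cx.
  rewrite (addrAC (_ * _)) subrr add0r subrr.
  by apply: ccvg_eq => n; apply: eq_bigr => k _; rewrite gcoef_log.
have HMr k : (N0 <= k)%N -> `|beta k| <= `|M| * k%:R `^ (- 1 - gamma).
  move=> /HM /= h; rewrite -cm_real aE cmM cmX cm_real gtr0_norm //.
  rewrite -ler_pdivlMr ?exprn_gt0 // (le_trans h) //.
  by rewrite [leRHS]mulrAC ler_wpM2r ?powR_ge0 // ler_wpM2r ?invr_ge0 ?exprn_ge0 ?(ltW r0) // ler_norm.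
pose S := \sum_(k < N0) `|beta k| / k%:R `^ (- 1 - gamma).
have S0 : 0 <= S by apply: sumr_ge0 => k _; rewrite divr_ge0 // powR_ge0.
exists gamma, (`|M| + S + 1); split => //.
- by rewrite ltr_wpDl // addr_ge0.
- move=> k k0; have P0 : 0 < k%:R `^ (- 1 - gamma) :> R by apply: powR_gt0; rewrite ltr0n.
  have [h|h] := leqP N0 k.
    by rewrite (le_trans (HMr k h)) // ler_wpM2r ?(ltW P0) // -addrA lerDl addr_ge0.
  rewrite -ler_pdivrMr //.
  have : `|beta k| / k%:R `^ (- 1 - gamma) <= S.
    rewrite /S (bigD1 (Ordinal h)) //= lerDl; apply: sumr_ge0 => i _.
    by rewrite divr_ge0 // powR_ge0.
  by have := normr_ge0 M; lra.
have [N HN] := HK 1 ltr01; exists N => n Nn.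
have := HN n.+1 (leqW Nn); rewrite /series /= big_ltn // -aE {1}/beta invr0 mulr0 add0r.
rewrite (eq_bigr (fun k => (beta k)%:C)); last by move=> k _; rewrite aE.
by rewrite -rmorph_sum -rmorphB cm_real => /ltW.
Qed.

End Reduction.

(** * Signed measures on the naturals as formal power series *)

Section FormalSeries.
Variable S : comNzRingType.

(** The coefficient ring is arbitrary, since series in t whose coefficients are series in x occur as
    [fps (fps R)]. *)
Definition fps : Type := nat -> S.

HB.instance Definition _ := GRing.Zmodule.copy fps (nat -> S).

Implicit Types a b c : fps.

Definition fone : fps := fun n => (n == 0%N)%:R.
Definition fmul a b : fps := fun n => \sum_(i < n.+1) a i * b (n - i)%N.

(** The ring laws are inherited from polynomials, one coefficient at a time, by truncation. *)
Lemma fmul_poly m a b n : (n < m)%N ->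
  fmul a b n = ((\poly_(i < m) a i) * (\poly_(i < m) b i))`_n.
Proof.
move=> nm; rewrite coefM; apply: eq_bigr => i _; rewrite !coef_poly.
have im : (i < m)%N by apply: leq_ltn_trans nm; rewrite -ltnS.
by rewrite im (leq_ltn_trans (leq_subr _ _) nm).
Qed.

Lemma fmulC : commutative fmul.
Proof. by move=> a b; apply/funext => n; rewrite !(@fmul_poly n.+1) // mulrC. Qed.

Lemma fmulA : associative fmul.
Proof.
have H a b c n : fmul (fmul a b) c n =
  ((\poly_(i < n.+1) a i) * (\poly_(i < n.+1) b i) * (\poly_(i < n.+1) c i))`_n.
  rewrite coefM; apply: eq_bigr => i _; rewrite (@fmul_poly n.+1) //.
  by rewrite [in RHS]coef_poly ltnS leq_subr.
move=> a b c; apply/funext => n.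
by rewrite fmulC !H; congr (nth _ (polyseq _) _); rewrite mulrC mulrA.
Qed.

Lemma fmul1 : left_id fone fmul.
Proof.
move=> a; apply/funext => n; rewrite /fmul big_ord_recl big1 ?addr0 => [|i _].
  by rewrite /fone /= mul1r subn0.
by rewrite /fone /= mul0r.
Qed.

Lemma fmulDl : left_distributive fmul +%R.
Proof.
move=> a b c; apply/funext => n.
rewrite -[RHS]/(fmul a c n + fmul b c n) /fmul -big_split /=.
by apply: eq_bigr => i _; rewrite mulrDl.
Qed.

Lemma fone_neq0 : fone != 0.
Proof. by apply/eqP => /(congr1 (fun f : fps => f 0%N))/eqP; rewrite /fone /= oner_eq0. Qed.

HB.instance Definition _ := GRing.Zmodule_isComNzRing.Build fps
  fmulA fmulC fmul1 fmulDl fone_neq0.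

Lemma fmulE a b n : (a * b) n = \sum_(i < n.+1) a i * b (n - i)%N.
Proof. by []. Qed.
Lemma faddE a b n : (a + b) n = a n + b n. Proof. by []. Qed.
Lemma foppE a n : (- a) n = - a n. Proof. by []. Qed.
Lemma f1E n : (1 : fps) n = (n == 0%N)%:R. Proof. by []. Qed.
Lemma f0E n : (0 : fps) n = 0. Proof. by []. Qed.
Lemma fsumE (I : Type) (s : seq I) (P : pred I) (F : I -> fps) n :
  (\sum_(i <- s | P i) F i) n = \sum_(i <- s | P i) F i n.
Proof. by elim/big_rec2: _ => [|i y z _ <-]. Qed.

Definition fcst (c : S) : fps := fun n => if n == 0%N then c else 0.

Lemma fcstE (c : S) a n : (fcst c * a) n = c * a n.
Proof.
rewrite fmulE big_ord_recl big1 ?addr0 => [|i _]; last by rewrite /fcst /= mul0r.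
by rewrite /fcst /= subn0.
Qed.
Lemma fcstD (c d : S) : fcst (c + d) = fcst c + fcst d.
Proof. by apply/funext => -[|n]; rewrite faddE /fcst //= addr0. Qed.
Lemma fcstM (c d : S) : fcst (c * d) = fcst c * fcst d.
Proof. by apply/funext => n; rewrite fcstE /fcst; case: n => //= n; rewrite mulr0. Qed.
Lemma fcst1 : fcst 1 = 1.
Proof. by apply/funext => -[]. Qed.
Lemma fcst0 : fcst 0 = 0.
Proof. by apply/funext => -[]. Qed.
Lemma fcstN (c : S) : fcst (- c) = - fcst c.
Proof. by apply/funext => -[|n]; rewrite foppE /fcst //= oppr0. Qed.
Lemma fcst_nat n : fcst n%:R = n%:R.
Proof. by elim: n => [|n IH]; rewrite ?fcst0 // -!natr1 fcstD IH fcst1. Qed.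

Definition fX : fps := fun n => (n == 1%N)%:R.

Lemma fXE a n : (fX * a) n = if n is m.+1 then a m else 0.
Proof.
case: n => [|n]; first by rewrite fmulE big_ord1 /fX mul0r.
rewrite fmulE big_ord_recl /fX /= mul0r add0r big_ord_recl /= mul1r subn1 big1 ?addr0 //.
by move=> i _; rewrite /= mul0r.
Qed.

(* [t d/dt] *)
Definition fD a : fps := fun n => n%:R * a n.

Lemma fDM a b : fD (a * b) = fD a * b + a * fD b.
Proof.
apply/funext => n; rewrite faddE /fD !fmulE mulr_sumr -big_split /=.
apply: eq_bigr => i _.
have {1}-> : n = (i + (n - i))%N by rewrite subnKC // -ltnS.
by rewrite natrD; ring.
Qed.

Lemma fDX a k : fD (a ^+ k.+1) = k.+1%:R * (a ^+ k * fD a).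
Proof.
elim: k => [|k IH]; first by rewrite expr1 expr0 !mul1r.
by rewrite exprS fDM IH -[k.+2%:R]natr1 exprS; ring.
Qed.

End FormalSeries.

Section Norms.
Variable R : realType.
Implicit Types (a b : fps R) (C D : R).

(* [nle a C], [sle a C], [kle a C]: the total variation, pointwise and
   Kolmogorov norms of the signed measure [a] on [nat] are at most [C]. *)
Definition nle a C := forall N, \sum_(i < N) `|a i| <= C.
Definition sle a C := forall i, `|a i| <= C.
Definition csum a i := \sum_(j < i.+1) a j.
Definition kle a C := forall i, `|csum a i| <= C.

Lemma nle_ge0 a C : nle a C -> 0 <= C.
Proof. by move/(_ 0%N); rewrite big_ord0. Qed.
Lemma nle_le a C D : C <= D -> nle a C -> nle a D.
Proof. by move=> CD h N; rewrite (le_trans (h N)). Qed.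
Lemma nleD a b C D : nle a C -> nle b D -> nle (a + b) (C + D).
Proof.
move=> ha hb N; apply: le_trans (lerD (ha N) (hb N)).
by rewrite -big_split /=; apply: ler_sum => i _; exact: ler_normD.
Qed.
Lemma nleN a C : nle a C -> nle (- a) C.
Proof.
by move=> h N; under eq_bigr do rewrite foppE normrN; exact: h.
Qed.
Lemma nleB a b C D : nle a C -> nle b D -> nle (a - b) (C + D).
Proof. by move=> ha hb; apply: nleD => //; exact: nleN. Qed.

Lemma nle_cst c : nle (fcst c) `|c|.
Proof.
move=> [|N]; first by rewrite big_ord0.
rewrite big_ord_recl big1 ?addr0 //= => i _; by rewrite /fcst /= normr0.
Qed.
Lemma nle1 : nle 1 1.
Proof. by rewrite -fcst1; have := nle_cst 1; rewrite normr1. Qed.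
Lemma nle0 : nle 0 0.
Proof. by move=> N; rewrite big1 // => i _; rewrite f0E normr0. Qed.
Lemma nleX : nle (fX R) 1.
Proof.
move=> [|[|N]]; rewrite ?big_ord0 ?big_ord1 ?/fX ?normr0 //.
rewrite 2!big_ord_recl big1 ?addr0 /= ?normr0 ?add0r ?normr1 // => i _; by rewrite normr0.
Qed.

Lemma conv_sum_exchange (V : zmodType) (F : nat -> nat -> V) N :
  \sum_(n < N) \sum_(i < n.+1) F i (n - i)%N =
  \sum_(i < N) \sum_(j < N | (i + j < N)%N) F i j.
Proof.
rewrite (eq_bigr (fun n : 'I_N => \sum_(i < N | (i <= n)%N) F i (n - i)%N)); last first.
  by move=> n _; rewrite (big_ord_widen_cond N xpredT (fun i => F i (n - i)%N)).
rewrite (exchange_big_dep xpredT) //=; apply: eq_bigr => i _.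
have -> : \sum_(n < N | (i <= n)%N) F i (n - i)%N = \sum_(k < N - i) F i k.
  rewrite -(big_mkord xpredT (fun k => F i k)) -{1}(add0n i).
  rewrite -(big_mkord (fun n => (i <= n)%N) (fun n => F i (n - i)%N)).
  rewrite (big_cat_nat (n := i)) ?leq0n 1?ltnW //= big_nat_cond big1 ?add0r; last first.
    by move=> n /andP[/andP[_ h] h']; move: h; rewrite ltnNge h'.
  rewrite -{1}[i : nat]add0n big_addn big_nat_cond [RHS]big_nat_cond.
  apply: eq_big => n; first by rewrite leq_addl !andbT.
  by rewrite addnK.
rewrite (big_ord_widen N (fun k => F i k)) ?leq_subr //; apply: eq_bigl => j.
by rewrite ltn_subRL.
Qed.

Lemma conv_sum_le N (c d : nat -> R) :
  (forall i, 0 <= c i) -> (forall i, 0 <= d i) ->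
  \sum_(n < N) \sum_(i < n.+1) c i * d (n - i)%N <=
  (\sum_(i < N) c i) * (\sum_(i < N) d i).
Proof.
move=> c0 d0; rewrite (conv_sum_exchange (fun i j => c i * d j)) mulr_suml.
apply: ler_sum => i _; rewrite mulr_sumr.
rewrite [leRHS](bigID (fun j : 'I_N => (i + j < N)%N)) /= lerDl sumr_ge0 // => j _.
exact: mulr_ge0.
Qed.

(** The property for which the total variation norm is chosen: error factors can be multiplied
    without looking at x. *)
Lemma nleM a b C D : nle a C -> nle b D -> nle (a * b) (C * D).
Proof.
move=> ha hb N.
apply: (@le_trans _ _ ((\sum_(i < N) `|a i|) * (\sum_(i < N) `|b i|))); last first.
  by apply: ler_pM => //; apply: sumr_ge0.
apply: le_trans (@conv_sum_le N (fun i => `|a i|) (fun i => `|b i|) _ _) => //.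
apply: ler_sum => n _; rewrite fmulE (le_trans (ler_norm_sum _ _ _)) //.
by apply: ler_sum => i _; rewrite normrM.
Qed.

Lemma nle_sum (I : Type) (s : seq I) (P : pred I) (F : I -> fps R) (C : I -> R) :
  (forall i, P i -> nle (F i) (C i)) ->
  nle (\sum_(i <- s | P i) F i) (\sum_(i <- s | P i) C i).
Proof. by move=> h; elim/big_rec2: _ => [|i x y Pi]; [exact: nle0 | apply: nleD; exact: h]. Qed.

Lemma nle_sle a C : nle a C -> sle a C.
Proof.
move=> h i; apply: le_trans (h i.+1); rewrite big_ord_recr /= lerDr.
by apply: sumr_ge0.
Qed.
Lemma sle_ge0 a C : sle a C -> 0 <= C.
Proof. by move/(_ 0%N); apply: le_trans. Qed.
(** Lets a factor that is bounded only in total variation multiply a pointwise estimate of a Poisson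
    law. *)
Lemma sleM a b C D : sle a C -> nle b D -> sle (a * b) (C * D).
Proof.
move=> ha hb n; have C0 := sle_ge0 ha.
rewrite mulrC fmulE (le_trans (ler_norm_sum _ _ _)) //.
apply: le_trans (ler_wpM2l C0 (hb n.+1)); rewrite mulr_sumr; apply: ler_sum => i _.
by rewrite normrM mulrC ler_wpM2r.
Qed.
Lemma sleD a b C D : sle a C -> sle b D -> sle (a + b) (C + D).
Proof. by move=> ha hb i; rewrite faddE (le_trans (ler_normD _ _)) // lerD. Qed.
Lemma sleZ c a C : sle a C -> sle (fcst c * a) (`|c| * C).
Proof. by move=> h i; rewrite fcstE normrM ler_wpM2l. Qed.

Lemma csumS a i : csum a i.+1 = csum a i + a i.+1.
Proof. by rewrite /csum big_ord_recr. Qed.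
Lemma csumD a b i : csum (a + b) i = csum a i + csum b i.
Proof. by rewrite /csum -big_split. Qed.
Lemma csumZ c a i : csum (fcst c * a) i = c * csum a i.
Proof. by rewrite /csum mulr_sumr; apply: eq_bigr => j _; rewrite fcstE. Qed.
Lemma kleD a b C D : kle a C -> kle b D -> kle (a + b) (C + D).
Proof. by move=> ha hb i; rewrite csumD (le_trans (ler_normD _ _)) // lerD. Qed.
Lemma kleZ c a C : kle a C -> kle (fcst c * a) (`|c| * C).
Proof. by move=> h i; rewrite csumZ normrM ler_wpM2l. Qed.
Lemma nle_kle a C : nle a C -> kle a C.
Proof. by move=> h i; rewrite (le_trans (ler_norm_sum _ _ _)). Qed.

(** The series x - 1. Multiplying by it takes differences of consecutive terms, which partial sums
    undo: this is why the Kolmogorov norm of a product by [dlt] is a pointwise norm. *)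
Definition dlt : fps R := fX R - 1.

Lemma dltE a n : (dlt * a) n = (if n is m.+1 then a m else 0) - a n.
Proof. by rewrite /dlt mulrBl mul1r faddE foppE fXE. Qed.

Lemma csum_dlt a i : csum (dlt * a) i = - a i.
Proof.
rewrite /csum; elim: i => [|i IH]; first by rewrite big_ord1 dltE sub0r.
by rewrite big_ord_recr IH dltE /= addrA addNr add0r.
Qed.
Lemma kle_dlt a C : sle a C -> kle (dlt * a) C.
Proof. by move=> h i; rewrite csum_dlt normrN. Qed.
Lemma nle_dlt : nle dlt 2.
Proof. by have := nleB nleX nle1. Qed.

(** Used to see that a product by [dlt] has total mass 0: its partial sum up to i is - a i, which is
    small for suitable large i. *)
Lemma nle_small a C m : nle a C -> forall e, 0 < e ->
  exists2 i : nat, (m <= i)%N & `|a i| <= e.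
Proof.
move=> h e e0; apply: contrapT => H.
have {}H i : e < `|a (m + i)%N|.
  by rewrite ltNge; apply/negP => k; apply: H; exists (m + i)%N; rewrite ?leq_addr.
pose N := Num.bound (C / e).
have C0 := nle_ge0 h.
have : C < N%:R * e.
  by rewrite -ltr_pdivrMr // archi_boundP // divr_ge0 // ltW.
rewrite ltNge => /negP; apply; apply: le_trans (h (m + N)%N).
rewrite big_split_ord /= ler_wpDl ?sumr_ge0 //.
rewrite -[N in N%:R](card_ord N) -sum1_card natr_sum mulr_suml.
by apply: ler_sum => i _; rewrite mul1r ltW.
Qed.

End Norms.

(** * Poisson laws and their first differences *)

Section Poisson.
Variable R : realType.
Implicit Types (x y p mu b : R).

(** As a power series it is exp (x (X - 1)) in the indeterminate X. The parameter may be negative;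
    [pois (- x)] is then the inverse of [pois x], at the cost of a norm exp (2 |x|). *)
Definition pois x : fps R := fun i => expR (- x) * (x ^+ i / i`!%:R).

Lemma fact_gt0R i : 0 < i`!%:R :> R. Proof. by rewrite ltr0n fact_gt0. Qed.

Lemma poisD x y : pois x * pois y = pois (x + y).
Proof.
apply/funext => n; rewrite fmulE /pois opprD expRD [x + y]addrC exprDn.
rewrite mulr_suml mulr_sumr; apply: eq_bigr => i _.
have im : (i <= n)%N by rewrite -ltnS.
have nE : n`!%:R = 'C(n, i)%:R * (i`!%:R * (n - i)`!%:R) :> R.
  by rewrite -!natrM bin_fact.
have b0 : 0 < 'C(n, i)%:R :> R by rewrite ltr0n bin_gt0.
rewrite nE -mulr_natr; field.
by rewrite !lt0r_neq0 ?fact_gt0R.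
Qed.

Lemma pois0 : pois 0 = 1.
Proof.
apply/funext => -[|i]; rewrite /pois f1E oppr0 expR0 mul1r; first by rewrite expr0 divr1.
by rewrite expr0n mul0r.
Qed.
Lemma poisNK x : pois x * pois (- x) = 1.
Proof. by rewrite poisD subrr pois0. Qed.

Lemma exp_sum_le x N : 0 <= x -> \sum_(i < N) x ^+ i / i`!%:R <= expR x.
Proof.
move=> x0; rewrite /expR -(big_mkord xpredT (fun i => x ^+ i / i`!%:R)).
have := @nondecreasing_cvgn_le R (series (exp_coeff x)).
move=> /(_ _ _ N); rewrite /series /exp_coeff /=; apply; last exact: is_cvg_series_exp_coeff.
by apply: nondecreasing_series => n _ _; rewrite divr_ge0 ?exprn_ge0.
Qed.

Lemma nle_pois x : nle (pois x) (expR (`|x| - x)).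
Proof.
move=> N; rewrite (eq_bigr (fun i : 'I_N => expR (- x) * (`|x| ^+ i / i`!%:R))).
  by rewrite -mulr_sumr addrC expRD ler_wpM2l ?expR_ge0 // exp_sum_le.
move=> i _; rewrite /pois normrM ger0_norm ?expR_ge0 // normrM normrX.
by rewrite [X in _ * (_ * X)]ger0_norm // invr_ge0 ltW // fact_gt0R.
Qed.

Lemma nle_pois1 x : 0 <= x -> nle (pois x) 1.
Proof. by move=> x0; have := nle_pois x; rewrite ger0_norm // subrr expR0. Qed.

Lemma pois_ge0 x i : 0 <= x -> 0 <= pois x i.
Proof. by move=> x0; rewrite mulr_ge0 ?expR_ge0 // divr_ge0 ?exprn_ge0. Qed.

Lemma csum_pois_le1 x i : 0 <= x -> csum (pois x) i <= 1.
Proof.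
move=> x0; apply: le_trans (nle_pois1 x0 i.+1); apply: ler_sum => j _; exact: ler_norm.
Qed.

Lemma csum_pois_cvg x e : 0 <= x -> 0 < e -> exists N : nat, forall i, (N <= i)%N ->
  1 - e <= csum (pois x) i.
Proof.
move=> x0 e0.
have h : series (exp_coeff x) @ \oo --> expR x by exact: is_cvg_series_exp_coeff.
have e'0 : 0 < e * expR x by rewrite mulr_gt0 ?expR_gt0.
move/cvgrPdist_lt: h => /(_ _ e'0)[N _ HN]; exists N => i Ni.
have := HN i.+1 (leqW Ni); rewrite ltr_norml => /andP[_ h].
have -> : csum (pois x) i = expR (- x) * series (exp_coeff x) i.+1.
  by rewrite /csum /series /= big_mkord mulr_sumr.
rewrite lerBlDr -[X in X <= _](expRxMexpNx_1 x) mulrC.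
rewrite -[X in _ + X](_ : expR (- x) * (e * expR x) = e); last first.
  by rewrite mulrCA (mulrC (expR (- x))) expRxMexpNx_1 mulr1.
rewrite -mulrDr ler_wpM2l ?expR_ge0 // -lerBlDl; exact: ltW.
Qed.

Lemma pois_rec x i : i.+1%:R * pois x i.+1 = x * pois x i.
Proof.
rewrite /pois factS natrM exprS; field.
by rewrite !lt0r_neq0 // ?fact_gt0R.
Qed.

(** The tail probabilities; they are the quotient of [pois p - 1] by [dlt], hence the natural source
    of the factors D. *)
Definition pois_tail p : fps R := fun i => 1 - csum (pois p) i.

Lemma pois_tail_dlt p : dlt R * pois_tail p = pois p - 1.
Proof.
apply/funext => -[|i]; rewrite dltE faddE foppE f1E /pois_tail /csum.
  by rewrite big_ord1 sub0r opprB.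
by rewrite [in X in _ - X]big_ord_recr /= subr0; ring.
Qed.

Lemma pois_tail_ge0 p i : 0 <= p -> 0 <= pois_tail p i.
Proof. by move=> p0; rewrite subr_ge0 csum_pois_le1. Qed.

(** Sum (k + 1) pois (k + 1) = p pois k over k > i, where k + 1 >= i + 2. The tails are reached as
    limits of finite sums, whence the slack [e]. *)
Lemma pois_tail_rec p i : 0 <= p -> i.+2%:R * pois_tail p i.+1 <= p * pois_tail p i.
Proof.
move=> p0; apply/ler_addgt0Pr => e e0.
have e'0 : 0 < e / i.+2%:R by rewrite divr_gt0.
have [N HN] := csum_pois_cvg p0 e'0; pose M := maxn N i.+2.
have H j : i.+2%:R * (csum (pois p) (i.+1 + j) - csum (pois p) i.+1)
   <= p * (csum (pois p) (i + j) - csum (pois p) i).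
  elim: j => [|j IH]; first by rewrite !addn0 !subrr !mulr0.
  have -> : csum (pois p) (i + j.+1) = csum (pois p) (i + j) + pois p (i + j).+1.
    by rewrite addnS csumS.
  have -> : csum (pois p) (i.+1 + j.+1) = csum (pois p) (i.+1 + j) + pois p (i.+1 + j).+1.
    by rewrite addnS csumS.
  have h : i.+2%:R * pois p (i.+1 + j).+1 <= p * pois p (i + j).+1.
    rewrite -[(i + j).+1]/(i.+1 + j)%N -pois_rec ler_wpM2r ?pois_ge0 // ler_nat; lia.
  rewrite (addrAC _ (pois p (i.+1 + j).+1)) (addrAC _ (pois p (i + j).+1)).
  rewrite mulrDr [leRHS]mulrDr; exact: lerD.
have := H M; have := HN (i.+1 + M)%N _.
have -> : (N <= i.+1 + M)%N by rewrite (leq_trans (leq_maxl N i.+2)) // leq_addl.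
move=> /(_ isT) h1 h2.
have h3 := csum_pois_le1 (i + M) p0.
have h4 : p * (csum (pois p) (i + M) - csum (pois p) i) <= p * pois_tail p i.
  by rewrite ler_wpM2l // lerB.
have h5 : i.+2%:R * pois_tail p i.+1 <= i.+2%:R * (csum (pois p) (i.+1 + M) - csum (pois p) i.+1) + e.
  rewrite /pois_tail.
  have -> : e = i.+2%:R * (e / i.+2%:R) by field.
  rewrite -mulrDr ler_pM2l // ?ltr0n //.
  by rewrite addrAC lerD2r -lerBlDr.
by apply: le_trans h5 _; rewrite lerD2r; exact: le_trans h2 h4.
Qed.

(** The tails of a law on the naturals sum to its mean. [H] is the summation by parts, and
    [pois_tail_rec] bounds its boundary term. *)
Lemma pois_tail_sum p N : 0 <= p -> \sum_(i < N) pois_tail p i <= p.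
Proof.
move=> p0; have T0 : pois_tail p 0 = 1 - expR (- p).
  by rewrite /pois_tail /csum big_ord1 /pois expr0 divr1 mulr1.
have H n : \sum_(i < n.+1) pois_tail p i = n.+1%:R * pois_tail p n + p * (if n is m.+1 then 1 - pois_tail p m else 0).
  elim: n => [|n IH]; first by rewrite big_ord1 mul1r mulr0 addr0.
  rewrite big_ord_recr /= IH.
  have Tn : pois_tail p n = pois_tail p n.+1 + pois p n.+1.
    by rewrite /pois_tail /csum [in RHS]big_ord_recr /=; ring.
  have r1 := pois_rec p n.
  have -> : p * (if n is m.+1 then 1 - pois_tail p m else 0) = p * (1 - pois_tail p n) - p * pois p n.
    case: n {IH Tn r1} => [|m].
      by rewrite /pois_tail /csum big_ord1; ring.
    rewrite /pois_tail /csum [X in _ = p * (1 - (1 - X)) - _]big_ord_recr /=; ring.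
  rewrite -r1 Tn -[n.+2%:R]natr1; ring.
case: N => [|[|n]]; first by rewrite big_ord0.
  by rewrite big_ord1 T0 lerBlDr -lerBlDl -[- p]addr0 expR_ge1Dx.
rewrite H; have := pois_tail_rec n p0; lra.
Qed.

Lemma nle_pois_tail p : 0 <= p -> nle (pois_tail p) p.
Proof.
move=> p0 N; rewrite (eq_bigr (fun i : 'I_N => pois_tail p i)); first exact: pois_tail_sum.
by move=> i _; rewrite ger0_norm // pois_tail_ge0.
Qed.

(** The term of index 0 is 1 - exp (- p), which falls short of p by at most p^2; as all tails
    together sum to at most p, the others contribute no more than this shortfall. *)
Lemma nle_pois_tail_sub p : 0 <= p -> nle (pois_tail p - fcst p) (2 * p ^+ 2).
Proof.
move=> p0; have T0 : pois_tail p 0 = 1 - expR (- p).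
  by rewrite /pois_tail /csum big_ord1 /pois expr0 divr1 mulr1.
have e1 : expR (- p) <= (1 + p)^-1.
  rewrite expRN lef_pV2 ?posrE ?expR_gt0 ?ltr_pwDl //; exact: expR_ge1Dx.
have e2 : p - pois_tail p 0 <= p ^+ 2.
  rewrite T0; have : p - 1 + (1 + p)^-1 <= p ^+ 2.
    have -> : p - 1 + (1 + p)^-1 = p ^+ 2 / (1 + p).
      by field; rewrite lt0r_neq0 // ltr_pwDl.
    rewrite ler_pdivrMr ?ltr_pwDl // ler_peMr ?sqr_ge0 // lerDl //.
  lra.
move=> [|N]; first by rewrite big_ord0 mulr_ge0 // sqr_ge0.
have := pois_tail_sum N.+1 p0; rewrite !big_ord_recl /= => h.
rewrite (eq_bigr (fun i : 'I_N => pois_tail p (bump 0 i))); last first.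
  by move=> i _; rewrite faddE foppE /fcst /= subr0 ger0_norm // pois_tail_ge0.
have : `|(pois_tail p - fcst p) 0%N| = p - pois_tail p 0.
  rewrite faddE foppE /fcst /= ler0_norm ?opprB // subr_le0 T0 lerBlDr -lerBlDl.
  by rewrite -[- p]addr0 expR_ge1Dx.
move=> ->; lra.
Qed.

(** Both generating functions are 1 plus a multiple of x - 1, with quotients p and [pois_tail p],
    which differ by O(p^2). Division by [pois p] is multiplication by [pois (- p)], of norm at most
    e^2. *)
Lemma bernoulli_pois p : 0 <= p <= 1 -> exists2 d : fps R,
  1 + fcst p * dlt R = pois p * (1 + dlt R * d) & nle d (2 * expR 2 * p ^+ 2).
Proof.
move=> /andP[p0 p1]; pose tau := pois_tail p - fcst p; exists (- (pois (- p) * tau)).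
  have -> : pois p * (1 + dlt R * - (pois (- p) * tau)) = pois p - (pois p * pois (- p)) * (dlt R * tau).
    ring.
  rewrite poisNK mul1r /tau (mulrBr (dlt R) (pois_tail p)) pois_tail_dlt; ring.
apply: nleN; rewrite (_ : 2 * _ * _ = expR 2 * (2 * p ^+ 2)); last by ring.
apply: nleM (nle_pois_tail_sub p0); apply: nle_le (nle_pois (- p)).
rewrite normrN ger0_norm // opprK ler_expR; lra.
Qed.

(** For negative [b], the identity for the parameter - b is divided by [pois (- b)]. *)
Lemma pois_shift b (C : R) : `|b| <= C -> exists2 d : fps R,
  pois b = 1 + dlt R * d & nle d (C * expR (2 * C)).
Proof.
move=> bC; have C0 : 0 <= C by apply: le_trans bC.
have [b0|b0] := leP 0 b.
  exists (pois_tail b); first by rewrite pois_tail_dlt addrC subrK.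
  rewrite ger0_norm // in bC; apply: nle_le (nle_pois_tail b0).
  rewrite (le_trans bC) // ler_peMr // -expR0 ler_expR mulr_ge0 //.
exists (- (pois b * pois_tail (- b))).
  rewrite mulrN mulrCA pois_tail_dlt mulrBr poisNK; ring.
rewrite ltr0_norm // in bC.
have nb : 0 <= - b by rewrite oppr_ge0 ltW.
apply: nleN; apply: nle_le (nleM (nle_pois b) (nle_pois_tail nb)).
rewrite mulrC ler_pM ?expR_ge0 ?oppr_ge0 ?(ltW b0) // ler_expR ltr0_norm //; lra.
Qed.

(** Flatness instead of Stirling's formula: up to the mean, a weight is followed by L = floor (sqrt
    mu) others that are at least 1 / e times as large, and the total mass is 1. Beyond the mean the
    weights decrease. *)
Lemma sle_pois mu : 0 < mu -> sle (pois mu) (expR 1 / Num.sqrt mu).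
Proof.
move=> mu0; pose s := Num.sqrt mu; have s0 : 0 < s by rewrite sqrtr_gt0.
have ss : s ^+ 2 = mu by rewrite sqr_sqrtr // ltW.
have Ep i : 0 <= pois mu i by rewrite pois_ge0 // ltW.
have low i : i%:R <= mu -> pois mu i <= expR 1 / s.
  move=> imu; pose L := Num.truncn s.
  have /andP[Ls sL] : L%:R <= s < L.+1%:R by apply: truncn_itv; exact: ltW.
  pose q := mu / (mu + L%:R).
  have muL : 0 < mu + L%:R by rewrite ltr_pwDl.
  have q0 : 0 <= q by rewrite divr_ge0 // ltW.
  have q1 : q <= 1 by rewrite ler_pdivrMr // mul1r lerDl.
  have H l : (l <= L)%N -> pois mu i * q ^+ l <= pois mu (i + l)%N.
    elim: l => [|l IH] lL; first by rewrite addn0 expr0 mulr1.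
    rewrite exprSr mulrA addnS.
    have h : pois mu (i + l)%N * q <= pois mu (i + l)%N.+1.
      have -> : pois mu (i + l)%N.+1 = pois mu (i + l)%N * (mu / (i + l).+1%:R).
        have r := pois_rec mu (i + l).
        apply: (mulfI (x := (i + l).+1%:R)); first by rewrite pnatr_eq0.
        by rewrite r; field.
      rewrite ler_wpM2l // ler_wpM2l ?(ltW mu0) // lef_pV2 ?posrE //.
      by rewrite -addnS natrD lerD // ler_nat.
    by apply: le_trans h; apply: ler_wpM2r => //; apply: IH; exact: ltnW.
  have qL : expR (-1) <= q ^+ L.
    have : expR (- (L%:R / mu)) <= q.
      rewrite expRN /q -[mu / _]invrK lef_pV2 ?posrE ?expR_gt0 ?invr_gt0 ?divr_gt0 //.
      rewrite invf_div; apply: le_trans (expR_ge1Dx _).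
      by rewrite mulrDl mulfV ?lt0r_neq0.
    move=> /(lerXn2r L); rewrite !nnegrE expR_ge0 q0 => /(_ isT isT); apply: le_trans.
    rewrite -expRM_natl ler_expR mulrN lerN2 mulrA ler_pdivrMr // mul1r -ss expr2.
    by rewrite ler_pM.
  have sum1 : \sum_(l < L.+1) pois mu i * expR (-1) <= 1.
    apply: le_trans (nle_pois1 (ltW mu0) (i + L.+1)).
    rewrite big_split_ord /= ler_wpDl ?sumr_ge0 //; apply: ler_sum => k _.
    have lL : (k <= L)%N by rewrite -ltnS.
    rewrite ger0_norm // (le_trans _ (H k lL)) // ler_wpM2l //.
    by rewrite (le_trans qL) // ler_wiXn2l.
  move: sum1; rewrite sumr_const card_ord -mulr_natr => h.
  have h2 : pois mu i * L.+1%:R <= expR 1.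
    rewrite -(ler_pM2l (expR_gt0 (-1))) -[leRHS]mulrC expRxMexpNx_1.
    by apply: le_trans h; rewrite mulrCA mulrA.
  by rewrite ler_pdivlMr // (le_trans _ h2) // ler_wpM2l // ltW.
move=> i; rewrite ger0_norm //; elim: i => [|i IH]; first by apply: low; exact: ltW.
have [h|h] := leP i.+1%:R mu; first exact: low.
apply: le_trans IH; rewrite -(ler_pM2l (x := i.+1%:R)) ?ltr0n // pois_rec.
by rewrite ler_wpM2r // ltW.
Qed.

(** The Poisson law is unimodal, so its variation is at most twice its maximum. *)
Lemma nle_dlt_pois mu : 0 < mu -> nle (dlt R * pois mu) (2 * (expR 1 / Num.sqrt mu)).
Proof.
move=> mu0; set B := expR 1 / _; have hB := sle_pois mu0; rewrite -/B in hB.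
have Ep i : 0 <= pois mu i by rewrite pois_ge0 // ltW.
have B0 : 0 <= B by rewrite divr_ge0 ?expR_ge0 // sqrtr_ge0.
have EB i : pois mu i <= B by rewrite (le_trans _ (hB i)) // ler_norm.
move=> [|N]; first by rewrite big_ord0 mulr_ge0.
(* The running variation equals the current weight up to the mode, and what has gone down is
   subtracted from 2 B after it. *)
suff H : \sum_(i < N.+1) `|(dlt R * pois mu) i| <= if N%:R <= mu then pois mu N else 2 * B - pois mu N.
  apply: (le_trans H); case: ifP => _; have := EB N; have := Ep N; lra.
elim: N => [|N IH].
  by rewrite big_ord1 dltE sub0r normrN ger0_norm // (ltW mu0).
rewrite big_ord_recr /= dltE.
have r := pois_rec mu N; have nr : 0 < N.+1%:R :> R by rewrite ltr0n.
case: ifPn => [h|]; last rewrite -ltNge => h.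
  have h' : N%:R <= mu by rewrite (le_trans _ h) // ler_nat.
  rewrite h' in IH; have : pois mu N <= pois mu N.+1.
    by rewrite -(ler_pM2l nr) r ler_wpM2r.
  by move=> k; rewrite ler0_norm ?subr_le0 //; lra.
have k : pois mu N.+1 <= pois mu N by rewrite -(ler_pM2l nr) r ler_wpM2r // ltW.
rewrite ger0_norm ?subr_ge0 //; have := EB N; move: IH; case: ifP => _; lra.
Qed.

(** The law is the convolution of two of parameter mu / 2: one supplies its maximum, the other the
    variation of its difference, each of order 1 / sqrt mu. *)
Lemma sle_dlt_pois mu : 0 < mu -> sle (dlt R * pois mu) (4 * expR 1 ^+ 2 / mu).
Proof.
move=> mu0; pose nu := mu / 2; have nu0 : 0 < nu by rewrite divr_gt0.
have -> : pois mu = pois nu * pois nu by rewrite poisD /nu -splitr.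
rewrite mulrA mulrC.
have := sleM (sle_pois nu0) (nle_dlt_pois nu0).
have ss : Num.sqrt nu ^+ 2 = nu by rewrite sqr_sqrtr // ltW.
have s0 : 0 < Num.sqrt nu by rewrite sqrtr_gt0.
congr sle; have -> : mu = 2 * Num.sqrt nu ^+ 2 by rewrite ss /nu; field.
field; exact: lt0r_neq0.
Qed.

End Poisson.

(** * Poisson approximation *)

Section Recurrence.
Variable S : comNzRingType.
Hypothesis nat_reg : forall n (x : S), n.+1%:R * x = 0 -> x = 0.

(** A linear differential equation t H' = Z H without constant term determines each coefficient from
    the earlier ones, as soon as positive integers are not zero divisors. *)
Lemma rec_unique (Z H G : fps S) : Z 0%N = 0 -> fD H = Z * H -> fD G = Z * G ->
  H 0%N = G 0%N -> H = G.
Proof.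
move=> Z0 hH hG H0; apply/funext; elim/ltn_ind => -[//|n] IH.
have h (F : fps S) : fD F = Z * F -> n.+1%:R * F n.+1 = \sum_(i < n.+1) Z i.+1 * F (n - i)%N.
  move=> hF; rewrite -[LHS]/(fD F n.+1) hF fmulE big_ord_recl Z0 mul0r add0r.
  by apply: eq_bigr => i _; rewrite ?lift0 /bump /= ?add1n subSS.
apply/eqP; rewrite -subr_eq0; apply/eqP; apply: (nat_reg (n := n)).
rewrite mulrBr (h _ hH) (h _ hG) -sumrB big1 // => i _.
by rewrite IH ?subrr // ltnS leq_subr.
Qed.
End Recurrence.

Section Core.
Variable R : realType.
Variables (theta : R) (theta0 : 0 < theta).

Lemma fps_nat_reg n (x : fps R) : n.+1%:R * x = 0 -> x = 0.
Proof.
move=> h; apply/funext => i; have := congr1 (fun f : fps R => f i) h.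
rewrite -fcst_nat /= fcstE f0E => /eqP; rewrite mulf_eq0 pnatr_eq0 /= => /eqP //.
Qed.

(* [rise n] is the coefficient of [t^n] in (1 - t)^(- theta x). *)
Fixpoint rise n : fps R := if n is m.+1 then
  fcst (m.+1%:R^-1) * (fcst m%:R + fcst theta * fX R) * rise m else 1.
(** The coefficient of t^n in (1 - t)^(- theta), which is [rise n] at x = 1 and therefore bounds its
    norm, the coefficients being non-negative. *)
Fixpoint alpha n : R := if n is m.+1 then (m%:R + theta) / m.+1%:R * alpha m else 1.

Lemma alpha_gt0 n : 0 < alpha n.
Proof. by elim: n => //= n IH; rewrite mulr_gt0 // divr_gt0 // ltr_wpDl. Qed.

Lemma riseS n : n.+1%:R * rise n.+1 = (fcst n%:R + fcst theta * fX R) * rise n.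
Proof.
rewrite /= mulrA mulrA -fcst_nat -fcstM mulfV ?pnatr_eq0 // fcst1 mul1r //.
Qed.

Lemma alphaS n : n.+1%:R * alpha n.+1 = (n%:R + theta) * alpha n.
Proof. by rewrite /=; field. Qed.

(** The differential equation t F' = theta x t / (1 - t) F for F = (1 - t)^(- theta x), in the form
    needed by [H_conv]. *)
Lemma rise_sum n : n%:R * rise n = \sum_(k < n) fcst theta * fX R * rise k.
Proof.
elim: n => [|n IH]; first by rewrite mul0r big_ord0.
by rewrite big_ord_recr -IH riseS mulrDl fcst_nat.
Qed.

Lemma alpha_sum n : theta * \sum_(k < n) alpha k = n%:R * alpha n.
Proof.
elim: n => [|n IH]; first by rewrite mul0r big_ord0 mulr0.
by rewrite big_ord_recr mulrDr IH alphaS mulrDl.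
Qed.

Lemma nle_rise n : nle (rise n) (alpha n).
Proof.
elim: n => [|n IH]; first exact: nle1.
rewrite /=; apply: nleM IH; rewrite [in X in nle _ X]mulrC.
apply: nleM; first by have := nle_cst (n.+1%:R^-1 : R); rewrite ger0_norm.
apply: nleD; first by have := nle_cst (n%:R : R); rewrite ger0_norm.
by rewrite -[theta in X in nle _ X]mulr1 -{2}(gtr0_norm theta0); apply: nleM (nle_cst _) (nleX R).
Qed.

(** The products m alpha_m increase with m, since (m + 1) alpha_(m+1) = (m + theta) alpha_m. *)
Lemma alpha_half m n : (m <= n)%N -> (n <= m.*2)%N -> alpha m <= 2 * alpha n.
Proof.
move=> mn nm; case: m mn nm => [|m] mn nm.
  by move: nm; rewrite leqn0 => /eqP ->; rewrite /= mulr1 ler1n.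
have mono j : m.+1%:R * alpha m.+1 <= (m.+1 + j)%:R * alpha (m.+1 + j)%N.
  elim: j => [|j IH]; first by rewrite addn0.
  rewrite addnS [leRHS]alphaS (le_trans IH) // ler_wpM2r ?(ltW (alpha_gt0 _)) //.
  by rewrite lerDl ltW.
have := mono (n - m.+1)%N; rewrite subnKC // => h.
rewrite -(ler_pM2l (x := m.+1%:R)) ?ltr0n // (le_trans h) // mulrA.
by rewrite ler_wpM2r ?(ltW (alpha_gt0 _)) // -natrM ler_nat muln2.
Qed.

Lemma nle_riseS m : nle (rise m.+1 - rise m) (alpha m * ((theta + 1) / m.+1%:R)).
Proof.
have -> : rise m.+1 - rise m = rise m * (fcst (m.+1%:R^-1) * (fcst theta * fX R - 1)).
  rewrite /=.
  have E : fcst (m.+1%:R^-1) * (fcst m%:R + 1) = 1 :> fps R.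
    by rewrite -fcst1 -fcstD -fcstM natr1 mulVf ?pnatr_eq0.
  move: E; set u := fcst (m.+1%:R^-1); set w := fcst m%:R; set x := rise m => E.
  have -> : u * (w + fcst theta * fX R) * x - x =
     x * (u * (fcst theta * fX R - 1)) + (u * (w + 1) - 1) * x by ring.
  by rewrite E subrr mul0r addr0.
apply: nleM; first exact: nle_rise.
rewrite [X in nle _ X]mulrC; apply: nleM; first by have := nle_cst (m.+1%:R^-1 : R); rewrite ger0_norm.
apply: nleB (nle1 R); rewrite -[theta in X in nle _ X]mulr1 -{2}(gtr0_norm theta0).
exact: nleM (nle_cst _) (nleX R).
Qed.

(** Telescoping of [nle_riseS]: all indices passed are at least n / 2, where alpha is at most 2
    alpha_n and 1 / (m + 1) at most 2 / n. *)
Lemma nle_rise_diff n k : (k.*2 <= n)%N -> (0 < n)%N ->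
  nle (rise (n - k)%N - rise n) (alpha n * (4 * (theta + 1) * (k%:R / n%:R))).
Proof.
move=> kn n0; have nr : 0 < n%:R :> R by rewrite ltr0n.
elim: k kn => [|k IH] kn.
  by rewrite subn0 subrr mul0r !mulr0; exact: nle0.
have kn' : (k.+1 <= n)%N by lia.
have -> : rise (n - k.+1)%N - rise n =
   (rise (n - k)%N - rise n) - (rise (n - k.+1).+1 - rise (n - k.+1)%N).
  by rewrite subnSK //; ring.
apply: nle_le (nleB (IH _) (nle_riseS _)); last by lia.
set m := (n - k.+1)%N; have am : alpha m <= 2 * alpha n by apply: alpha_half; rewrite /m; lia.
have -> : alpha n * (4 * (theta + 1) * (k.+1%:R / n%:R)) =
   alpha n * (4 * (theta + 1) * (k%:R / n%:R)) + (2 * alpha n) * ((theta + 1) * (2 / n%:R)).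
  by rewrite -[k.+1%:R]natr1; field; exact: lt0r_neq0.
rewrite lerD2l.
have t1 : 0 <= theta + 1 by rewrite addr_ge0 // ltW.
apply: ler_pM => //; first exact: ltW (alpha_gt0 _).
  by rewrite divr_ge0.
rewrite ler_wpM2l // ler_pdivlMr // mulrC ler_pdivrMr ?ltr0n //.
by rewrite -natrM ler_nat /m; lia.
Qed.

Variables (bet : nat -> R) (g M : R) (g0 : 0 < g) (g1 : g <= 1) (M0 : 0 < M).
Hypothesis hbet : forall k, (0 < k)%N -> `|bet k| <= M * k%:R `^ (- 1 - g).

(* The indeterminate is t here, but x in [rise n]. *)
Definition bseries : fps R := fun k => if k == 0%N then 0 else bet k.
(** Half of the exponent g is given up to keep the weighted sum of the |b_k| finite; the other half
    is the rate obtained. *)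
Let del := g / 2.
Let v k : R := k.+1%:R `^ del.

Lemma del0 : 0 < del. Proof. by rewrite divr_gt0. Qed.
Lemma del1 : del <= 1. Proof. by have := g1; rewrite ler_pdivrMr //; lra. Qed.
Lemma v_ge1 k : 1 <= v k.
Proof.
apply: (@le_trans _ _ (k.+1%:R `^ 0)); first by rewrite powRr0.
by apply: ler_powR; [rewrite ler1n | exact: ltW del0].
Qed.
Lemma v_gt0 k : 0 < v k. Proof. exact: lt_le_trans (v_ge1 k). Qed.
Lemma v_sub i j : v (i + j) <= v i * v j.
Proof.
rewrite /v -powRM // -natrM; apply: ge0_ler_powR; rewrite ?nnegrE ?(ltW del0) // ler_nat.
nia.
Qed.

(* The submultiplicative weight [v i = (i + 1)^(g / 2)] measures the decay of coefficients. *)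
Definition wle (a : fps R) C := forall N, \sum_(i < N) `|a i| * v i <= C.

Lemma wleM a b C D : wle a C -> wle b D -> wle (a * b) (C * D).
Proof.
move=> ha hb N.
have p0 (c : fps R) i : 0 <= `|c i| * v i by rewrite mulr_ge0 // ltW ?v_gt0.
apply: (@le_trans _ _ ((\sum_(i < N) `|a i| * v i) * (\sum_(i < N) `|b i| * v i))); last first.
  by apply: ler_pM => //; apply: sumr_ge0.
apply: le_trans (@conv_sum_le R N (fun i => `|a i| * v i) (fun i => `|b i| * v i) _ _) => //.
apply: ler_sum => n _; rewrite fmulE.
apply: le_trans (ler_wpM2r (ltW (v_gt0 n)) (ler_norm_sum _ _ _)) _.
rewrite mulr_suml; apply: ler_sum => i _; rewrite normrM.
have -> : `|a i| * v i * (`|b (n - i)%N| * v (n - i)%N) =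
  `|a i| * `|b (n - i)%N| * (v i * v (n - i)%N) by ring.
rewrite ler_wpM2l ?mulr_ge0 //; have := v_sub i (n - i)%N.
by rewrite subnKC // -ltnS.
Qed.

Lemma wle1 : wle 1 1.
Proof.
move=> [|N]; first by rewrite big_ord0.
rewrite big_ord_recl big1 => [|i _]; last by rewrite f1E /= normr0 mul0r.
by rewrite f1E /= normr1 mul1r addr0 /v powR1.
Qed.

Lemma wleX a C n : wle a C -> wle (a ^+ n) (C ^+ n).
Proof.
move=> h; elim: n => [|n IH]; first by rewrite !expr0; exact: wle1.
by rewrite !exprS; exact: wleM.
Qed.

Lemma wle_nle a C : wle a C -> nle a C.
Proof.
move=> h N; apply: le_trans (h N); apply: ler_sum => i _.
by rewrite ler_peMr // v_ge1.
Qed.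

(** A bound for the weighted norm of b: 2 M for k = 1, and the tail by [powRN_tail]. *)
Let V := M * 2 * (1 + del^-1).
Lemma V_gt0 : 0 < V.
Proof. by rewrite /V mulr_gt0 ?mulr_gt0 // addr_gt0 // invr_gt0 del0. Qed.

Lemma wle_bseries : wle bseries V.
Proof.
have term k : (0 < k)%N -> `|bseries k| * v k <= M * 2 * k%:R `^ (- 1 - del).
  move=> k0; have kr : 0 < k%:R :> R by rewrite ltr0n.
  have vk : v k <= 2 * k%:R `^ del.
    apply: (@le_trans _ _ ((2 * k%:R) `^ del)).
      apply: ge0_ler_powR; rewrite ?nnegrE ?(ltW del0) // -natrM ler_nat; lia.
    rewrite powRM // ler_wpM2r ?powR_ge0 //.
    by apply: ler1_powR; [rewrite ler1n | exact: del1].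
  rewrite /bseries gtn_eqF //; apply: (@le_trans _ _ (M * k%:R `^ (- 1 - g) * (2 * k%:R `^ del))).
    by apply: ler_pM => //; [exact: ltW (v_gt0 _) | exact: hbet].
  have -> : (- 1 - del) = (- 1 - g) + del by rewrite /del; field.
  rewrite [in leRHS]powRD ?lt0r_neq0 ?implybT // le_eqVlt; apply/orP; left; apply/eqP; ring.
move=> N; rewrite -(big_mkord xpredT (fun k => `|bseries k| * v k)).
have M20 : 0 <= M * 2 by rewrite mulr_ge0 // ltW.
case: N => [|[|N]]; first by rewrite big_geq // ltW ?V_gt0.
  by rewrite big_nat1 normr0 mul0r ltW ?V_gt0.
rewrite big_ltn // big_ltn // normr0 mul0r add0r /V mulrDr lerD //.
  by apply: le_trans (term 1%N isT) _; rewrite powR1.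
have := powRN_tail N.+2 del0 (leqnn 1); rewrite powR1 mul1r => h.
apply: le_trans (ler_wpM2l M20 h); rewrite mulr_sumr !big_nat.
by apply: ler_sum => k /andP[k1 _]; apply: term; exact: ltn_trans k1.
Qed.

(* [ecoef k] is the coefficient of [t^k] in exp (x b(t)), where b is [bseries]. *)
Definition ecoef k : fps R := fun i => (bseries ^+ i) k / i`!%:R.

Lemma bseries_pow_small i k : (k < i)%N -> (bseries ^+ i) k = 0.
Proof.
elim: i k => [//|i IH] k ki.
rewrite exprS fmulE big_ord_recl (_ : bseries ord0 = 0) // mul0r add0r big1 // => j _.
by rewrite IH ?mulr0 // lift0; have := ltn_ord j; lia.
Qed.

Lemma ecoef0 : ecoef 0%N = 1.
Proof.
apply/funext => -[|i]; rewrite /ecoef f1E /=; first by rewrite expr0 f1E divr1.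
by rewrite bseries_pow_small // mul0r.
Qed.

(** The norm of [ecoef k], a polynomial in x of degree at most k because b has no constant term. *)
Definition ee k : R := \sum_(i < k.+1) `|ecoef k i|.

Lemma ee_ge0 k : 0 <= ee k. Proof. by apply: sumr_ge0. Qed.

Lemma nle_ecoef k : nle (ecoef k) (ee k).
Proof.
move=> N; rewrite /ee -!(big_mkord xpredT (fun i => `|ecoef k i|)).
have z i : (k < i)%N -> `|ecoef k i| = 0.
  by move=> ki; rewrite /ecoef bseries_pow_small // mul0r normr0.
have [Nk|kN] := leqP N k.+1.
  by rewrite [leRHS](big_cat_nat (n := N)) //= lerDl sumr_ge0.
rewrite (big_cat_nat (n := k.+1)) ?(ltnW kN) //= [X in _ + X]big_nat.
by rewrite [X in _ + X]big1 ?addr0 // => i /andP[ki _]; rewrite z.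
Qed.

(** The differential equation t E' = x t b' E of E = exp (x b(t)), checked on each power of x by the
    rule for the derivative of a power of b. *)
Lemma ecoef_rec n : n.+1%:R * ecoef n.+1 =
  \sum_(k < n.+1) fX R * fcst (k.+1%:R * bet k.+1) * ecoef (n - k)%N.
Proof.
apply/funext => i; rewrite -fcst_nat fcstE fsumE.
under eq_bigr do rewrite -mulrA fXE.
case: i => [|i].
  by rewrite /ecoef expr0 f1E mul0r mulr0 big1.
under eq_bigr do rewrite fcstE.
rewrite /ecoef mulrA.
have := congr1 (fun f : fps R => f n.+1) (fDX bseries i).
rewrite /= -[LHS]/(n.+1%:R * _) => ->.
rewrite -fcst_nat fcstE mulrC [bseries ^+ i * _]mulrC fmulE big_ord_recl.
rewrite [fD bseries ord0]mul0r mul0r add0r mulr_sumr mulr_sumr; apply: eq_bigr => k _.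
rewrite ?lift0 /bump /= ?add1n subSS /fD /bseries /= factS natrM; field.
by rewrite lt0r_neq0 ?fact_gt0R // nat1r pnatr_eq0.
Qed.

(** The exponential series in the submultiplicative weighted norm, in which b has norm at most V. *)
Lemma ee_sum N : \sum_(k < N) ee k * v k <= expR V.
Proof.
apply: le_trans (exp_sum_le N (ltW V_gt0)).
apply: (@le_trans _ _ (\sum_(k < N) \sum_(i < N) `|(bseries ^+ i) k| / i`!%:R * v k)).
  apply: ler_sum => k _; rewrite -mulr_suml; apply: ler_wpM2r; first exact: ltW (v_gt0 _).
  rewrite /ee (big_ord_widen N (fun i => `|ecoef k i|)) //.
  rewrite [leRHS](bigID (fun i : 'I_N => (i < k.+1)%N)) /=.
  apply: ler_wpDr; first by apply: sumr_ge0 => i _; rewrite divr_ge0.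
  apply: ler_sum => i _; rewrite /ecoef normrM.
  by rewrite [X in _ * X <= _]ger0_norm ?invr_ge0.
rewrite exchange_big /=; apply: ler_sum => i _.
rewrite (eq_bigr (fun k : 'I_N => (`|(bseries ^+ i) k| * v k) / i`!%:R)); last by move=> k _; ring.
rewrite -mulr_suml ler_wpM2r ?invr_ge0 //; exact: wleX wle_bseries N.
Qed.

(** In the recurrence, k |b_k| is at most M k^(- del), and k^(- del) <= m^(- del) v (m - k); the
    weighted sum of the [ee] then closes the estimate. *)
Lemma ee_point m : (0 < m)%N -> m%:R * ee m <= M * expR V * m%:R `^ (- del).
Proof.
case: m => // n _.
have n0 : 0 < n.+1%:R :> R by rewrite ltr0n.
have h : nle (n.+1%:R * ecoef n.+1)
   (\sum_(k < n.+1) `|k.+1%:R * bet k.+1| * ee (n - k)%N).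
  rewrite ecoef_rec; apply: nle_sum => k _; apply: nleM (nle_ecoef _).
  by rewrite -[X in nle _ X]mul1r; apply: nleM (nleX R) (nle_cst _).
have -> : n.+1%:R * ee n.+1 = \sum_(i < n.+2) `|(n.+1%:R * ecoef n.+1) i|.
  rewrite /ee mulr_sumr; apply: eq_bigr => i _.
  by rewrite -fcst_nat fcstE [RHS]normrM [X in X * _ = _](_ : _ = `|n.+1%:R|) // ger0_norm.
apply: le_trans (h _) _.
have P0 : 0 <= n.+1%:R `^ (- del) :> R by exact: powR_ge0.
apply: (@le_trans _ _ (\sum_(k < n.+1) M * n.+1%:R `^ (- del) * (ee (n - k)%N * v (n - k)%N))).
  apply: ler_sum => k _; have kn : (k <= n)%N by rewrite -ltnS.
  have kr : 0 < k.+1%:R :> R by rewrite ltr0n.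
  rewrite normrM (ger0_norm (ltW kr)).
  have h1 : k.+1%:R * `|bet k.+1| <= M * k.+1%:R `^ (- del).
    apply: (@le_trans _ _ (k.+1%:R * (M * k.+1%:R `^ (- 1 - g)))).
      by rewrite ler_wpM2l ?(ltW kr) // hbet.
    rewrite mulrCA ler_wpM2l ?(ltW M0) //.
    have -> : - 1 - g = - g - 1 by ring.
    have -> : k.+1%:R * k.+1%:R `^ (- g - 1) = k.+1%:R `^ (- g) :> R.
      rewrite -[X in X * _](powRr1 (ltW kr)) -powRD ?lt0r_neq0 ?implybT //.
      by congr (_ `^ _); ring.
    apply: ler_powR; rewrite ?ler1n // /del; have := g0; lra.
  have h2 : k.+1%:R `^ (- del) <= n.+1%:R `^ (- del) * v (n - k)%N.
    have hh : n.+1%:R `^ del <= k.+1%:R `^ del * v (n - k)%N.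
      rewrite /v -powRM // -natrM; apply: ge0_ler_powR; rewrite ?nnegrE ?(ltW del0) //.
      by rewrite ler_nat; nia.
    rewrite !powRN -ler_pdivrMl ?invr_gt0 ?powR_gt0 // invrK.
    by rewrite ler_pdivrMr ?powR_gt0 // mulrC.
  rewrite mulrA (mulrAC _ _ (v _)) -(mulrA M) ler_wpM2r ?ee_ge0 //.
  by rewrite (le_trans h1) // ler_wpM2l // ltW.
rewrite -mulr_sumr [leRHS]mulrAC ler_wpM2l ?mulr_ge0 ?(ltW M0) //.
have := ee_sum n.+1; rewrite (reindex_inj rev_ord_inj) /=.
by congr (_ <= _); apply: eq_bigr => k _; rewrite subSS.
Qed.

Definition Ksum n : R := \sum_(k < n.+1) bseries k.
Definition expu (x : R) : fps R := fun i => x ^+ i / i`!%:R.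

Lemma Ksum_le n : `|Ksum n| <= V.
Proof. by rewrite (le_trans (ler_norm_sum _ _ _)) // (wle_nle wle_bseries). Qed.

(** The two sums differ by the terms with i + j > n, where the weights satisfy v i v j >= v (i + j)
    >= (n + 1)^del. *)
Lemma prod_trunc (a b : fps R) C D n : wle a C -> wle b D ->
  `|\sum_(k < n.+1) (a * b) k - (\sum_(k < n.+1) a k) * (\sum_(k < n.+1) b k)|
    <= n.+1%:R `^ (- del) * (C * D).
Proof.
move=> ha hb; have nu0 : 0 < n.+1%:R `^ (- del) :> R by apply: powR_gt0.
have E1 : \sum_(k < n.+1) (a * b) k =
   \sum_(i < n.+1) \sum_(j < n.+1 | (i + j < n.+1)%N) a i * b j.
  exact: (conv_sum_exchange (fun i j => a i * b j)).
have -> : (\sum_(k < n.+1) a k) * (\sum_(k < n.+1) b k) =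
   \sum_(i < n.+1) \sum_(j < n.+1) a i * b j.
  by rewrite mulr_suml; apply: eq_bigr => i _; rewrite mulr_sumr.
rewrite E1 -sumrB.
apply: le_trans (ler_norm_sum _ _ _) _.
apply: (@le_trans _ _ (\sum_(i < n.+1) \sum_(j < n.+1)
    n.+1%:R `^ (- del) * ((`|a i| * v i) * (`|b j| * v j)))).
  apply: ler_sum => i _.
  rewrite [X in _ - X](bigID (fun j : 'I_n.+1 => (i + j < n.+1)%N)) /= opprD addrA subrr add0r.
  rewrite normrN (le_trans (ler_norm_sum _ _ _)) //.
  rewrite [leRHS](bigID (fun j : 'I_n.+1 => (i + j < n.+1)%N)) /=.
  apply: ler_wpDl.
    by apply: sumr_ge0 => j _; rewrite mulr_ge0 ?(ltW nu0) // !mulr_ge0 // ltW ?v_gt0.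
  apply: ler_sum => j; rewrite -leqNgt => ij.
  rewrite normrM.
  have -> : n.+1%:R `^ (- del) * (`|a i| * v i * (`|b j| * v j)) =
    `|a i| * `|b j| * (n.+1%:R `^ (- del) * (v i * v j)) by ring.
  rewrite ler_peMr ?mulr_ge0 // powRN mulrC ler_pdivlMr ?powR_gt0 // mul1r.
  apply: le_trans (v_sub i j).
  apply: ge0_ler_powR; rewrite ?nnegrE ?(ltW del0) // ler_nat; lia.
under eq_bigr do rewrite -mulr_sumr -mulr_sumr.
rewrite -mulr_sumr -mulr_suml ler_wpM2l ?(ltW nu0) //.
have p0 (c : fps R) i : 0 <= `|c i| * v i by rewrite mulr_ge0 // ltW ?v_gt0.
by apply: ler_pM => //; apply: sumr_ge0.
Qed.

(** Truncated sums are multiplicative up to [prod_trunc]; by induction the error for the i-th power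
    is i V^i, and summing i V^i / i! gives V exp V. *)
Lemma esum_expu n : nle (\sum_(k < n.+1) ecoef k - expu (Ksum n))
   (n.+1%:R `^ (- del) * (V * expR V)).
Proof.
set nu := n.+1%:R `^ (- del); have nu0 : 0 <= nu by exact: powR_ge0.
have V0 := V_gt0.
have H i : `|\sum_(k < n.+1) (bseries ^+ i) k - Ksum n ^+ i| <= nu * (i%:R * V ^+ i).
  elim: i => [|i IH].
    rewrite !expr0 big_ord_recl big1 => [|k _]; rewrite ?f1E //= addr0 subrr normr0.
    by rewrite mul0r mulr0.
  have := prod_trunc n wle_bseries (wleX i wle_bseries); rewrite -/nu -/(Ksum n) => P.
  have -> : \sum_(k < n.+1) (bseries ^+ i.+1) k - Ksum n ^+ i.+1 =
    (\sum_(k < n.+1) (bseries * bseries ^+ i) k - Ksum n * \sum_(k < n.+1) (bseries ^+ i) k)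
    + Ksum n * (\sum_(k < n.+1) (bseries ^+ i) k - Ksum n ^+ i) by rewrite !exprS; ring.
  rewrite (le_trans (ler_normD _ _)) // -[i.+1%:R]natr1.
  have -> : nu * ((i%:R + 1) * V ^+ i.+1) = nu * (V * V ^+ i) + V * (nu * (i%:R * V ^+ i)).
    by rewrite exprS; ring.
  rewrite lerD // normrM; apply: ler_pM => //; exact: Ksum_le.
move=> N; apply: (@le_trans _ _ (\sum_(i < N) nu * (i%:R * V ^+ i / i`!%:R))).
  apply: ler_sum => i _; rewrite faddE foppE fsumE /ecoef /expu -mulr_suml -mulrBl.
  rewrite normrM [X in _ * X]ger0_norm ?invr_ge0 // mulrA.
  by rewrite ler_wpM2r ?invr_ge0.
rewrite -mulr_sumr ler_wpM2l //.
case: N => [|N]; first by rewrite big_ord0 mulr_ge0 ?expR_ge0 // ltW.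
rewrite big_ord_recl /= mul0r mul0r add0r.
apply: le_trans (ler_wpM2l (ltW V0) (exp_sum_le N (ltW V0))).
rewrite mulr_sumr le_eqVlt; apply/orP; left; apply/eqP; apply: eq_bigr => i _.
rewrite ?lift0 /bump /= ?add1n factS natrM exprS; field.
by rewrite lt0r_neq0 ?fact_gt0R // nat1r pnatr_eq0.
Qed.

Variable H : nat -> fps R.
Hypothesis H0 : H 0%N = 1.
Hypothesis Hrec : forall n, n.+1%:R * H n.+1 =
  \sum_(k < n.+1) fX R * fcst (theta + k.+1%:R * bet k.+1) * H (n - k)%N.

(** Over the ring of series in x, both sides solve the same linear differential equation in t:
    logarithmic derivatives add under products, which is [ZE]. *)
Lemma H_conv n : H n = \sum_(k < n.+1) rise (n - k)%N * ecoef k.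
Proof.
pose Z : fps (fps R) := fun k => if k is j.+1 then fX R * fcst (theta + j.+1%:R * bet j.+1) else 0.
pose Ht : fps (fps R) := H; pose At : fps (fps R) := rise; pose et : fps (fps R) := ecoef.
pose P : fps (fps R) := fun k => if k is j.+1 then fcst theta * fX R else 0.
pose Q : fps (fps R) := fun k => if k is j.+1 then fX R * fcst (j.+1%:R * bet j.+1) else 0.
have mulS (Y F : fps (fps R)) m : Y 0%N = 0 ->
    (Y * F) m.+1 = \sum_(k < m.+1) Y k.+1 * F (m - k)%N.
  move=> Y0; rewrite fmulE big_ord_recl Y0 mul0r add0r.
  by apply: eq_bigr => i _; rewrite ?lift0 /bump /= ?add1n subSS.
have mul0 (Y F : fps (fps R)) : Y 0%N = 0 -> (Y * F) 0%N = 0.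
  by move=> Y0; rewrite fmulE big_ord1 Y0 mul0r.
have dA : fD At = P * At.
  apply/funext => -[|m]; first by rewrite mul0 // /fD mul0r.
  rewrite mulS // -[LHS]/(m.+1%:R * rise m.+1) rise_sum (reindex_inj rev_ord_inj) /=.
  by apply: eq_bigr => k _; rewrite subSS.
have de : fD et = Q * et.
  apply/funext => -[|m]; first by rewrite mul0 // /fD mul0r.
  by rewrite mulS // -[LHS]/(m.+1%:R * ecoef m.+1) ecoef_rec.
have dH : fD Ht = Z * Ht.
  apply/funext => -[|m]; first by rewrite mul0 // /fD mul0r.
  by rewrite mulS // -[LHS]/(m.+1%:R * H m.+1) Hrec.
have ZE : Z = P + Q.
  apply/funext => -[|m]; rewrite faddE /Z /P /Q ?addr0 // fcstD; ring.
have dG : fD (et * At) = Z * (et * At) by rewrite fDM dA de ZE; ring.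
have HtE : Ht = et * At.
  apply: rec_unique dH dG _ => //; first exact: fps_nat_reg.
  by rewrite fmulE big_ord1 /et ecoef0 /Ht H0 mul1r.
by rewrite -[H n]/(Ht n) HtE fmulE; apply: eq_bigr => k _; rewrite mulrC.
Qed.

(** Replacing [rise (n - k)] by [rise n] in the convolution is cheap for k <= n / 2, by
    [nle_rise_diff]; for larger k the decay of [ee] pays, through [ee_point] and the sum of the
    alpha. *)
Lemma H_approx : exists2 C : R, 0 < C & forall n, (0 < n)%N ->
  nle (H n - rise n * expu (Ksum n)) (C * alpha n * n%:R `^ (- del)).
Proof.
pose W := expR V; have W0 : 0 < W by exact: expR_gt0.
(* [C1] is for k <= n / 2; [C2] and [C3] are for larger k, from [rise (n - k)] and from [rise n];
   [V * W] will come from [esum_expu]. *)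
pose C1 := 4 * (theta + 1) * W; pose C2 := 4 * (M * W) / theta; pose C3 := 2 * W.
have VW0 : 0 < V * W := mulr_gt0 V_gt0 W0.
exists (C1 + C2 + C3 + V * W).
  have t1 : 0 < theta + 1 by rewrite addr_gt0.
  have C10 : 0 < C1 by rewrite /C1 mulr_gt0 // mulr_gt0.
  have C20 : 0 < C2 by rewrite /C2 divr_gt0 // mulr_gt0 // mulr_gt0.
  have C30 : 0 < C3 by rewrite /C3 mulr_gt0.
  by rewrite (addr_gt0 (addr_gt0 (addr_gt0 C10 C20) C30) VW0).
move=> n n0; have nr : 0 < n%:R :> R by rewrite ltr0n.
have an0 := alpha_gt0 n.
set nu := n%:R `^ (- del); have nu0 : 0 < nu by exact: powR_gt0.
have E1 : H n - rise n * expu (Ksum n) =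
   \sum_(k < n.+1) (rise (n - k)%N - rise n) * ecoef k +
   rise n * (\sum_(k < n.+1) ecoef k - expu (Ksum n)).
  rewrite H_conv mulrBr mulr_sumr addrA; congr (_ - _).
  by rewrite -big_split /=; apply: eq_bigr => k _; ring.
rewrite E1; apply: (@nle_le _ _ ((C1 + C2 + C3) * alpha n * nu + alpha n * (nu * (V * W)))).
  by rewrite le_eqVlt; apply/orP; left; apply/eqP; ring.
apply: nleD; last first.
  apply: nleM (nle_rise n) _; apply: nle_le (esum_expu n).
  apply: (ler_wpM2r (ltW VW0)); rewrite /nu !powRN lef_pV2 ?posrE ?powR_gt0 //.
  by apply: ge0_ler_powR; rewrite ?nnegrE ?(ltW del0) // ler_nat.
pose bnd (k : nat) := if (k.*2 <= n)%N then alpha n * (4 * (theta + 1) * (k%:R / n%:R)) * ee k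
   else (alpha (n - k)%N + alpha n) * ee k.
apply: (@nle_le _ _ (\sum_(k < n.+1) bnd k)); last first.
  apply: nle_sum => k _; rewrite /bnd; case: ifPn => kn; apply: nleM (nle_ecoef k).
    exact: nle_rise_diff.
  by apply: nleB; exact: nle_rise.
have small k : (k.*2 <= n)%N -> bnd k <= alpha n * nu * (4 * (theta + 1)) * (ee k * v k).
  move=> kn; rewrite /bnd kn.
  have h : k%:R / n%:R <= nu * v k.
    case: k kn => [|k] kn; first by rewrite mul0r mulr_ge0 // ltW // v_gt0.
    have kr : 0 < k.+1%:R :> R by rewrite ltr0n.
    have q0 : 0 < k.+1%:R / n%:R :> R by rewrite divr_gt0.
    have q1 : k.+1%:R / n%:R <= 1 :> R.
      by rewrite ler_pdivrMr // mul1r ler_nat (leq_trans _ kn) // -addnn leq_addl.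
    have q01 : 0 < (k.+1%:R / n%:R : R) <= 1 by rewrite q0.
    apply: le_trans (ger1_powR q01 del1) _.
    rewrite powRM ?invr_ge0 ?(ltW kr) ?(ltW nr) // -powR_inv1 ?(ltW nr) // -powRrM mulN1r.
    by rewrite mulrC -/nu ler_wpM2l ?(ltW nu0) //; apply: ge0_ler_powR; rewrite ?nnegrE ?(ltW del0) // ler_nat.
  have -> : alpha n * (4 * (theta + 1) * (k%:R / n%:R)) * ee k =
    alpha n * (4 * (theta + 1)) * ee k * (k%:R / n%:R) by ring.
  have -> : alpha n * nu * (4 * (theta + 1)) * (ee k * v k) =
    alpha n * (4 * (theta + 1)) * ee k * (nu * v k) by ring.
  rewrite ler_wpM2l // !mulr_ge0 ?(ltW an0) ?addr_ge0 ?(ltW theta0) ?ee_ge0 //.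
have large k : (k <= n)%N -> (n < k.*2)%N ->
    bnd k <= 4 * (M * W) * nu / n%:R * alpha (n - k)%N + alpha n * (2 * nu * (ee k * v k)).
  move=> kn nk; rewrite /bnd leqNgt nk /= mulrDl.
  have k0 : (0 < k)%N by rewrite -double_gt0 (leq_ltn_trans _ nk).
  have kr : 0 < k%:R :> R by rewrite ltr0n.
  have hk : n%:R / 2 <= k%:R :> R by rewrite ler_pdivrMr // -natrM ler_nat muln2 ltnW.
  have P0 : 0 < k%:R `^ del :> R by exact: powR_gt0.
  have hP : k%:R `^ (- del) <= 2 * nu.
    rewrite /nu !powRN -div1r ler_pdivrMr // mulrAC ler_pdivlMr ?powR_gt0 // mul1r.
    apply: (@le_trans _ _ ((2 * k%:R) `^ del)).
      by apply: ge0_ler_powR; rewrite ?nnegrE ?(ltW del0) ?mulr_ge0 //; lra.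
    rewrite powRM // ler_wpM2r ?powR_ge0 //.
    by apply: ler1_powR; [rewrite ler1n | exact: del1].
  rewrite lerD //.
    rewrite mulrC ler_wpM2r ?(ltW (alpha_gt0 _)) //.
    have := ee_point k0; rewrite -ler_pdivlMl // => /le_trans; apply.
    have hk' : k%:R^-1 <= 2 / n%:R :> R.
      by rewrite ler_pdivlMr // mulrC ler_pdivrMr //; lra.
    have -> : 4 * (M * W) * nu / n%:R = (2 / n%:R) * (M * W * (2 * nu)) by ring.
    have MW0 : 0 <= M * W by rewrite mulr_ge0 // ltW.
    by apply: ler_pM => //; rewrite ?(mulr_ge0 MW0) ?powR_ge0 // ler_wpM2l.
  rewrite ler_wpM2l ?(ltW an0) // [leRHS]mulrCA ler_peMr ?ee_ge0 //.
  apply: (@le_trans _ _ (k%:R `^ (- del) * v k)).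
    rewrite powRN mulrC ler_pdivlMr // mul1r.
    by apply: ge0_ler_powR; rewrite ?nnegrE ?(ltW del0) // ler_nat.
  by rewrite ler_wpM2r // ltW ?v_gt0.
have all k : (k <= n)%N -> bnd k <= alpha n * nu * (4 * (theta + 1) + 2) * (ee k * v k)
     + 4 * (M * W) * nu / n%:R * (if k == 0%N then 0 else alpha (n - k)%N).
  move=> kn; have ev0 : 0 <= ee k * v k by rewrite mulr_ge0 ?ee_ge0 // ltW ?v_gt0.
  have anu0 : 0 <= alpha n * nu * (ee k * v k) by rewrite !mulr_ge0 ?ee_ge0 ?(ltW (v_gt0 _)) // ltW.
  have cst0 : 0 <= 4 * (M * W) * nu / n%:R by rewrite divr_ge0 // !mulr_ge0 // ltW.
  have [h|h] := leqP k.*2 n.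
    apply: (le_trans (small k h)); rewrite ler_wpDr //.
      by rewrite mulr_ge0 //; case: ifP => // _; rewrite ltW ?alpha_gt0.
    by move: anu0; lra.
  apply: (le_trans (large k kn h)).
  rewrite ifF; last by apply/negbTE; rewrite -lt0n -double_gt0 (leq_ltn_trans _ h).
  rewrite addrC lerD2r.
  have : 0 <= 4 * (theta + 1) * (alpha n * nu * (ee k * v k)).
    by rewrite mulr_ge0 // mulr_ge0 // addr_ge0 // ltW.
  lra.
apply: (@le_trans _ _ (\sum_(k < n.+1) (alpha n * nu * (4 * (theta + 1) + 2) * (ee k * v k)
     + 4 * (M * W) * nu / n%:R * (if k == 0%N :> nat then 0 else alpha (n - k)%N)))).
  by apply: ler_sum => k _; apply: all; rewrite -ltnS.
rewrite big_split /= -mulr_sumr -mulr_sumr.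
have -> : \sum_(k < n.+1) (if k == 0%N :> nat then 0 else alpha (n - k)%N) = n%:R * alpha n / theta.
  rewrite big_ord_recl /= add0r -alpha_sum mulrAC mulfV ?mul1r; last exact: lt0r_neq0.
  rewrite (reindex_inj rev_ord_inj) /=; apply: eq_bigr => k _; congr alpha.
  by rewrite /bump leq0n add1n subnSK ?subKn // ltnW.
have -> : (C1 + C2 + C3) * alpha n * nu = alpha n * nu * (4 * (theta + 1) + 2) * W +
   4 * (M * W) * nu / n%:R * (n%:R * alpha n / theta).
  by rewrite /C1 /C2 /C3; field; rewrite !lt0r_neq0.
rewrite lerD2r ler_wpM2l ?ee_sum //.
by rewrite !mulr_ge0 ?(ltW an0) ?(ltW nu0) // addr_ge0 // mulr_ge0 // addr_ge0 // ltW.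
Qed.

End Core.

(** * Comparison of the main term with a Poisson law, and normalization *)

Section MainTerm.
Variable R : realType.
Variables (theta : R) (theta0 : 0 < theta).

Lemma sum_inv_sq n : \sum_(1 <= k < n) (k%:R ^+ 2)^-1 <= 2 :> R.
Proof.
have [n1|n1] := leqP n 1; first by rewrite big_geq.
case: n n1 => [|[|n]] // _.
rewrite big_ltn // expr1n invr1 (_ : 2 = 1 + 1) // lerD2l.
have := @powRN_tail R 1 1 n.+2 ltr01 (leqnn 1); rewrite powR1 divr1; apply: le_trans.
rewrite !big_nat; apply: ler_sum => k _.
by rewrite (_ : - 1 - 1 = - 2%:R) ?powR_invn //; ring.
Qed.

Definition ber j : R := theta / (j%:R + theta).
Definition Lam n : R := \sum_(j < n) ber j.

Lemma ber_bounds j : 0 <= ber j <= 1.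
Proof.
have h : 0 < j%:R + theta by rewrite ltr_wpDl.
by rewrite divr_ge0 ?(ltW theta0) ?(ltW h) //= ler_pdivrMr // mul1r lerDr.
Qed.

Lemma ber_sq_sum n : \sum_(j < n) ber j ^+ 2 <= 1 + 2 * theta ^+ 2.
Proof.
rewrite -(big_mkord xpredT (fun j => ber j ^+ 2)).
case: n => [|n]; first by rewrite big_geq // addr_ge0 // mulr_ge0 // sqr_ge0.
rewrite big_ltn // lerD //.
  by rewrite /ber add0r divff ?expr1n // lt0r_neq0.
apply: le_trans (ler_wpM2r (sqr_ge0 theta) (sum_inv_sq n.+1)).
rewrite mulr_suml !big_nat; apply: ler_sum => j /andP[j0 _].
have jr : 0 < j%:R :> R by rewrite ltr0n.
rewrite /ber expr_div_n mulrC ler_wpM2r ?sqr_ge0 // lef_pV2 ?posrE ?exprn_gt0 ?addr_gt0 //.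
by rewrite lerXn2r ?nnegrE ?addr_ge0 ?(ltW jr) ?(ltW theta0) // lerDl ltW.
Qed.

(** The increments of the difference are O(1 / n^2), because ln (n + 1) - ln n lies between 1 / (n +
    1) and 1 / n. *)
Lemma Lam_log : exists2 C : R, 0 < C &
  forall n, (0 < n)%N -> `|Lam n - theta * ln n%:R| <= C.
Proof.
have t1 : 0 < theta + 1 by rewrite addr_gt0.
exists (1 + 2 * (theta * (theta + 1))); first by rewrite addr_gt0 // mulr_gt0 // mulr_gt0.
suff H n : `|Lam n.+1 - theta * ln n.+1%:R| <=
    1 + theta * (theta + 1) * \sum_(1 <= k < n.+1) (k%:R ^+ 2)^-1.
  case=> // n _; apply: (le_trans (H n)); rewrite lerD2l mulrC ler_wpM2r ?sum_inv_sq //.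
  by rewrite mulr_ge0 // ltW.
elim: n => [|n IH].
  rewrite /Lam big_ord1 /ber add0r divff ?lt0r_neq0 // ln1 mulr0 subr0 normr1.
  by rewrite big_geq // mulr0 addr0.
have n0 : 0 < n.+1%:R :> R by rewrite ltr0n.
have n20 : 0 < n.+2%:R :> R by rewrite ltr0n.
have nt : 0 < n.+1%:R + theta by rewrite addr_gt0.
rewrite /Lam big_ord_recr -/(Lam _) /= big_nat_recr //= mulrDr addrA.
set x : R := n.+1%:R in IH n0 nt *.
pose l := ln n.+2%:R - ln x : R.
have xE : n.+2%:R = x + 1 :> R by rewrite natr1.
have -> : Lam n.+1 + ber n.+1 - theta * ln n.+2%:R =
   (Lam n.+1 - theta * ln x) + theta * ((x + theta)^-1 - l).
  by rewrite /l /ber -/x; ring.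
rewrite (le_trans (ler_normD _ _)) // lerD // normrM (gtr0_norm theta0) -mulrA.
rewrite ler_pM2l //.
clearbody x; have x10 : x + 1 != 0 by rewrite -xE lt0r_neq0.
have l1 : l <= x^-1.
  rewrite /l -ln_div ?posrE // xE mulrDl divff ?lt0r_neq0 // mul1r.
  by apply: le_ln1Dx; rewrite (lt_trans (ltrN10 R)) // invr_gt0.
have l2 : (x + 1)^-1 <= l.
  rewrite /l -ln_div ?posrE // -[_ / x]invrK lnV ?posrE ?invr_gt0 ?divr_gt0 // invf_div.
  rewrite lerNr; have -> : x / n.+2%:R = 1 + (- (x + 1)^-1).
    by rewrite xE; field; exact: x10.
  apply: le_ln1Dx; rewrite ltrN2 invf_lt1 -?xE //; rewrite xE ltrDr //.
have x2 : 0 < x ^+ 2 by rewrite exprn_gt0.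
have b1 : (x + theta)^-1 - l <= (theta + 1) / x ^+ 2.
  apply: (@le_trans _ _ ((x + theta)^-1 - (x + 1)^-1)); first by rewrite lerB.
  have -> : (x + theta)^-1 - (x + 1)^-1 = (1 - theta) / ((x + theta) * (x + 1)).
    by field; rewrite x10 lt0r_neq0.
  apply: (@le_trans _ _ ((theta + 1) / ((x + theta) * (x + 1)))).
    rewrite ler_wpM2r ?invr_ge0 ?mulr_ge0 ?addr_ge0 ?(ltW n0) ?(ltW theta0) //.
    by have := theta0; lra.
  rewrite ler_wpM2l ?(ltW t1) // lef_pV2 ?posrE ?mulr_gt0 ?addr_gt0 // expr2.
  by rewrite ler_pM ?(ltW n0) // lerDl ?(ltW theta0).
have b2 : l - (x + theta)^-1 <= (theta + 1) / x ^+ 2.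
  apply: (@le_trans _ _ (x^-1 - (x + theta)^-1)); first by rewrite lerB.
  have -> : x^-1 - (x + theta)^-1 = theta / (x * (x + theta)).
    by field; rewrite !lt0r_neq0.
  apply: ler_pM; rewrite ?invr_ge0 ?mulr_ge0 ?addr_ge0 ?(ltW n0) ?(ltW theta0) //.
    by rewrite lerDl.
  rewrite lef_pV2 ?posrE ?mulr_gt0 ?addr_gt0 // expr2 ler_pM2l // lerDl ltW //.
by rewrite ler_norml; apply/andP; split => //; rewrite lerNl opprB.
Qed.

(** Each factor (j + theta x) / (j + 1) is (j + theta) / (j + 1) times a Bernoulli generating
    function. Multiplying 1 + (x - 1) D by 1 + (x - 1) d replaces D by D + d + (x - 1) D d; as x - 1
    has norm 2, the quantity 1 + 2 c is multiplicative, and its product is at most the exponential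
    of a bounded sum. *)
Lemma rise_poisson : exists2 C : R, 0 < C & forall n, exists2 D : fps R,
  rise theta n = fcst (alpha theta n) * (pois (Lam n) * (1 + dlt R * D)) & nle D C.
Proof.
pose q j := 2 * expR 2 * ber j ^+ 2 : R.
have q0 j : 0 <= q j by rewrite mulr_ge0 ?sqr_ge0 // mulr_ge0 // expR_ge0.
pose C := expR (4 * expR 2 * (1 + 2 * theta ^+ 2)); exists C; first exact: expR_gt0.
suff H n : exists2 D : fps R,
    rise theta n = fcst (alpha theta n) * (pois (Lam n) * (1 + dlt R * D)) &
    exists2 c : R, nle D c & 1 + 2 * c <= \prod_(j < n) (1 + 2 * q j).
  move=> n; have [D hD [c hc cP]] := H n; have c0 := nle_ge0 hc; exists D => //; apply: nle_le hc.
  have : 1 + 2 * c <= C; last by lra.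
  apply: (le_trans cP); apply: (@le_trans _ _ (\prod_(j < n) expR (2 * q j))).
    apply: ler_prod => j _; apply/andP; split; last exact: expR_ge1Dx.
    by apply: addr_ge0 => //; apply: mulr_ge0.
  rewrite -expR_sum ler_expR /q.
  rewrite (eq_bigr (fun j : 'I_n => 4 * expR 2 * ber j ^+ 2)); last by move=> j _; ring.
  by rewrite -mulr_sumr ler_wpM2l ?ber_sq_sum // mulr_ge0 // expR_ge0.
elim: n => [|n [D hD [c hc cP]]].
  exists 0; last by exists 0; [exact: nle0 | rewrite big_ord0 mulr0 addr0].
  by rewrite /= fcst1 /Lam big_ord0 pois0 !mul1r mulr0 addr0.
have [d hd dq] := bernoulli_pois (ber_bounds n); rewrite -/(q n) in dq.
exists (D + d + dlt R * (D * d)).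
  have nt : 0 < n%:R + theta by rewrite ltr_wpDl.
  have E1 : fcst n%:R + fcst theta * fX R = fcst (n%:R + theta) * (1 + fcst (ber n) * dlt R).
    have eb : (n%:R + theta) * ber n = theta by rewrite /ber mulrC divfK ?lt0r_neq0.
    rewrite mulrDr mulr1 mulrA -fcstM eb fcstD /dlt; ring.
  rewrite /= E1 hD hd fcstM fcstM -/(Lam n) /Lam big_ord_recr /= -/(Lam n) -poisD.
  rewrite -[alpha _ _]/(alpha theta n); ring.
exists (c + q n + 2 * (c * q n)).
  apply: nleD; first exact: nleD.
  by apply: nleM; [exact: nle_dlt | exact: nleM].
rewrite big_ord_recr /=.
have -> : 1 + 2 * (c + q n + 2 * (c * q n)) = (1 + 2 * c) * (1 + 2 * q n) by ring.
by rewrite ler_wpM2r // addr_ge0 // mulr_ge0.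
Qed.

Lemma expu_pois (x : R) : expu x = fcst (expR x) * pois x.
Proof.
apply/funext => i; rewrite fcstE -[pois x i]/(expR (- x) * (x ^+ i / i`!%:R)).
by rewrite [RHS]mulrA expRxMexpNx_1 mul1r.
Qed.

Variables (bet : nat -> R) (g M : R) (g0 : 0 < g) (g1 : g <= 1) (M0 : 0 < M).
Hypothesis hbet : forall k, (0 < k)%N -> `|bet k| <= M * k%:R `^ (- 1 - g).
Variable H : nat -> fps R.
Hypothesis H0 : H 0%N = 1.
Hypothesis Hrec : forall n, n.+1%:R * H n.+1 =
  \sum_(k < n.+1) fX R * fcst (theta + k.+1%:R * bet k.+1) * H (n - k)%N.
Variables (K : R) (N1 : nat).
Hypothesis hK : forall n, (N1 <= n)%N -> `|Ksum bet n - K| <= 1.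

(** The parameters of the two Poisson factors add up to [Lam n + Ksum bet n], which stays within
    bounded distance of K + theta ln n; [pois_shift] moves it there. *)
Lemma H_poisson : exists CD CN : R, [/\ 0 < CD, 0 < CN &
  forall n, (0 < n)%N -> (N1 <= n)%N -> exists kap : R, 0 < kap /\
   exists D Er : fps R,
   [/\ H n = fcst kap * (pois (K + theta * ln n%:R) + dlt R * (pois (K + theta * ln n%:R) * D)) + Er,
       nle D CD & nle Er (kap * (CN * n%:R `^ (- (g / 2))))]].
Proof.
have [C1 C10 hC1] := rise_poisson.
have [C2 C20 hC2] := Lam_log.
have [C3 C30 hC3] := H_approx theta0 g0 g1 M0 hbet H0 Hrec.
pose V := M * 2 * (1 + (g / 2)^-1).
pose C4 := (C2 + 1) * expR (2 * (C2 + 1)).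
have C40 : 0 < C4 by rewrite mulr_gt0 ?addr_gt0 // expR_gt0.
exists (C4 + C1 + 2 * (C4 * C1)), (C3 * expR V); split.
- by rewrite !addr_gt0 // mulr_gt0 // mulr_gt0.
- by rewrite mulr_gt0 // expR_gt0.
move=> n n0 nN; pose kap := alpha theta n * expR (Ksum bet n).
have an0 := alpha_gt0 theta0 n.
exists kap; split; first by rewrite mulr_gt0 ?expR_gt0.
set lam := K + _.
have [D hD nD] := hC1 n.
have [|d hd nd] := @pois_shift R (Lam n + Ksum bet n - lam) (C2 + 1).
  have -> : Lam n + Ksum bet n - lam = (Lam n - theta * ln n%:R) + (Ksum bet n - K).
    by rewrite /lam; ring.
  by rewrite (le_trans (ler_normD _ _)) // lerD ?hC2 ?hK.
exists (d + D + dlt R * (d * D)), (H n - rise theta n * expu (Ksum bet n)); split.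
- have -> : rise theta n * expu (Ksum bet n) = fcst kap * (pois lam * (1 + dlt R * d) * (1 + dlt R * D)).
    rewrite -hd poisD hD expu_pois /kap fcstM.
    have -> : lam + (Lam n + Ksum bet n - lam) = Lam n + Ksum bet n by ring.
    rewrite -poisD; ring.
  ring.
- apply: nleD; first exact: nleD.
  by apply: nleM; [exact: nle_dlt | exact: nleM].
(* The error is relative to alpha_n, whereas [kap] has the further factor exp (Ksum n) >= exp (- V);
   the exp V in the constant makes up for it. *)
- apply: nle_le (hC3 n n0).
  have -> : kap * (C3 * expR V * n%:R `^ (- (g / 2))) =
    C3 * alpha theta n * n%:R `^ (- (g / 2)) * (expR (Ksum bet n) * expR V).
    by rewrite /kap; ring.
  rewrite ler_peMr ?mulr_ge0 ?powR_ge0 ?(ltW C30) ?(ltW an0) //.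
  rewrite -expRD -expR0 ler_expR; have := Ksum_le theta0 g0 g1 M0 hbet n.
  by rewrite -/V ler_norml => /andP[h _]; rewrite -lerBlDr sub0r.
Qed.

(** [eta] is the total mass of [H n]. The product by x - 1 has no mass, so [eta] differs from [kap]
    only by the error term, and dividing by one or the other makes a relative difference O(1 / log
    n). *)
Lemma poisson_bound : exists C : R, exists n1 : nat, 0 < C /\
  forall n, (n1 <= n)%N -> (1 < n)%N -> forall eta : R,
    (forall i, (n <= i)%N -> csum (H n) i = eta) ->
    sle (fcst eta^-1 * H n - pois (K + theta * ln n%:R)) (C / ln n%:R) /\
    kle (fcst eta^-1 * H n - pois (K + theta * ln n%:R)) (C / Num.sqrt (ln n%:R)).
Proof.
have [CD [CN [CD0 CN0 hP]]] := H_poisson.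
pose del := g / 2; have del_0 : 0 < del by rewrite divr_gt0.
pose C := 4 * (CN / del) + 8 * expR 1 ^+ 2 * CD * (2 / theta) + 2 * (expR 1 * CD) * Num.sqrt (2 / theta).
have e10 : 0 < expR 1 :> R by exact: expR_gt0.
have c10 : 0 < 4 * (CN / del) by rewrite mulr_gt0 // divr_gt0.
have c20 : 0 < 8 * expR 1 ^+ 2 * CD * (2 / theta).
  by rewrite mulr_gt0 ?divr_gt0 // mulr_gt0 // mulr_gt0 // exprn_gt0.
have c30 : 0 < 2 * (expR 1 * CD) * Num.sqrt (2 / theta).
  by rewrite mulr_gt0 ?sqrtr_gt0 ?divr_gt0 // mulr_gt0 // mulr_gt0.
have C0 : 0 < C by rewrite addr_gt0 // addr_gt0.
(* From ln n >= L one gets ln n >= 1, a Poisson parameter of at least (theta / 2) ln n, and a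
   relative error [nu] of at most 1 / 2. *)
pose L := 1 + 2 * `|K| / theta + 2 * (CN / del).
pose n1 := maxn N1 (Num.bound (expR L)).
exists C, n1; split => // n nn1 n2 eta heta.
have n0 : (0 < n)%N by apply: ltnW.
have nr : 0 < n%:R :> R by rewrite ltr0n.
have nN : (N1 <= n)%N by apply: leq_trans nn1; exact: leq_maxl.
pose ll : R := ln n%:R.
have LL : L <= ll.
  rewrite -[L]expRK ler_ln ?posrE ?expR_gt0 //.
  rewrite (le_trans (ltW (archi_boundP (expR_ge0 L)))) // ler_nat.
  by apply: leq_trans nn1; exact: leq_maxr.
have K0 : 0 <= 2 * `|K| / theta by rewrite divr_ge0 ?mulr_ge0 // ltW.
have CND : 0 < CN / del by rewrite divr_gt0.
have ll1 : 1 <= ll by move: LL; rewrite /L; lra.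
have ll0 : 0 < ll by apply: lt_le_trans ll1.
have llK : 2 * `|K| / theta <= ll by move: LL; rewrite /L; lra.
have llC : 2 * (CN / del) <= ll by move: LL; rewrite /L; lra.
set lam := K + theta * ln n%:R.
have lam1 : theta / 2 * ll <= lam.
  move: llK; rewrite ler_pdivrMr // => h.
  have := ler_norm (- K); rewrite normrN /lam -/ll; lra.
have lam0 : 0 < lam by apply: lt_le_trans lam1; rewrite mulr_gt0 // divr_gt0.
pose nu := CN * n%:R `^ (- del).
have nu0 : 0 <= nu by rewrite mulr_ge0 ?powR_ge0 // ltW.
have nu1 : nu <= CN / del / ll.
  rewrite /nu -mulrA ler_wpM2l ?(ltW CN0) // powRN -invfM lef_pV2 ?posrE ?powR_gt0 ?mulr_gt0 //.
  rewrite /ll -ln_powR; apply: ltW; apply: ln_sublinear; exact: powR_gt0.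
have nu2 : nu <= 1 / 2 by apply: (le_trans nu1); rewrite ler_pdivrMr //; lra.
have [kap [kap0 [D [Er [hH nD nEr]]]]] := hP n n0 nN.
rewrite -/lam -/del -/nu in hH nEr.
have E1 : nle (pois lam) 1 by apply: nle_pois1; exact: ltW.
(* The partial sum is evaluated at a single index i beyond n, at which the Poisson distribution
   function is nearly 1 and the term left by [csum_dlt] nearly 0. *)
have etak : `|eta - kap| <= kap * nu.
  apply/ler_addgt0Pr => e e0.
  have e'0 : 0 < e / (2 * kap) by rewrite divr_gt0 // mulr_gt0.
  have [m hm] := csum_pois_cvg (ltW lam0) e'0.
  have [i im hi] := nle_small (maxn m n) (nleM E1 nD) e'0.
  have mi : (m <= i)%N by apply: leq_trans im; exact: leq_maxl.
  have ni : (n <= i)%N by apply: leq_trans im; exact: leq_maxr.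
  have := heta i ni; rewrite hH csumD csumZ csumD csum_dlt => <-.
  have c1 := csum_pois_le1 i (ltW lam0); have c2 := hm i mi.
  have c3 := nle_kle nEr i.
  have -> : kap * (csum (pois lam) i + - (pois lam * D) i) + csum Er i - kap =
     kap * (csum (pois lam) i - 1 - (pois lam * D) i) + csum Er i by ring.
  rewrite (le_trans (ler_normD _ _)) // addrC lerD // normrM (gtr0_norm kap0).
  rewrite -ler_pdivlMl // (le_trans (ler_normB _ _)) //.
  have -> : kap^-1 * e = e / (2 * kap) + e / (2 * kap).
    by field; exact: lt0r_neq0.
  apply: lerD hi; rewrite ler0_norm ?subr_le0 // opprB lerBlDr -lerBlDl //.
have eta2 : kap / 2 <= eta.
  move: etak; rewrite ler_norml => /andP[h _].
  have : kap * nu <= kap * (1 / 2) by rewrite ler_wpM2l // ltW.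
  lra.
have eta0 : 0 < eta by apply: lt_le_trans eta2; rewrite divr_gt0.
have etaV : `|eta^-1| <= 2 / kap.
  rewrite ger0_norm ?invr_ge0 ?(ltW eta0) // -[2 / kap]invrK invf_div.
  by rewrite lef_pV2 ?posrE // divr_gt0.
(* Three sources of error: the normalization, the factor 1 + (x - 1) D, and the remainder of
   [H_approx]. The middle one determines the orders 1 / log n and 1 / sqrt (log n). *)
have DE : fcst eta^-1 * H n - pois lam = fcst eta^-1 * (fcst (kap - eta) * pois lam + fcst kap * (dlt R * (pois lam * D)) + Er).
  have e1 : fcst eta^-1 * fcst eta = 1 :> fps R by rewrite -fcstM mulVf ?fcst1 // lt0r_neq0.
  have -> : fcst (kap - eta) = fcst kap - fcst eta :> fps R by rewrite fcstD fcstN.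
  rewrite hH -[X in _ - X]mul1r -e1; ring.
rewrite DE.
have kn : `|kap - eta| <= kap * nu by rewrite distrC.
have h1 : `|kap - eta| * 1 <= kap * nu by rewrite mulr1.
have kapE : `|kap| = kap by rewrite gtr0_norm.
have scale (X Y : R) : 0 <= X -> X <= kap * Y -> `|eta^-1| * X <= 2 * Y.
  move=> X0 XY; apply: (le_trans (ler_wpM2r X0 etaV)).
  apply: (le_trans (ler_wpM2l _ XY)); first by rewrite divr_ge0 // ltW.
  by rewrite le_eqVlt; apply/orP; left; apply/eqP; field; exact: lt0r_neq0.
split.
- have s1 : sle (fcst (kap - eta) * pois lam) (kap * nu).
    by move=> i; apply: le_trans h1; have := sleZ (kap - eta) (nle_sle E1) i.
  have s2 : sle (fcst kap * (dlt R * (pois lam * D))) (kap * (4 * expR 1 ^+ 2 / lam * CD)).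
    by rewrite -{2}kapE; apply: sleZ; rewrite mulrA; apply: sleM nD; exact: sle_dlt_pois.
  have s3 := nle_sle nEr.
  have s := sleZ eta^-1 (sleD (sleD s1 s2) s3).
  move=> i; apply: (le_trans (s i)).
  apply: (@le_trans _ _ (2 * (nu + 4 * expR 1 ^+ 2 / lam * CD + nu))).
    by apply: scale; [exact: sle_ge0 (sleD (sleD s1 s2) s3) | rewrite !mulrDr].
  have hl : lam^-1 <= 2 / theta / ll.
    rewrite -[2 / theta / ll]invrK lef_pV2 ?posrE ?invr_gt0 ?divr_gt0 //.
    by rewrite invfM invf_div invrK.
  have h2 : 4 * expR 1 ^+ 2 / lam * CD <= 4 * expR 1 ^+ 2 * (2 / theta / ll) * CD.
    by rewrite ler_wpM2r ?(ltW CD0) // ler_wpM2l // mulr_ge0 // exprn_ge0 // ltW.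
  have h3 : 2 * (CN / del / ll + 4 * expR 1 ^+ 2 * (2 / theta / ll) * CD + CN / del / ll) =
     (4 * (CN / del) + 8 * expR 1 ^+ 2 * CD * (2 / theta)) / ll by ring.
  apply: (@le_trans _ _ ((4 * (CN / del) + 8 * expR 1 ^+ 2 * CD * (2 / theta)) / ll)).
    by rewrite -h3 ler_pM2l // !lerD.
  by rewrite ler_pM2r ?invr_gt0 // /C lerDl ltW.
have s1 : kle (fcst (kap - eta) * pois lam) (kap * nu).
  by move=> i; apply: le_trans h1; have := kleZ (kap - eta) (nle_kle E1) i.
have s2 : kle (fcst kap * (dlt R * (pois lam * D))) (kap * (expR 1 / Num.sqrt lam * CD)).
  by rewrite -{2}kapE; apply: kleZ; apply: kle_dlt; apply: sleM nD; exact: sle_pois.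
have s3 := nle_kle nEr.
have s := kleZ eta^-1 (kleD (kleD s1 s2) s3).
move=> i; apply: (le_trans (s i)).
apply: (@le_trans _ _ (2 * (nu + expR 1 / Num.sqrt lam * CD + nu))).
  apply: scale; last by rewrite !mulrDr.
  by apply: le_trans (kleD (kleD s1 s2) s3 0%N).
have sl0 : 0 < Num.sqrt ll by rewrite sqrtr_gt0.
have slam0 : 0 < Num.sqrt lam by rewrite sqrtr_gt0.
have hl : (Num.sqrt lam)^-1 <= Num.sqrt (2 / theta) / Num.sqrt ll.
  rewrite -[X in _ <= X]invrK lef_pV2 ?posrE ?invr_gt0 ?divr_gt0 ?sqrtr_gt0 ?divr_gt0 //.
  rewrite invf_div -(sqrtrV _) ?divr_ge0 ?(ltW theta0) // invf_div -sqrtrM ?(ltW ll0) //.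
  by rewrite ler_sqrt ?(ltW lam0) // mulrC.
have ls : ll^-1 <= (Num.sqrt ll)^-1.
  rewrite lef_pV2 ?posrE // -[X in _ <= X](sqr_sqrtr (ltW ll0)) expr2 ler_peMl ?(ltW sl0) //.
  by rewrite -[X in X <= _]sqrtr1 ler_sqrt // ltW.
have nu3 : nu <= CN / del / Num.sqrt ll.
  by apply: (le_trans nu1); rewrite ler_wpM2l // ltW.
have h2 : expR 1 / Num.sqrt lam * CD <= expR 1 * (Num.sqrt (2 / theta) / Num.sqrt ll) * CD.
  by rewrite ler_wpM2r ?(ltW CD0) // ler_wpM2l // ltW.
apply: (@le_trans _ _ ((4 * (CN / del) + 2 * (expR 1 * CD) * Num.sqrt (2 / theta)) / Num.sqrt ll)).
  have -> : (4 * (CN / del) + 2 * (expR 1 * CD) * Num.sqrt (2 / theta)) / Num.sqrt ll =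
    2 * (CN / del / Num.sqrt ll + expR 1 * (Num.sqrt (2 / theta) / Num.sqrt ll) * CD + CN / del / Num.sqrt ll).
    ring.
  by rewrite ler_pM2l // !lerD.
rewrite ler_pM2r ?invr_gt0 // /C; lra.
Qed.

End MainTerm.

(** * Cycle sums over permutations *)

Section CycleSums.
Variable S : comNzRingType.
Variable w : nat -> S.

Lemma porbit_agree (T : finType) (A : {set T}) (s t : {perm T}) y :
  (forall z, z \in A -> t z \in A) -> {in A, s =1 t} -> y \in A -> porbit s y = porbit t y.
Proof.
move=> st eqst yA.
have h i : (s ^+ i)%g y = (t ^+ i)%g y /\ (t ^+ i)%g y \in A.
  elim: i => [|i [IH IA]]; first by rewrite !expg0 perm1.
  by rewrite !expgSr !permM IH eqst //; split => //; apply: st.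
by apply/setP => z; apply/porbitP/porbitP => -[i ->]; exists i; have [] := h i.
Qed.

(** Permutations of [D] are taken as permutations of the ambient type supported in [D], so that
    removing a cycle needs no relabelling; the orbits of points of [D] include its fixed points. *)
Definition cycle_sum (T : finType) (D : {set T}) : S :=
  \sum_(s : {perm T} | perm_on D s) \prod_(c in [set porbit s y | y in D]%SET) w #|c|.

(** For x in [A], the cyclic permutations of the whole of [A]. *)
Definition full_cycles (T : finType) (x : T) (A : {set T}) : {set {perm T}} :=
  [set s | perm_on A s & porbit s x == A].

Section Product.
Variables (T : finType) (x : T) (A D : {set T}) (c t : {perm T}).
Hypotheses (xA : x \in A) (AD : A \subset D) (cA : perm_on A c) (cx : porbit c x = A)
  (tD : perm_on (D :\: A) t).

Lemma glue_on : perm_on D (c * t)%g.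
Proof.
apply: perm_onM; first exact: fintype.subset_trans cA AD.
by apply: fintype.subset_trans tD _; exact: finset.subsetDl.
Qed.

Lemma glue_in y : y \in A -> (c * t)%g y = c y.
Proof.
move=> yA; rewrite permM (out_perm tD) // inE negb_and negbK.
by rewrite (perm_closed _ cA) yA.
Qed.

Lemma glue_out y : y \notin A -> (c * t)%g y = t y.
Proof. by move=> yA; rewrite permM (out_perm cA). Qed.

Lemma glue_porbit_in y : y \in A -> porbit (c * t)%g y = A.
Proof.
move=> yA; rewrite (@porbit_agree _ A _ c) //.
- by rewrite -[RHS]cx; apply/eqP; rewrite eq_porbit_mem cx.
- by move=> z zA; rewrite (perm_closed _ cA).
- by move=> z; exact: glue_in.
Qed.

Lemma glue_porbit_out y : y \in D :\: A -> porbit (c * t)%g y = porbit t y.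
Proof.
move=> yA; rewrite (@porbit_agree _ (D :\: A) _ t) //.
- by move=> z zA; rewrite (perm_closed _ tD).
- by move=> z /setDP[_ zA]; exact: glue_out.
Qed.

Lemma glue_prod :
  \prod_(b in [set porbit (c * t)%g y | y in D]%SET) w #|b| =
  w #|A| * \prod_(b in [set porbit t y | y in D :\: A]%SET) w #|b|.
Proof.
have -> : [set porbit (c * t)%g y | y in D]%SET = A |: [set porbit t y | y in D :\: A]%SET.
  apply/setP => b; rewrite in_setU1; apply/imsetP/orP.
    move=> [y yD ->]; have [yA|yA] := boolP (y \in A).
      by left; rewrite glue_porbit_in.
    right; apply/imsetP; exists y; first by rewrite inE yA.
    by rewrite glue_porbit_out // inE yA.
  move=> [/eqP ->|/imsetP[y yD ->]].
    by exists x; [exact: (fintype.subsetP AD) | rewrite glue_porbit_in].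
  by exists y; [by have /setDP[] := yD | rewrite glue_porbit_out].
rewrite big_setU1 //=; apply/imsetP => -[y /setDP[_ /negP yA] e].
by apply: yA; rewrite e porbit_id.
Qed.

End Product.

Lemma restr_perm_glue (T : finType) (x : T) (A : {set T}) (s : {perm T}) :
  porbit s x = A -> {in A, restr_perm A s =1 s} /\ perm_on A (restr_perm A s).
Proof.
move=> sx; split; last exact: restr_perm_on.
move=> y yA; apply: restr_permE => //; apply/astabsP => z /=.
rewrite -sx -!eq_porbit_mem; have -> : aperm z s = (s ^+ 1)%g z by rewrite expg1.
by rewrite porbit_perm.
Qed.

(** The permutations are grouped by the support A of the cycle through x; once A is fixed, that
    cycle and the permutation of the remaining points are chosen independently. *)
Lemma cycle_sum_rec (T : finType) (D : {set T}) (x : T) : x \in D ->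
  cycle_sum D = \sum_(A : {set T} | (A \subset D) && (x \in A))
     w #|A| * cycle_sum (D :\: A) *+ #|full_cycles x A|.
Proof.
move=> xD; rewrite /cycle_sum.
rewrite (partition_big (fun s : {perm T} => porbit s x)
  (fun A : {set T} => (A \subset D) && (x \in A))) /=; last first.
  move=> s sD; rewrite porbit_id andbT; apply/fintype.subsetP => y /porbitP[i ->].
  by elim: i => [|i IH]; rewrite ?expg0 ?perm1 // expgSr permM (perm_closed _ sD).
apply: eq_bigr => A /andP[AD xA].
pose h (p : {perm T} * {perm T}) := (p.1 * p.2)%g.
pose h' s : {perm T} * {perm T} := (restr_perm A s, (restr_perm A s)^-1 * s)%g.
(* A permutation corresponds to the pair of its restriction to A and the permutation left when that
   cycle is undone. *)
rewrite (reindex_onto h h') /=; last by move=> s _; rewrite /h /= mulKVg.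
rewrite (eq_bigl (fun p : {perm T} * {perm T} =>
   (p.1 \in full_cycles x A) && perm_on (D :\: A) p.2)); last first.
  move=> [c t]; rewrite /h /= inE; apply/idP/idP.
    move=> /andP[/andP[sD /eqP sx] /eqP [e1 e2]].
    have [r1 r2] := restr_perm_glue sx; rewrite e1 in r1 r2.
    have cx : porbit c x == A.
      rewrite -sx; apply/eqP; apply: esym; apply: (@porbit_agree _ A) => // z zA.
        by rewrite (perm_closed _ r2).
      by rewrite r1.
    rewrite r2 cx /=; apply/fintype.subsetP => y; rewrite !inE => ty.
    have yA : y \notin A.
      apply: contra ty => yA.
      have : c (c^-1%g y) = (c * t)%g (c^-1%g y).
        by apply: r1; rewrite (perm_closed _ (perm_onV r2)).
      by rewrite permM permKV => <-.
    rewrite yA /=; apply: contraNT ty => yD.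
    by have := out_perm sD yD; rewrite permM (out_perm r2 yA) => ->.
  move=> /andP[/andP[cA /eqP cx] tD].
  rewrite (glue_on AD cA tD) /= (glue_porbit_in cA cx tD xA) eqxx /=.
  have sx := glue_porbit_in cA cx tD xA.
  have [r1 r2] := restr_perm_glue sx.
  suff e : restr_perm A (c * t)%g = c by rewrite /h' e mulKg.
  apply/permP => y; have [yA|yA] := boolP (y \in A).
    by rewrite r1 // (glue_in cA tD yA).
  by rewrite (out_perm r2) // (out_perm cA).
rewrite -(pair_big (mem (full_cycles x A)) (perm_on (D :\: A))
   (fun c t => \prod_(b in [set porbit (h (c, t)) y | y in D]%SET) w #|b|)) /=.
rewrite -sumr_const; apply: eq_bigr => c; rewrite inE => /andP[cA /eqP cx].
rewrite mulr_sumr; apply: eq_bigr => t tD; exact: (glue_prod xA AD cA cx tD).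
Qed.

End CycleSums.

Section CycleCount.

Lemma sum_subsets_card (S : nmodType) (T : finType) (D : {set T}) (x : T) m (f : nat -> S) :
  x \in D -> #|D| = m.+1 ->
  \sum_(A : {set T} | (A \subset D) && (x \in A)) f #|A| = \sum_(k < m.+1) f k.+1 *+ 'C(m, k).
Proof.
move=> xD cD; have cDx : #|D :\ x| = m by have := cardsD1 x D; rewrite xD cD => -[].
rewrite (reindex_onto (fun B : {set T} => x |: B) (fun A : {set T} => A :\ x)) /=; last first.
  by move=> A /andP[_ xA]; rewrite finset.setD1K.
rewrite (eq_bigl (fun B : {set T} => B \subset D :\ x)); last first.
  move=> B; rewrite setU11 andbT finset.subUset finset.sub1set xD /= finset.subsetD1.
  congr (_ && _); apply/eqP/idP => [<-|xB]; first by rewrite !inE eqxx.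
  by rewrite setU1K.
rewrite (partition_big (fun B : {set T} => inord #|B| : 'I_m.+1) xpredT) //=.
apply: eq_bigr => k _.
rewrite (eq_bigl (fun B => B \in [set B : {set T} | B \subset D :\ x & #|B| == k]%SET)); last first.
  move=> B; rewrite !inE; have [BD|//] := boolP (B \subset _) => /=.
  by rewrite -val_eqE /= inordK // ltnS -cDx; exact: subset_leq_card.
have -> : 'C(m, k) = 'C(#|D :\ x|, k) by rewrite cDx.
rewrite -cards_draws -sumr_const; apply: eq_bigr => B.
rewrite inE finset.subsetD1 => /andP[/andP[_ xB] /eqP kB].
by rewrite cardsU1 xB kB.
Qed.

(** Counting all permutations by [cycle_sum_rec] with unit weights gives a sum over A that remains
    correct when every count is replaced by (|A| - 1)!. By induction the terms of proper subsets
    agree, so the terms of [D] agree as well. *)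
Lemma card_full_cycles (T : finType) (D : {set T}) (x : T) : x \in D ->
  #|full_cycles x D| = (#|D|.-1)`!%N.
Proof.
have [m] := ubnP #|D|; elim: m D => // m IH D; rewrite ltnS => Dm xD.
have cs (D' : {set T}) : cycle_sum (fun _ => 1 : int) D' = (#|D'|)`!%:R.
  rewrite /cycle_sum -card_perm -sumr_const; apply: eq_big => s //.
  by move=> _; rewrite big1.
have [d cD] : exists d, #|D| = d.+1 by exists #|D|.-1; rewrite (cardD1 x) xD.
have cDA (A : {set T}) : A \subset D -> #|D :\: A| = (d.+1 - #|A|)%N.
  by move=> AD; rewrite cardsD (finset.setIidPr AD) cD.
pose F (a : {set T} -> nat) : int :=
  \sum_(A : {set T} | (A \subset D) && (x \in A)) (a A * (d.+1 - #|A|)`!)%N%:R.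
have e1 : F (fun A => #|full_cycles x A|) = (d.+1)`!%:R.
  rewrite -cD -cs (cycle_sum_rec _ xD); apply: eq_bigr => A /andP[AD _].
  by rewrite mul1r cs cDA // -mulrnA mulnC.
have e2 : F (fun A => (#|A|.-1)`!%N) = (d.+1)`!%:R.
  rewrite /F (@sum_subsets_card _ _ _ x d (fun k => (k.-1`! * (d.+1 - k)`!)%N%:R)) //.
  rewrite (eq_bigr (fun=> d`!%:R)) => [|k _].
    by rewrite sumr_const card_ord -mulrnA factS mulnC.
  by rewrite -mulrnA subSS mulnC bin_fact // -ltnS.
move: e1; rewrite -e2 /F (bigD1 D) ?subxx ?xD //= [RHS](bigD1 D) ?subxx ?xD //=.
rewrite (eq_bigr (fun A : {set T} => (#|A|.-1`! * (d.+1 - #|A|)`!)%N%:R)).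
  by move/addIr/eqP; rewrite cD subnn fact0 !muln1 eqr_nat => /eqP.
move=> A /andP[/andP[AD xA] nA]; rewrite IH //.
by apply: leq_trans Dm; apply: proper_card; rewrite finset.properEneq nA.
Qed.

End CycleCount.

Section CycleSumOrd.
Variable S : comNzRingType.
Variable w : nat -> S.

Definition cycle_poly n : S := cycle_sum w [set: 'I_n]%SET.

Lemma cycle_sum0 (T : finType) : cycle_sum w (finset.set0 : {set T}) = 1.
Proof.
rewrite /cycle_sum (big_pred1 (1%g : {perm T})) => [|s].
  by rewrite imset0 big_set0.
apply/idP/eqP => [h|->]; last exact: perm_on1.
by apply: (perm_on_id h); rewrite cards0.
Qed.

(** [G] is the value on smaller sets, supposed to depend on their size only. The same step then
    proves this dependence by induction and yields the recurrence [cycle_polyS]. *)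
Lemma cycle_sum_step (G : nat -> S) (T : finType) (D : {set T}) m :
  (forall A : {set T}, (#|A| <= m)%N -> cycle_sum w A = G #|A|) -> #|D| = m.+1 ->
  cycle_sum w D = \sum_(k < m.+1) w k.+1 * G (m - k)%N *+ (k`! * 'C(m, k)).
Proof.
move=> hG cD; have /card_gt0P[x xD] : (0 < #|D|)%N by rewrite cD.
rewrite (cycle_sum_rec _ xD).
under eq_bigr => A /andP[AD xA].
  have cA := cardsD1 x A; rewrite xA in cA.
  have cDA : #|D :\: A| = (m.+1 - #|A|)%N by rewrite cardsD (finset.setIidPr AD) cD.
  rewrite hG ?card_full_cycles // ?cDA; last by rewrite cA add1n subSS leq_subr.
over.
rewrite (@sum_subsets_card _ _ _ x m (fun k => w k * G (m.+1 - k)%N *+ (k.-1)`!)) //.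
by apply: eq_bigr => k _; rewrite -mulrnA subSS.
Qed.

Lemma cycle_sum_card (T : finType) (D : {set T}) : cycle_sum w D = cycle_poly #|D|.
Proof.
have [m] := ubnP #|D|; elim: m T D => // m IH T D; rewrite ltnS.
case cD : #|D| => [|d] dm.
  rewrite (cards0_eq cD) cycle_sum0 /cycle_poly.
  suff -> : [set: 'I_0]%SET = finset.set0 by rewrite cycle_sum0.
  by apply/setP => -[].
rewrite /cycle_poly (@cycle_sum_step cycle_poly _ D d) //; last first.
  by move=> A Ad; apply: IH; apply: leq_ltn_trans dm.
rewrite (@cycle_sum_step cycle_poly _ _ d) // ?cardsT ?card_ord //.
by move=> A Ad; apply: IH; apply: leq_ltn_trans dm.
Qed.

Lemma cycle_poly0 : cycle_poly 0 = 1.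
Proof.
by rewrite /cycle_poly -(cycle_sum0 'I_0); congr cycle_sum; apply/setP => -[].
Qed.

Lemma cycle_polyS n :
  cycle_poly n.+1 = \sum_(k < n.+1) w k.+1 * cycle_poly (n - k)%N *+ (k`! * 'C(n, k)).
Proof.
apply: cycle_sum_step; last by rewrite cardsT card_ord.
by move=> A _; exact: cycle_sum_card.
Qed.

Lemma prod_porbits n (s : 'S_n) :
  \prod_(c in porbits s) w #|c| = \prod_(1 <= m < n.+1) w m ^+ Ccycles m s.
Proof.
have C0 : Ccycles 0 s = 0%N.
  apply/eqP; rewrite cards_eq0; apply/eqP/setP => c; rewrite !inE; apply/andP => -[].
  by move=> /imsetP[y _ ->]; rewrite (negbTE (card_porbit_neq0 s y)).
have -> : \prod_(1 <= m < n.+1) w m ^+ Ccycles m s = \prod_(m < n.+1) w m ^+ Ccycles m s.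
  by rewrite -(big_mkord xpredT (fun m => w m ^+ Ccycles m s)) [RHS]big_ltn // C0 expr0 mul1r.
rewrite (partition_big (fun c : {set 'I_n} => inord #|c| : 'I_n.+1) xpredT) //=.
apply: eq_bigr => m _; rewrite -prodr_const.
apply: eq_big => [c|c /andP[_ /eqP <-]].
  rewrite [RHS]inE; congr (_ && _); rewrite -val_eqE /= inordK // ltnS.
  by rewrite -[X in (_ <= X)%N](card_ord n); exact: max_card.
by rewrite inordK // ltnS -[X in (_ <= X)%N](card_ord n); exact: max_card.
Qed.

Lemma cycle_polyE n : cycle_poly n =
  \sum_(s : 'S_n) \prod_(1 <= m < n.+1) w m ^+ Ccycles m s.
Proof.
rewrite /cycle_poly /cycle_sum; apply: eq_big => [s|s _].
  by rewrite /perm_on; apply/fintype.subsetP => y; rewrite inE.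
rewrite -prod_porbits; apply: eq_bigl => c.
by apply/imsetP/imsetP => -[y _ ->]; exists y.
Qed.

End CycleSumOrd.

(** * The distances to the Poisson law *)

Section GeneratingFunction.
Variable R : realType.
Variables (Theta : nat -> R) (r : R).

Lemma fXnE k i : (fX R ^+ k) i = (i == k)%:R.
Proof.
elim: k i => [|k IH] i; first by rewrite expr0 f1E.
by rewrite exprS fXE; case: i => [|i] //; rewrite IH.
Qed.

(** Read off from [prod_porbits] with every weight equal to x, by comparing exponents. *)
Lemma K0_card n (s : 'S_n) : K0 s = #|porbits s|.
Proof.
have := prod_porbits (fun=> fX R) s; rewrite prodrXr prodr_const.
move=> /(congr1 (fun a : fps R => a #|porbits s|)); rewrite !fXnE eqxx.
by case: eqP => // _ /eqP; rewrite oner_eq0.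
Qed.

Lemma K0_le n (s : 'S_n) : (K0 s <= n)%N.
Proof. by rewrite K0_card; apply: leq_trans (leq_imset_card _ _) _; rewrite card_ord. Qed.

Definition Hgen n : fps R :=
  fcst (r ^+ n / n`!%:R) * cycle_poly (fun m => fcst (Theta m) * fX R) n.

Lemma Hgen0 : Hgen 0 = 1.
Proof. by rewrite /Hgen cycle_poly0 expr0 fact0 divr1 fcst1 mulr1. Qed.

(** k! 'C(n, k) = n! / (n - k)! makes the cycle recurrence a convolution, and theta + k beta_k is
    Theta_k r^k whatever theta is. *)
Lemma Hgen_rec theta n : n.+1%:R * Hgen n.+1 =
  \sum_(k < n.+1) fX R * fcst (theta + k.+1%:R * beta Theta r theta k.+1) * Hgen (n - k)%N.
Proof.
rewrite /Hgen cycle_polyS mulrA -fcst_nat -fcstM mulr_sumr; apply: eq_bigr => k _.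
have kn : (k <= n)%N by rewrite -ltnS.
have -> : theta + k.+1%:R * beta Theta r theta k.+1 = Theta k.+1 * r ^+ k.+1.
  by rewrite /beta; field.
have f0 m : m`!%:R != 0 :> R by rewrite pnatr_eq0 -lt0n fact_gt0.
have -> : n.+1%:R * (r ^+ n.+1 / n.+1`!%:R) = r ^+ n.+1 / n`!%:R :> R.
  have n0 : n.+1%:R != 0 :> R by rewrite pnatr_eq0.
  by rewrite factS natrM invfM mulrCA (mulrA _ n.+1%:R^-1) mulfV // mul1r.
rewrite -[_ *+ (_ * _)]mulr_natr -(fcst_nat _ (_ * _)).
have -> : (k`! * 'C(n, k))%N%:R = n`!%:R / (n - k)`!%:R :> R.
  by rewrite -(bin_fact kn) !natrM; field; rewrite f0.
have -> : r ^+ n.+1 = r ^+ k.+1 * r ^+ (n - k) by rewrite -exprD addSn subnKC.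
set P := cycle_poly _ _.
rewrite [LHS](_ : _ = fcst (r ^+ k.+1 * r ^+ (n - k) / n`!%:R) * fcst (Theta k.+1) *
  fcst (n`!%:R / (n - k)`!%:R) * (fX R * P)); last by ring.
rewrite [RHS](_ : _ = fcst (Theta k.+1 * r ^+ k.+1) * fcst (r ^+ (n - k) / (n - k)`!%:R) *
  (fX R * P)); last by ring.
by rewrite -!fcstM; congr (fcst _ * _); field; rewrite !f0.
Qed.

Lemma HgenE n j : Hgen n j = r ^+ n / n`!%:R * \sum_(s : 'S_n | K0 s == j) weight Theta s.
Proof.
rewrite /Hgen fcstE cycle_polyE fsumE; congr (_ * _); rewrite [RHS]big_mkcond.
apply: eq_bigr => s _; under eq_bigr do rewrite exprMn.
rewrite big_split prodrXr /=.
have -> : \prod_(1 <= m < n.+1) fcst (Theta m) ^+ Ccycles m s = fcst (weight Theta s).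
  rewrite /weight; elim/big_rec2: _ => [|m a b _ ->]; first by rewrite fcst1.
  rewrite fcstM; congr (_ * _); elim: (Ccycles _ _) => [|c IH]; first by rewrite !expr0 fcst1.
  by rewrite !exprS fcstM IH.
rewrite fcstE fXnE -/(K0 s) eq_sym.
by case: eqP => _; rewrite ?mulr1 ?mulr0.
Qed.

Lemma csum_Hgen n j :
  csum (Hgen n) j = r ^+ n / n`!%:R * \sum_(s : 'S_n | (K0 s <= j)%N) weight Theta s.
Proof.
rewrite /csum; under eq_bigr do rewrite HgenE.
rewrite -mulr_sumr; congr (_ * _).
rewrite [RHS](partition_big (fun s : 'S_n => inord (K0 s) : 'I_j.+1) xpredT) //=.
apply: eq_bigr => i _; apply: eq_bigl => s; apply/idP/idP.
  by move=> /eqP ->; rewrite -ltnS ltn_ord /=; apply/eqP/val_inj; rewrite /= inordK.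
by move=> /andP[h /eqP <-]; rewrite inordK.
Qed.

Hypothesis r0 : 0 < r.

Lemma csum_Hgen_total n j : (n <= j)%N -> csum (Hgen n) j = r ^+ n * hTheta Theta n.
Proof.
move=> nj; rewrite csum_Hgen /hTheta mulrA; congr (_ * _); apply: eq_bigl => s.
by rewrite (leq_trans (K0_le s)).
Qed.

Lemma PTheta_sum n (A : set 'S_n) :
  PTheta Theta A = (r ^+ n * hTheta Theta n)^-1 *
    (r ^+ n / n`!%:R * \sum_(s : 'S_n | s \in A) weight Theta s).
Proof.
rewrite /PTheta -mulr_suml mulrA mulrC; congr (_ * _).
have rn : r ^+ n != 0 by rewrite expf_neq0 ?lt0r_neq0.
rewrite !invfM -[LHS]mul1r -(mulVf rn); ring.
Qed.

Lemma law_K0_point n j : law_K0 Theta n [set Posz j] =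
  (fcst (r ^+ n * hTheta Theta n)^-1 * Hgen n) j.
Proof.
rewrite fcstE HgenE /law_K0 /law PTheta_sum; do 2 congr (_ * _).
apply: eq_bigl => s; apply/idP/idP; first by rewrite inE => -[->].
by move=> /eqP <-; rewrite inE.
Qed.

Lemma law_K0_cdf n j : law_K0 Theta n [set k | k <= Posz j] =
  csum (fcst (r ^+ n * hTheta Theta n)^-1 * Hgen n) j.
Proof.
rewrite csumZ csum_Hgen /law_K0 /law PTheta_sum; do 2 congr (_ * _).
by apply: eq_bigl => s; apply/idP/idP; rewrite inE.
Qed.

Lemma law_poisson_point (lam : R) j : 0 < lam -> law_poisson lam [set Posz j] = pois lam j.
Proof.
move=> l0; rewrite /law_poisson /law /poisson_prob l0.
have -> : Posz @^-1` [set Posz j] = [set j] by apply/seteqP; split => x /= => [[->]|->].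
rewrite esum_set1 ?lee_fin ?poisson_pmf_ge0 //= /poisson_pmf l0 /pois; ring.
Qed.

Lemma law_poisson_cdf (lam : R) j : 0 < lam ->
  law_poisson lam [set k | k <= Posz j] = csum (pois lam) j.
Proof.
move=> l0; rewrite /law_poisson /law /poisson_prob l0.
have -> : Posz @^-1` [set k | k <= Posz j] = `I_j.+1 by apply/seteqP; split.
rewrite esum_fset //; last by move=> i _; rewrite lee_fin poisson_pmf_ge0.
rewrite -fsbig_ord sumEFin /= /csum; apply: eq_bigr => i _.
rewrite /poisson_pmf l0 /pois; ring.
Qed.

Lemma laws_neg n (lam : R) j (A : set int) : 0 < lam -> A `<=` [set k | k <= Negz j] ->
  law_K0 Theta n A = 0 /\ law_poisson lam A = 0.
Proof.
move=> l0 hA; split.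
  rewrite /law_K0 /law /PTheta big_pred0 // => s.
  by apply/negbTE/negP; rewrite inE => /hA.
rewrite /law_poisson /law /poisson_prob l0.
have -> : Posz @^-1` A = set0 by apply/seteqP; split => // x /= /hA.
by rewrite esum_set0.
Qed.

Lemma d_loc_le n (lam C : R) : 0 < lam ->
  sle (fcst (r ^+ n * hTheta Theta n)^-1 * Hgen n - pois lam) C ->
  d_loc (law_K0 Theta n) (law_poisson lam) <= C.
Proof.
move=> l0 h; apply: ge_sup; first by apply: image_nonempty; exists 0.
move=> _ [[j|j] _ <-]; first by rewrite law_K0_point law_poisson_point //; exact: h.
have [|-> ->] := @laws_neg n lam j [set Negz j] l0; first by move=> _ ->; exact: lexx.
by rewrite subrr normr0; exact: sle_ge0 h.
Qed.

Lemma d_K_le n (lam C : R) : 0 < lam ->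
  kle (fcst (r ^+ n * hTheta Theta n)^-1 * Hgen n - pois lam) C ->
  d_K (law_K0 Theta n) (law_poisson lam) <= C.
Proof.
move=> l0 h; apply: ge_sup; first by apply: image_nonempty; exists 0.
move=> _ [[j|j] _ <-].
  rewrite law_K0_cdf law_poisson_cdf //; have := h j.
  by rewrite csumD (_ : csum (- _) j = - csum (pois lam) j) // /csum sumrN.
have [|-> ->] := @laws_neg n lam j [set k | k <= Negz j] l0; first by [].
by rewrite subrr normr0; apply: le_trans (h 0%N).
Qed.

End GeneratingFunction.

(** The finitely many remaining n are absorbed into the constant; [P] stands for the positivity of
    the Poisson parameter. *)
Lemma bound_of_eventually (R : realType) (P : nat -> Prop) (d l : nat -> R) n1 (C : R) :
  0 < C -> (forall n, (1 < n)%N -> 0 < l n) ->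
  (forall n, (n1 <= n)%N -> (1 < n)%N -> P n -> d n <= C / l n) ->
  exists2 c : R, 0 < c & forall n, (1 < n)%N -> P n -> d n <= c / l n.
Proof.
move=> C0 l0 h; exists (C + \sum_(n < n1) `|d n * l n|).
  by rewrite ltr_pwDl // sumr_ge0.
move=> n n2 Pn; rewrite ler_pdivlMr ?l0 //; have [nn|nn] := leqP n1 n.
  have := h n nn n2 Pn; rewrite ler_pdivlMr ?l0 // => /le_trans; apply.
  by rewrite lerDl sumr_ge0.
apply: (le_trans (ler_norm _)); rewrite (bigD1 (Ordinal nn)) //= addrCA lerDl.
by rewrite addr_ge0 ?(ltW C0) // sumr_ge0.
Qed.

Lemma regular_beta_bound (R : realType) (Theta : nat -> R) (r theta K : R) :
  0 < theta -> 0 < r -> regular_beta Theta r theta K ->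
  exists c1 c2 : R, [/\ 0 < c1, 0 < c2 &
    forall n : nat, (2 <= n)%N -> 0 < K + theta * ln n%:R ->
      d_loc (law_K0 Theta n) (law_poisson (K + theta * ln n%:R)) <= c1 / ln n%:R /\
      d_K (law_K0 Theta n) (law_poisson (K + theta * ln n%:R)) <= c2 / Num.sqrt (ln n%:R)].
Proof.
move=> theta0 r0 [g [M [/andP[g0 g1] M0 hbet [N hK]]]].
have hKs n : (N <= n)%N -> `|Ksum (beta Theta r theta) n - K| <= 1.
  move=> /hK; suff -> : Ksum (beta Theta r theta) n = \sum_(1 <= k < n.+1) beta Theta r theta k by [].
  rewrite /Ksum -(big_mkord xpredT) big_ltn // add0r !big_nat.
  by apply: eq_bigr => -[].
have [C [n1 [C0 hC]]] := poisson_bound theta0 g0 g1 M0 hbet (Hgen0 Theta r)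
  (Hgen_rec Theta r theta) hKs.
have ln0 n : (1 < n)%N -> 0 < ln n%:R :> R by move=> n2; rewrite ln_gt0 // ltr1n.
have tot n i : (n <= i)%N -> csum (Hgen Theta r n) i = r ^+ n * hTheta Theta n.
  exact: csum_Hgen_total.
pose P n := 0 < K + theta * ln n%:R.
have [|c1 c10 hc1] := @bound_of_eventually R P
  (fun n => d_loc (law_K0 Theta n) (law_poisson (K + theta * ln n%:R))) (fun n => ln n%:R) n1 C C0 ln0.
    move=> n nn n2 Pn; have [h _] := hC n nn n2 _ (tot n); exact: (d_loc_le r0 Pn h).
have [m /ln0|m nn n2 Pn|c2 c20 hc2] := @bound_of_eventually R P
  (fun n => d_K (law_K0 Theta n) (law_poisson (K + theta * ln n%:R)))
  (fun n => Num.sqrt (ln n%:R)) n1 C C0.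
- by rewrite sqrtr_gt0.
- have [_ h] := hC m nn n2 _ (tot m); exact: (d_K_le r0 Pn h).
by exists c1, c2; split => // n n2 Pn; split; [exact: hc1 | exact: hc2].
Qed.

Theorem lemma4p6 (R : realType) (Theta : nat -> R)
  (Theta_ge0 : forall m : nat, (1 <= m)%N -> 0 <= Theta m)
  (r theta K : R) (theta_gt0 : 0 < theta) :
  (gTheta_class_F Theta r theta K%:C ->
    exists c1 c2 : R, [/\ 0 < c1, 0 < c2 &
      forall n : nat, (2 <= n)%N -> 0 < hTheta Theta n ->
        0 < K + theta * ln n%:R ->
        d_loc (law_K0 Theta n) (law_poisson (K + theta * ln n%:R))
          <= c1 / ln n%:R /\
        d_K (law_K0 Theta n) (law_poisson (K + theta * ln n%:R))
          <= c2 / Num.sqrt (ln n%:R)])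
  /\
  (forall gamma : R, gTheta_class_eF Theta r theta gamma K%:C ->
    exists c3 : R, 0 < c3 /\
      forall n : nat, (2 <= n)%N -> 0 < hTheta Theta n ->
        0 < K + theta * ln n%:R ->
        d_loc (law_K0 Theta n) (law_poisson (K + theta * ln n%:R))
          <= c3 / ln n%:R).
Proof.
split=> [hF|gamma hF].
  have [_ [_ [r0 _ _]]] := hF.
  have [c1 [c2 [c10 c20 h]]] := regular_beta_bound theta_gt0 r0 (class_F_regular hF).
  by exists c1, c2; split=> // n n2 _; exact: h.
have [_ [_ [r0 _ _ _]]] := hF.
have [c1 [c2 [c10 _ h]]] := regular_beta_bound theta_gt0 r0 (class_eF_regular hF).
by exists c1; split=> // n n2 _ l0; have [] := h n n2 l0.
Qed.
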